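(* Fix a positive integer $w$. For every $\epsilon>0$ there is a $K$ such that every finite poset $P$ of width at most $w$ with $\pi(P)>K$ satisfies $\delta(P)>1/2-\epsilon$.
   Context: All posets are finite. The width of $P$ is the maximum size of an antichain. For a uniformly random linear extension $\prec$ of $P$ and distinct $x,y\in P$, $\delta_{xy}=\min\{\mathbb{P}(x\prec y),\mathbb{P}(y\prec x)\}$ and $\delta(P)=\max\delta_{xy}$ over distinct $x,y\in P$. For $x\in P$, $\pi(x)$ is the number of elements of $P$ incomparable to $x$, and $\pi(P)=\max_{x\in P}\pi(x)$. *)

(* Defs.v *)
From HB Require Import structures.
From mathcomp Require Import all_boot all_order all_algebra.

Set Implicit Arguments.
Unset Strict Implicit.
Unset Printing Implicit Defensive.

Import Order.TTheory GRing.Theory Num.Theory.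
Local Open Scope ring_scope.

Section PosetParameters.
Context {d : Order.disp_t} (P : finPOrderType d).
Implicit Types (x y z : P) (A : {set P}) (L : {set P * P}).

Definition antichain A : bool :=
  [forall x in A, forall y in A, (x != y) ==> (x >< y)%O].

Definition width : nat := \max_(A : {set P} | antichain A) #|A|.

Definition incomp_count x : nat := #|[set y : P | (x >< y)%O]|.

Definition max_incomp_count : nat := \max_(x : P) incomp_count x.

(* A linear extension is encoded as the graph of its strict order: a pair
   (x, y) belongs to L iff x precedes y. *)
Definition linear_extension L : bool :=
  [&& [forall x : P, (x, x) \notin L],
      [forall x : P, forall y : P, forall z : P,
         ((x, y) \in L) && ((y, z) \in L) ==> ((x, z) \in L)],
      [forall x : P, forall y : P,
         (x != y) ==> ((x, y) \in L) || ((y, x) \in L)]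
    & [forall x : P, forall y : P, (x < y)%O ==> ((x, y) \in L)]].

Definition linear_extensions : {set {set P * P}} :=
  [set L | linear_extension L].

Definition prob_prec (R : realFieldType) x y : R :=
  #|[set L in linear_extensions | (x, y) \in L]|%:R / #|linear_extensions|%:R.

Definition balance_pair (R : realFieldType) x y : R :=
  Num.min (prob_prec R x y) (prob_prec R y x).

(* Every balance_pair is nonnegative, so the base value 0 only matters when P
   has no two distinct elements. *)
Definition balance (R : realFieldType) : R :=
  \big[Num.max/0]_(p : P * P | p.1 != p.2) balance_pair R p.1 p.2.

End PosetParameters.

(* Main.v *)
Require Import Defs.
From mathcomp Require Import all_boot all_fingroup all_order all_algebra reals.
From mathcomp Require Import zify ring lra.

Set Implicit Arguments.
Unset Strict Implicit.
Unset Printing Implicit Defensive.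

Import Order.TTheory GRing.Theory Num.Theory.
Local Open Scope ring_scope.

(** Linear extensions are replaced by order-preserving maps [f] into [0, m) with m
    huge: such a map is injective with probability close to 1, and an injective one is
    a linear extension together with an independent uniform n-subset of [0, m).

    Given two independent maps and a shift, each element gets the interval between its
    two positions.  On a connected component of touching intervals the two maps can be
    exchanged.  This yields log-concavity of the position of one element relative to
    another, hence geometric tails.  At most [w] components meet a given level, and
    exchanging them shows that the expected number of elements crossing a level varies
    with the level by at most O(w) times the mean fluctuation of the number of elements
    in a window.  That fluctuation is of square root order, since away from the ends
    the elements form a uniform subset of a circle.  So if many elements are
    concentrated relative to [c] on scale [r] near [c], the same holds at all positions
    up to about [r ^ 2] from [c].

    If no pair is balanced, an element that has to cross this path of concentrated
    elements does so next to one of them, with probability gap at least [2 eps], and is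
    therefore within O(r) of it.  Thus closeness on scale [t] improves to scale
    [sqrt (k t)], where [2 ^ - k] is the error probability; four iterations leave every
    element undecided against at most [s] others, [s] a small power of the maximal
    number [Pi] of incomparable elements.  All ranks are then within O(s) of their
    median.  But some incomparable pair has median ranks of order [Pi] apart, which
    gives an up-set [U] whose density [p] along the ranks stays away from 0 and 1 over
    a range of order [Pi].  Swapping adjacent ranks shows that on a suitable window the
    membership pattern in [U] is almost exchangeable, so the difference between the
    counts in the two halves of the window has a large second moment, contradicting
    the concentration of the ranks. *)

(** * Expectations over finite types, and swapping components *)

(** Exchanging components can make two values coincide, so it does not act on linear extensions; it
    does act on order-preserving maps, and a large range makes collisions negligible. The range has
    size [#|T| * D]: consecutive elements are about [D] apart, and lengths are measured in multiples
    of [D]. The circle argument fails for an anchor near an end of the range, which is why [P] is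
    first padded by long chains.

    The exponents come from the endgame. Choose [v] with [v ^ 128 <= Pi < v.+1 ^ 128] and take
    [k = v], so that the error [2 ^ - v] beats every power of [Pi]. One step takes the scale [v ^ i]
    to about [v ^ ((i + 1) / 2 + 1)], the last factor absorbing all constants, and the scale runs
    through the powers 129, 66, 35, 19, 11, which yields [s = v ^ 13]. The variance argument needs a
    window length [L] of order [v * s ^ 3], and finding a window on which the density hardly rises
    needs [5 * L ^ 2] consecutive ones. Their total length is of order [v ^ 120], below [Pi]; three
    steps would leave [s] near [v ^ 21] and a total far above [Pi]. *)

Section Expectation.
Context {R : realFieldType} {W : finType}.
Implicit Types (X Y : W -> R) (A B : pred W).

Definition expect X : R := (\sum_w X w) / #|W|%:R.
Definition prob A : R := expect (fun w => (A w)%:R).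

Lemma eq_expect X Y : X =1 Y -> expect X = expect Y.
Proof. by move=> XY; rewrite /expect (eq_bigr _ (fun w _ => XY w)). Qed.

Lemma eq_prob A B : A =1 B -> prob A = prob B.
Proof. by move=> AB; apply: eq_expect => w; rewrite AB. Qed.

Lemma expectD X Y : expect (fun w => X w + Y w) = expect X + expect Y.
Proof. by rewrite /expect big_split mulrDl. Qed.

Lemma expectN X : expect (fun w => - X w) = - expect X.
Proof. by rewrite /expect sumrN mulNr. Qed.

Lemma expectB X Y : expect (fun w => X w - Y w) = expect X - expect Y.
Proof. by rewrite expectD expectN. Qed.

Lemma expectZ a X : expect (fun w => a * X w) = a * expect X.
Proof. by rewrite /expect -mulr_sumr mulrA. Qed.

Lemma expect_sum (I : Type) (r : seq I) (Q : pred I) (X : I -> W -> R) :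
  expect (fun w => \sum_(i <- r | Q i) X i w) = \sum_(i <- r | Q i) expect (X i).
Proof. by rewrite /expect exchange_big /= mulr_suml. Qed.

Lemma ler_expect X Y : (forall w, X w <= Y w) -> expect X <= expect Y.
Proof.
move=> XY; rewrite /expect ler_wpM2r ?invr_ge0 ?ler0n //.
by apply: ler_sum => w _.
Qed.

Lemma expect_ge0 X : (forall w, 0 <= X w) -> 0 <= expect X.
Proof.
by move=> X0; rewrite /expect divr_ge0 ?ler0n // sumr_ge0.
Qed.

Lemma ler_norm_expect X : `|expect X| <= expect (fun w => `|X w|).
Proof.
rewrite /expect normrM [`|_^-1|]ger0_norm ?invr_ge0 ?ler0n //.
by rewrite ler_wpM2r ?invr_ge0 ?ler0n // ler_norm_sum.
Qed.

Lemma le_prob A B : (forall w, A w -> B w) -> prob A <= prob B.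
Proof.
move=> AB; apply: ler_expect => w; rewrite ler_nat.
by case: (A w) (AB w) => // ->.
Qed.

Lemma prob_ge0 A : 0 <= prob A.
Proof. by apply: expect_ge0 => w; rewrite ler0n. Qed.

Lemma expect_bij (s : W -> W) X : involutive s -> expect (fun w => X (s w)) = expect X.
Proof.
move=> sI; rewrite /expect [in RHS](reindex_inj (inv_inj sI)) /=.
by [].
Qed.

Lemma markov X t : 0 < t -> (forall w, 0 <= X w) ->
  prob (fun w => t <= X w) <= expect X / t.
Proof.
move=> t0 X0; rewrite ler_pdivlMr // mulrC -expectZ; apply: ler_expect => w.
by case: (leP t (X w)) => h; rewrite ?mulr1 // mulr0 X0.
Qed.

Lemma probU A B : prob (fun w => A w || B w) <= prob A + prob B.
Proof.
rewrite -expectD; apply: ler_expect => w.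
by case: (A w); case: (B w); rewrite /= ?addr0 ?add0r ?lerDl ?ler01.
Qed.

Section Nonempty.
Context (W0 : (0 < #|W|)%N).

Lemma expect_cst a : expect (fun=> a) = a.
Proof.
rewrite /expect sumr_const -[a *+ _]mulr_natr mulfK //.
by rewrite pnatr_eq0 -lt0n.
Qed.

Lemma prob_le1 A : prob A <= 1.
Proof. by rewrite -(expect_cst 1); apply: ler_expect => w; rewrite lern1 leq_b1. Qed.

Lemma probC A : prob (fun w => ~~ A w) = 1 - prob A.
Proof.
rewrite -[X in X - _](expect_cst 1) -expectB; apply: eq_expect => w.
by case: (A w); rewrite /= ?subrr ?subr0.
Qed.

End Nonempty.
End Expectation.

Section Pairs.
Context {R : realFieldType} {W W' : finType}.

Lemma expect_pair (X : W -> R) (Y : W' -> R) :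
  expect (fun p : W * W' => X p.1 * Y p.2) = expect X * expect Y.
Proof.
rewrite /expect card_prod natrM invfM -!mulrA [RHS]mulrCA.
rewrite -(pair_bigA _ (fun x y => X x * Y y)) /=.
under eq_bigr do rewrite -mulr_sumr.
rewrite -mulr_suml; ring.
Qed.

Lemma prob_pair (A : pred W) (B : pred W') :
  prob (fun p : W * W' => A p.1 && B p.2) = prob A * prob B :> R.
Proof.
rewrite -expect_pair; apply: eq_expect => w.
by case: (A _); case: (B _); rewrite /= ?mulr0 ?mulr1 ?mul0r.
Qed.

Lemma expect_fst (X : W -> R) : (0 < #|W'|)%N ->
  expect (fun p : W * W' => X p.1) = expect X.
Proof.
move=> W0; rewrite -[RHS]mulr1 -[X in _ * X](expect_cst (W := W')) // -expect_pair.
by apply: eq_expect => p; rewrite mulr1.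
Qed.

Lemma expect_snd (Y : W' -> R) : (0 < #|W|)%N ->
  expect (fun p : W * W' => Y p.2) = expect Y.
Proof.
move=> W0; rewrite -[RHS]mul1r -[X in X * _](expect_cst (W := W)) // -expect_pair.
by apply: eq_expect => p; rewrite mul1r.
Qed.

End Pairs.

(** * Exchanging two solutions of difference constraints *)

Section Swap.
Context {V : finType} (gap : V -> V -> option int) (beta : int).
Implicit Types (X Y : V -> int) (A : {set V}).

(** Monotonicity and the bounds of the range are both difference constraints. These are invariant
    under translation, so positions may be measured from an anchor, and one exchange argument serves
    for all of them. *)
Definition satisfies X := forall a b k, gap a b = Some k -> X a + k <= X b.

Definition lower_end X Y v : int := Num.min (X v + beta) (Y v).
Definition upper_end X Y v : int := Num.max (X v + beta) (Y v).

Definition intervals X Y : {ffun V ->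
  int * int} := [ffun v => (lower_end X Y v, upper_end X Y v)].

(* I_a + k meets I_b for the half-open integer intervals I = (lo, hi]. *)
Definition contact (I : {ffun V -> int * int}) a b :=
  if gap a b is Some k then
    Num.max ((I a).1 + k) (I b).1 < Num.min ((I a).2 + k) (I b).2
  else false.

Definition adjacent I a b := contact I a b || contact I b a.

Lemma adjacent_sym I : symmetric (adjacent I).
Proof. by move=> a b; rewrite /adjacent orbC. Qed.

Definition component I a : {set V} := [set v | connect (adjacent I) a v].

(** On [A] the first map shifted up by [beta] trades places with the second; undoing the shift
    explains the two signs. *)
Definition swap1 A X Y v : int := if v \in A then Y v - beta else X v.
Definition swap2 A X Y v : int := if v \in A then X v + beta else Y v.

(** The ends of an interval are symmetric in [X + beta] and [Y]. Hence a set chosen from the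
    intervals alone is chosen again after the exchange, which makes the exchange an involution. *)
Lemma intervals_swap A X Y : intervals (swap1 A X Y) (swap2 A X Y) = intervals X Y.
Proof.
apply/ffunP => v; rewrite !ffunE /lower_end /upper_end /swap1 /swap2.
by case: ifP => // _; congr pair; lia.
Qed.

Definition adjacent_closed I A := forall a b, adjacent I a b -> a \in A -> b \in A.

Lemma component_closed I a : adjacent_closed I (component I a).
Proof.
move=> x y xy; rewrite !inE => ax; exact: connect_trans ax (connect1 xy).
Qed.

(** A constrained pair in contact is swapped together or not at all. Without contact, the ends of
    [I_a + k] are at most the corresponding ends of [I_b], so disjointness puts all of [I_a + k]
    below [I_b] and any mixture of the two maps is admissible. *)
Lemma swap_satisfies A X Y : adjacent_closed (intervals X Y) A ->
  satisfies X -> satisfies Y ->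
  satisfies (swap1 A X Y) /\ satisfies (swap2 A X Y).
Proof.
move=> cA sX sY; suff H a b k : gap a b = Some k ->
    swap1 A X Y a + k <= swap1 A X Y b /\ swap2 A X Y a + k <= swap2 A X Y b.
  by split=> a b k /H [].
move=> kab; have := sX _ _ _ kab; have := sY _ _ _ kab.
have ab : adjacent (intervals X Y) a b || ~~ adjacent (intervals X Y) a b by case:
  adjacent.
rewrite /swap1 /swap2; case/orP: ab => ab.
  have -> : (b \in A) = (a \in A).
    by apply/idP/idP; apply: cA; rewrite // adjacent_sym.
  by case: ifP; lia.
have : ~~ contact (intervals X Y) a b by move: ab; rewrite negb_or => /andP[].
rewrite /contact kab !ffunE /= /lower_end /upper_end.
by case: (a \in A); case: (b \in A); lia.
Qed.

(* If only one of [a] and [b] rises, then either constraint separates their half-open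
   intervals. *)
Lemma rising_adjacent X Y a b : satisfies X -> satisfies Y ->
  adjacent (intervals X Y) a b ->
  X a + beta < Y a -> X b + beta < Y b.
Proof.
move=> sX sY /orP[]; rewrite /contact; case E: gap => [k|//];
  rewrite !ffunE /= /lower_end /upper_end; have := sX _ _ _ E; have := sY _ _ _ E; lia.
Qed.

Lemma rising_component X Y a b : satisfies X -> satisfies Y ->
  b \in component (intervals X Y) a ->
  X a + beta < Y a -> X b + beta < Y b.
Proof.
move=> sX sY; rewrite inE => /connectP[p]; elim: p a => [|x p IH] a /=.
  by move=> _ ->.
move=> /andP[ax xp] bl aY; apply: (IH x) => //; exact: (rising_adjacent sX sY ax).
Qed.

End Swap.

(** * Order-preserving maps seen from an anchor *)

Section OrderPreserving.
Context {T : finType} (lt : rel T) (m : nat).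

Definition op_map (f : {ffun T -> 'I_m}) : bool :=
  [forall x, forall y, lt x y ==> (f x <= f y)%N].

Definition OP := {f : {ffun T -> 'I_m} | op_map f}.

Definition value (f : OP) (z : T) : int := Posz (val f z).

Lemma value_mono (f : OP) x y : lt x y -> value f x <= value f y.
Proof. by have /forallP/(_ x)/forallP/(_ y)/implyP h := valP f; exact: h. Qed.

Lemma value_ge0 (f : OP) z : 0 <= value f z. Proof. by []. Qed.
Lemma value_lt (f : OP) z : value f z <= m%:Z - 1.
Proof. have := ltn_ord (val f z); rewrite /value; lia. Qed.

Lemma value_inj (f g : OP) : value f =1 value g -> f = g.
Proof.
move=> fg; apply: val_inj; apply/ffunP => z; apply: val_inj.
by have := fg z; rewrite /value => -[].
Qed.

(* [None] is the bottom end of the range; the constraint from [Some _] to [None]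
   expresses that all positions lie at most [m - 1] above it. *)
Definition order_gap (a b : option T) : option int :=
  match a, b with
  | Some x, Some y => if lt x y then Some 0 else None
  | None, Some _ => Some 0
  | Some _, None => Some (1 - m%:Z)
  | None, None => None
  end.

Context (c : T).

(* Positions relative to [c]; [None] stands for the bottom end of the range. *)
Definition frame (f : OP) (v : option T) : int :=
  (if v is Some z then value f z else 0) - value f c.

Lemma frame_c f : frame f (Some c) = 0. Proof. by rewrite /frame subrr. Qed.

Lemma frame_sat f : satisfies order_gap (frame f).
Proof.
move=> [x|] [y|] k //=; rewrite /frame.
- case: ifP => // xy [<-]; have := value_mono f xy; lia.
- by move=> [<-]; have := value_lt f x; lia.
- by move=> [<-]; have := value_ge0 f y; lia.
Qed.

(** The value of [z] is recovered as its height above [None]; the constraints through [None] keep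
    this height between 0 and [m - 1]. *)
Lemma unframe_ex (X : option T -> int) : satisfies order_gap X -> X (Some c) = 0 ->
  {f : OP | frame f =1 X}.
Proof.
move=> sX Xc.
have lo z : X None <= X (Some z).
  by have := sX None (Some z) 0 erefl; lia.
have hi z : X (Some z) - X None < m%:Z.
  by have := sX (Some z) None _ erefl; lia.
have bd z : (absz (X (Some z) - X None) < m)%N by have := lo z; have := hi z; lia.
pose F := [ffun z => Ordinal (bd z)].
have FP : op_map F.
  apply/forallP => x; apply/forallP => y; apply/implyP => xy; rewrite !ffunE /=.
  have := sX (Some x) (Some y) 0; rewrite /= xy => /(_ erefl).
  by have := lo x; have := lo y; lia.
exists (exist _ F FP) => -[z|]; rewrite /frame /value /= !ffunE /=.
  by have := lo z; have := lo c; lia.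
by have := lo c; lia.
Qed.

Lemma frame_inj f g : frame f =1 frame g -> f = g.
Proof.
move=> fg; apply: value_inj => z.
by have := fg (Some z); have := fg None; rewrite /frame; lia.
Qed.

Context (beta : int).

Definition pair_intervals (p : OP * OP) := intervals beta (frame p.1) (frame p.2).

Context (sel : {ffun option T -> int * int} -> {set option T}).

Context (sel_closed : forall I, adjacent_closed order_gap I (sel I))
        (sel_c : forall I, Some c \notin sel I).

(** Keeping the anchor out of the selected set leaves both maps at 0 there, so the swapped positions
    are again frames. *)
Lemma swap_ex (p : OP * OP) : {q : OP * OP |
  frame q.1 =1 swap1 beta (sel (pair_intervals p)) (frame p.1) (frame p.2) /\
  frame q.2 =1 swap2 beta (sel (pair_intervals p)) (frame p.1) (frame p.2)}.
Proof.
have [s1 s2] := swap_satisfies (sel_closed (I := pair_intervals p)) (@frame_sat p.1)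
  (@frame_sat p.2).
have [|f fE] := unframe_ex s1.
  by rewrite /swap1 (negbTE (sel_c _)) frame_c.
have [|g gE] := unframe_ex s2.
  by rewrite /swap2 (negbTE (sel_c _)) frame_c.
by exists (f, g).
Qed.

Definition swap_pair p := sval (swap_ex p).

Lemma swap_pair1 p : frame (swap_pair p).1 =1 swap1 beta (sel (pair_intervals p)) (frame
  p.1) (frame p.2).
Proof. by rewrite /swap_pair; case: swap_ex => q []. Qed.
Lemma swap_pair2 p : frame (swap_pair p).2 =1 swap2 beta (sel (pair_intervals p)) (frame
  p.1) (frame p.2).
Proof. by rewrite /swap_pair; case: swap_ex => q []. Qed.

Lemma pair_intervals_swap p : pair_intervals (swap_pair p) = pair_intervals p.
Proof.
rewrite /pair_intervals -[RHS](intervals_swap beta (sel (pair_intervals p)));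
  apply/ffunP => v.
by rewrite !ffunE /lower_end /upper_end !swap_pair1 !swap_pair2.
Qed.

Lemma swap_pairK : involutive swap_pair.
Proof.
move=> p; rewrite [p in RHS]surjective_pairing [LHS]surjective_pairing; congr pair.
  apply: frame_inj => v; rewrite swap_pair1 pair_intervals_swap /swap1 swap_pair1
    swap_pair2 /swap1 /swap2.
  by case: (v \in _) => //; lia.
apply: frame_inj => v; rewrite swap_pair2 pair_intervals_swap /swap2 swap_pair1
  swap_pair2 /swap1 /swap2.
by case: (v \in _) => //; lia.
Qed.

End OrderPreserving.

(** * Log-concavity and level fluxes *)

Section SwapInequalities.
Context {R : realFieldType} {T : finType} (lt : rel T) (m : nat) (c : T).
Local Notation OPm := (OP lt m).
Local Notation X f z := (frame c f (Some z)).
Local Notation gapm := (order_gap lt m).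

Section Choice.
Context (beta : int) (beta0 : 0 <= beta) (u : T)
        (Q : pred {ffun option T -> int * int}).

(** The condition depends on the intervals only, so it is unchanged by the swap that it triggers. *)
Definition swap_event I := Q I && (Some c \notin component gapm I (Some u)).

Definition swap_set I : {set option T} :=
  if swap_event I then component gapm I (Some u) else set0.

Lemma swap_set_closed I : adjacent_closed gapm I (swap_set I).
Proof.
rewrite /swap_set; case: ifP => _; first exact: component_closed.
by move=> a b _; rewrite inE.
Qed.

Lemma swap_set_anchor I : Some c \notin swap_set I.
Proof. by rewrite /swap_set; case: ifP => [/andP[]//|_]; rewrite inE. Qed.

Definition component_swap := swap_pair beta swap_set_closed swap_set_anchor.

Lemma component_swapK : involutive component_swap. Proof. exact: swap_pairK. Qed.

Lemma pair_intervals_component_swap p : pair_intervals c beta (component_swap p) =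
  pair_intervals c beta p.
Proof. exact: pair_intervals_swap. Qed.

Lemma component_swap1 p z : swap_event (pair_intervals c beta p) ->
  Some z \in component gapm (pair_intervals c beta p) (Some u) ->
  X (component_swap p).1 z = X p.2 z - beta.
Proof. by move=> e h; rewrite /component_swap swap_pair1 /swap1 /swap_set e h. Qed.

Lemma component_swap2 p z : swap_event (pair_intervals c beta p) ->
  Some z \in component gapm (pair_intervals c beta p) (Some u) ->
  X (component_swap p).2 z = X p.1 z + beta.
Proof. by move=> e h; rewrite /component_swap swap_pair2 /swap2 /swap_set e h. Qed.

Lemma component_swap1_out p z :
  Some z \notin component gapm (pair_intervals c beta p) (Some u) ->
  X (component_swap p).1 z = X p.1 z.
Proof.
move=> h; rewrite /component_swap swap_pair1 /swap1 /swap_set; case: swap_event;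
  first by rewrite (negbTE h).
by rewrite inE.
Qed.

Lemma component_swap2_out p z :
  Some z \notin component gapm (pair_intervals c beta p) (Some u) ->
  X (component_swap p).2 z = X p.2 z.
Proof.
move=> h; rewrite /component_swap swap_pair2 /swap2 /swap_set; case: swap_event;
  first by rewrite (negbTE h).
by rewrite inE.
Qed.

Lemma rising_not_anchor (p : OPm * OPm) : X p.1 u + beta < X p.2 u ->
  Some c \notin component gapm (pair_intervals c beta p) (Some u).
Proof.
move=> h; apply/negP => cu.
have := rising_component (frame_sat c p.1) (frame_sat c p.2) cu h.
by rewrite !frame_c; lia.
Qed.

End Choice.

(* Swap the component of [z]: it does not contain the anchor [c], which does not rise. *)
Lemma log_concave (beta : int) (z : T) (A B : pred int) : 0 <= beta ->
  (forall x y, A x -> B y -> beta < y - x) ->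
  prob (fun f : OPm => A (X f z)) * prob (fun f : OPm => B (X f z)) <=
  prob (fun f : OPm => B (X f z + beta)) * prob (fun f : OPm => A (X f z - beta)) :> R.
Proof.
move=> b0 AB; rewrite -!prob_pair.
rewrite -[leRHS](expect_bij _ (component_swapK beta z predT)).
apply: le_prob => p /andP[pA pB].
have pos : X p.1 z + beta < X p.2 z by have := AB _ _ pA pB; lia.
have ev : swap_event z predT (pair_intervals c beta p) by rewrite /swap_event /=
  rising_not_anchor.
have zz : Some z \in component gapm (pair_intervals c beta p) (Some z) by rewrite inE.
by rewrite component_swap1 // component_swap2 // subrK addrK pB.
Qed.

(* The expected number of points that cross the level [a] upwards when the first map,
   shifted up by [beta], is replaced by the second. *)
Definition Fbar (beta a : int) : R :=
  \sum_z prob (fun f : OPm => X f z < a - beta) * prob (fun f : OPm => a <= X f z).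

Section Flux.
Context (w : nat) (lt_irr : irreflexive lt)
  (wT : forall A : {set T}, {in A &, forall x y, ~~ lt x y} -> (#|A| <= w)%N).
Context (beta : int) (beta0 : 0 <= beta) (a a' : int).

Local Notation sp := (pair_intervals c beta).
Local Notation intervals_t := {ffun option T -> int * int}.

Definition straddles (l : int) (I : intervals_t) (z : T) := (I (Some z)).1 < l <= (I
  (Some z)).2.
Definition straddles_any I z := straddles a I z || straddles a' I z.
(** [pick] sees only the component of [z], so two straddling points of one component receive the
    same representative. *)
Definition rep_of I z := odflt z [pick u | (Some u \in component gapm I (Some z)) &&
  straddles_any I u].
Definition is_rep I z := (rep_of I z == z) && straddles_any I z.

Lemma component_sym I (x y : option T) : (x \in component gapm I y) = (y \in component
  gapm I x).
Proof. by rewrite !inE (sym_connect_sym (adjacent_sym gapm I)). Qed.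

Lemma component_eq I x y : x \in component gapm I y ->
  component gapm I x = component gapm I y.
Proof.
move=> xy; apply/setP => v; move: (xy); rewrite !inE => yx.
by rewrite (same_connect (sym_connect_sym (adjacent_sym gapm I)) yx).
Qed.

Lemma straddles_any_rep I z : straddles_any I z ->
  [/\ Some (rep_of I z) \in component gapm I (Some z) & straddles_any I (rep_of I z)].
Proof.
move=> sz; rewrite /rep_of; case: pickP => [x /andP[]//|/(_ z)].
by rewrite sz inE connect0.
Qed.

Lemma rep_of_component I z y : straddles_any I z -> straddles_any I y ->
  Some z \in component gapm I (Some y) -> rep_of I z = rep_of I y.
Proof.
move=> sz sy zy; rewrite /rep_of (eq_pick (Q := fun u =>
  (Some u \in component gapm I (Some y)) && straddles_any I u)).
  by case: pickP => // /(_ y); rewrite sy inE connect0.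
by move=> x /=; rewrite (component_eq zy).
Qed.

Lemma is_rep_rep_of I z : straddles_any I z -> is_rep I (rep_of I z).
Proof.
move=> sz; have [h1 h2] := straddles_any_rep sz; rewrite /is_rep h2 andbT.
by apply/eqP/rep_of_component.
Qed.

Lemma straddles_component I l x y : lt x y -> straddles l I x -> straddles l I y ->
  Some y \in component gapm I (Some x).
Proof.
move=> xy /andP[h1 h2] /andP[h3 h4]; rewrite inE; apply: connect1.
by rewrite /adjacent /contact /= xy; apply/orP; left; lia.
Qed.

(* Straddling points of different components are incomparable, so for each of the two
   levels the representatives form an antichain. *)
Lemma card_is_rep I : (#|[set z | is_rep I z]| <= 2 * w)%N.
Proof.
have K l : (l = a \/ l = a') -> (#|[set z | is_rep I z && straddles l I z]| <= w)%N.
  move=> la; apply: wT => x y; rewrite !inE =>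
    /andP[/andP[/eqP rx sx] lx] /andP[/andP[/eqP ry sy] ly].
  apply/negP => xy; have := rep_of_component sy sx (straddles_component xy lx ly).
  by rewrite rx ry => E; move: xy; rewrite E lt_irr.
apply: leq_trans (_ : #|[set z | is_rep I z && straddles a I z] :|: [set z | is_rep I z
  && straddles a' I z]| <= _)%N.
  apply/subset_leq_card/subsetP => z; rewrite !inE => rz; rewrite rz /=.
  by case/andP: rz.
have := K a (or_introl erefl); have := K a' (or_intror erefl).
have := cardsUI [set z | is_rep I z && straddles a I z] [set z | is_rep I z && straddles
  a' I z].
lia.
Qed.

(** For [a' <= a] the sum over [z] is the count of the first map in [[a' - beta, a - beta)] minus
    that of the second in [[a', a)]. Window fluctuations control this sum, which they do not do
    directly for the one-sided [cross_change]. *)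
Definition level_change (p : OPm * OPm) z : int :=
  ((X p.1 z + beta < a)%R%:Z - (X p.2 z < a)%R%:Z)
  - ((X p.1 z + beta < a')%R%:Z - (X p.2 z < a')%R%:Z).

Definition cross_change (p : OPm * OPm) z : int :=
  (X p.1 z + beta < a <= X p.2 z)%R%:Z - (X p.1 z + beta < a' <= X p.2 z)%R%:Z.

Definition level_diff p : int := \sum_z level_change p z.

Definition rising (p : OPm * OPm) z := X p.1 z + beta < X p.2 z.

Lemma level_change0 p z : ~~ straddles_any (sp p) z -> level_change p z = 0.
Proof. by rewrite /straddles_any /straddles /level_change !ffunE /= /lower_end
  /upper_end; lia. Qed.

Lemma cross_changeE p z : cross_change p z = if rising p z && straddles_any (sp p) z
  then level_change p z else 0.
Proof.
case: ifP.
  by move=> /andP[]; rewrite /rising /straddles_any /straddles /cross_change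
    /level_change !ffunE /= /lower_end /upper_end; lia.
by rewrite /rising /straddles_any /straddles /cross_change /level_change !ffunE /=
  /lower_end /upper_end; lia.
Qed.

Definition flux p u : int := \sum_(z | Some z \in component gapm (sp p) (Some u))
  level_change p z.

Lemma rising_same_component p x y : Some x \in component gapm (sp p) (Some y) ->
  rising p x = rising p y.
Proof.
move=> xy; apply/idP/idP; last exact: (rising_component (frame_sat c p.1) (frame_sat c
  p.2) xy).
by move: xy; rewrite component_sym => yx;
  exact: (rising_component (frame_sat c p.1) (frame_sat c p.2) yx).
Qed.

(** Rising is constant on components: on a rising component the one-sided change equals the full
    one, and the other components contribute nothing. *)
Lemma sum_cross_change p : \sum_z cross_change p z = \sum_(u | is_rep (sp p) u && rising
  p u) flux p u.
Proof.
under eq_bigr do rewrite cross_changeE; rewrite -big_mkcond /=.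
rewrite (partition_big (rep_of (sp p)) (fun u => is_rep (sp p) u && rising p u)) /=;
  last first.
  move=> z /andP[pz sz]; rewrite is_rep_rep_of //=; have [h _] := straddles_any_rep sz.
  by rewrite (rising_same_component h).
apply: eq_bigr => u /andP[/andP[/eqP ru su] pu]; rewrite /flux.
rewrite [RHS](bigID (straddles_any (sp p))) /= [Z in _ = _ + Z]big1 ?addr0; last first.
  by move=> z /andP[_ /level_change0].
apply: eq_bigl => z; apply/idP/idP.
  move=> /andP[/andP[pz sz] /eqP rz]; rewrite sz andbT;
    have [h _] := straddles_any_rep sz.
  by rewrite component_sym -rz.
move=> /andP[zu sz]; rewrite sz (rising_same_component zu) pu /=.
by rewrite (rep_of_component sz su zu) ru.
Qed.

(** The swap negates the contribution of the component of [u] to [level_diff] and leaves the rest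
    alone, so the two values differ by twice the flux. *)
Lemma norm_flux p u : swap_event u (is_rep^~ u) (sp p) ->
  `|flux p u| *+ 2 <= `|level_diff p| + `|level_diff (component_swap beta u (is_rep^~ u)
    p)|.
Proof.
set q := component_swap _ _ _ _ => ev.
suff E : flux p u *+ 2 = level_diff p - level_diff q.
  by rewrite -normrMn E; exact: ler_normB.
rewrite /level_diff -sumrB (bigID (fun z =>
  Some z \in component gapm (sp p) (Some u))) /=.
rewrite [Z in _ = _ + Z]big1 ?addr0.
  rewrite -sumrMnl; apply: eq_bigr => z zu.
  by rewrite /level_change /q (component_swap1 ev) // (component_swap2 ev) //; lia.
by move=> z zu; rewrite /level_change /q component_swap1_out // component_swap2_out //
  subrr.
Qed.

(** The swap preserves both the law of the pair and its event, so the mean flux of a representative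
    is at most the mean of [level_diff] in absolute value on that event. At most [2 * w] of these
    events occur at once. *)
Lemma Fbar_close :
  `|Fbar beta a - Fbar beta a'| <= (2 * w)%:R * expect (fun p =>
    (`|level_diff p|%:~R : R)).
Proof.
have FE l : Fbar beta l = expect (fun p : OPm * OPm =>
  \sum_z ((X p.1 z + beta < l <= X p.2 z)%R%:R : R)).
  rewrite expect_sum; apply: eq_bigr => z _; rewrite -prob_pair; apply: eq_expect => p.
  by rewrite ltrBrDr.
rewrite !FE -expectB; apply: le_trans (ler_norm_expect _) _.
pose ev (p : OPm * OPm) u := swap_event u (is_rep^~ u) (sp p).
apply: (@le_trans _ _ (expect (fun p : OPm * OPm =>
  (\sum_u (ev p u)%:R * `|flux p u|%:~R : R)))).
  apply: ler_expect => p; rewrite -sumrB.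
  have -> : \sum_z (((X p.1 z + beta < a <= X p.2 z)%R%:R : R) - (X p.1 z + beta < a' <=
    X p.2 z)%R%:R)
     = (\sum_z cross_change p z)%:~R.
    by rewrite rmorph_sum; apply: eq_bigr => z _; rewrite /cross_change rmorphB.
  rewrite sum_cross_change (big_mkcond _ (fun u => flux p u)) /=.
  rewrite rmorph_sum /=; apply: le_trans (ler_norm_sum _ _ _) _.
  apply: ler_sum => u _; case: ifP => [/andP[ru pu]|_]; last first.
    by rewrite normr0 mulr_ge0 // ler0n.
  by rewrite /ev /swap_event ru rising_not_anchor //= mul1r intr_norm.
rewrite expect_sum.
apply: (@le_trans _ _ (\sum_u expect (fun p => (ev p u)%:R * `|level_diff p|%:~R))).
  apply: ler_sum => u _.
  set s := component_swap beta u (is_rep^~ u).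
  have sK : involutive s by exact: component_swapK.
  have two0 : (0 : R) < 2 by [].
  rewrite -(ler_pM2l two0) -[leLHS]expectZ [leRHS]mulr_natl mulr2n -[Z in _ <= _ +
    Z](expect_bij _ sK) -expectD.
  apply: ler_expect => p; rewrite /ev {2}/s pair_intervals_component_swap.
  case E : swap_event; last by rewrite !mul0r mulr0 addr0.
  have := norm_flux E; rewrite -/s !mul1r -(ler_int R) !intrD; lra.
rewrite -expect_sum -expectZ; apply: ler_expect => p; rewrite -mulr_suml.
apply: ler_wpM2r; first by rewrite ler0z.
rewrite -natr_sum ler_nat; apply: leq_trans (card_is_rep (sp p)).
rewrite -sum1_card [Z in (_ <= Z)%N]big_mkcond /=; apply: leq_sum => u _.
rewrite inE /ev /swap_event; by case: is_rep => //=; case: (_ \notin _).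
Qed.
End Flux.
End SwapInequalities.

(** * Uniform subsets *)

Section UniformSubset.
Context (R : realFieldType) (m n : nat).

Definition nsub := {S : {set 'I_m} | #|S| == n}.

Lemma perm_nsub_ex (x y : 'I_m) (S : nsub) : {S' : nsub | val S' = tperm x y @: val S}.
Proof.
have h : #|tperm x y @: val S| == n by rewrite card_imset ?(valP S) //; exact: perm_inj.
by exists (exist (fun A : {set 'I_m} => #|A| == n) _ h).
Qed.
Definition perm_nsub x y S := sval (perm_nsub_ex x y S).
Lemma perm_nsubE x y S : val (perm_nsub x y S) = tperm x y @: val S.
Proof. by rewrite /perm_nsub; case: perm_nsub_ex. Qed.
Lemma perm_nsubK x y : involutive (perm_nsub x y).
Proof.
move=> S; apply: val_inj; rewrite !perm_nsubE -imset_comp -[RHS]imset_id.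
by apply: eq_imset => z; rewrite /= tpermK.
Qed.
Lemma mem_perm_nsub x y S z : (z \in val (perm_nsub x y S)) = (tperm x y z \in val S).
Proof.
rewrite perm_nsubE -[z in LHS](tpermK x y) mem_imset //; exact: perm_inj.
Qed.

Context (W0 : (0 < #|{: nsub}|)%N).

Lemma nsub_le : (n <= m)%N.
Proof.
have /card_gt0P[S _] := W0.
by rewrite -(eqP (valP S)) -[X in (_ <= X)%N](card_ord m) max_card.
Qed.

Definition incl_prob (x : 'I_m) : R := prob (fun S : nsub => x \in val S).
Definition pair_prob (x y : 'I_m) : R := prob (fun S : nsub =>
  (x \in val S) && (y \in val S)).

Lemma incl_prob_const x y : incl_prob x = incl_prob y.
Proof.
rewrite /incl_prob /prob -(expect_bij _ (perm_nsubK x y)); apply: eq_expect => S.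
by rewrite mem_perm_nsub tpermL.
Qed.

Lemma pair_prob_const x y z : x != y -> x != z -> pair_prob x y = pair_prob x z.
Proof.
move=> xy xz; rewrite /pair_prob /prob -(expect_bij _ (perm_nsubK y z));
  apply: eq_expect => S.
by rewrite !mem_perm_nsub tpermL tpermD // eq_sym.
Qed.

Lemma card_nsub (S : nsub) (A : {set 'I_m}) :
  #|val S :&: A|%:R = \sum_(x in A) (x \in val S)%:R :> R.
Proof.
rewrite -sum1_card natr_sum big_mkcond [RHS]big_mkcond /=; apply: eq_bigr => x _.
by rewrite inE andbC; case: (x \in A) => //; case: (x \in val S).
Qed.

Lemma incl_probE x : incl_prob x = n%:R / m%:R.
Proof.
have m0 : (m%:R : R) != 0 by rewrite pnatr_eq0; case: x; lia.
apply: (mulIf m0); rewrite divfK //.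
have : expect (fun S : nsub => #|val S :&: setT|%:R : R) = n%:R.
  rewrite -[RHS](expect_cst (W := nsub)) //; apply: eq_expect => S.
  by rewrite setIT (eqP (valP S)).
rewrite (eq_expect (fun S => card_nsub S setT)) expect_sum => <-.
rewrite (eq_bigr (fun=> incl_prob x)) => [|y _]; last exact: incl_prob_const.
by rewrite sumr_const cardsT card_ord mulr_natr.
Qed.

Lemma pair_prob_le x y : x != y -> pair_prob x y <= (n%:R / m%:R) ^+ 2.
Proof.
move=> xy; have m1 : (1 < m)%N.
  rewrite -(card_ord m); apply: leq_trans (max_card (pred2 x y)).
  by rewrite card2 xy.
(* Double counting: a set that contains [x] has [n - 1] further points, and all candidates for them
   are equally likely. *)
have E : (m%:R - 1) * pair_prob x y = (n%:R - 1) * (n%:R / m%:R).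
  have H : expect (fun S : nsub => (x \in val S)%:R * #|val S :&: [set~ x]|%:R : R) =
    (n%:R - 1) * incl_prob x.
    rewrite -expectZ; apply: eq_expect => S; case xS : (x \in val S);
      last by rewrite mul0r mulr0.
    rewrite mul1r mulr1.
    have := cardsD1 x (val S); rewrite xS setDE => E;
      rewrite -[Z in Z%:R - 1](eqP (valP S)) E.
    by rewrite natrD addrAC subrr add0r.
  rewrite -(incl_probE x) -H -(_ : \sum_(z in [set~ x]) pair_prob x z = (m%:R - 1) *
    pair_prob x y).
    rewrite -expect_sum; apply: eq_expect => S; rewrite card_nsub mulr_sumr.
    by apply: eq_bigr => z _; rewrite -natrM mulnb.
  rewrite (eq_bigr (fun=> pair_prob x y)) => [|z]; last first.
    by rewrite !inE => zx; apply: pair_prob_const => //; rewrite eq_sym.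
  by rewrite sumr_const cardsC1 card_ord -[LHS]mulr_natl -subn1 natrB //; lia.
have nm := nsub_le.
have m1R : (1 : R) < m%:R by rewrite ltr1n.
have nmR : (n%:R : R) <= m%:R by rewrite ler_nat.
have n0 : (0 : R) <= n%:R by rewrite ler0n.
have m0 : (0 : R) < m%:R - 1 by lra.
rewrite -(ler_pM2l m0) E expr2 [leRHS]mulrA ler_wpM2r //;
  first by rewrite divr_ge0 ?ler0n.
rewrite mulrA ler_pdivlMr; last by lra.
nra.
Qed.

Lemma hypergeometric_mean (A : {set 'I_m}) :
  expect (fun S : nsub => #|val S :&: A|%:R : R) = #|A|%:R * (n%:R / m%:R).
Proof.
rewrite (eq_expect (fun S => card_nsub S A)) expect_sum.
rewrite (eq_bigr (fun=> n%:R / m%:R : R)) => [|y _]; last exact: incl_probE.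
by rewrite sumr_const -[LHS]mulr_natl.
Qed.

(* The variance is at most that of independent inclusions, by [pair_prob_le]. *)
Lemma hypergeometric_variance (A : {set 'I_m}) :
  expect (fun S : nsub => (#|val S :&: A|%:R - #|A|%:R * (n%:R / m%:R)) ^+ 2 : R)
  <= #|A|%:R * (n%:R / m%:R).
Proof.
set p := n%:R / m%:R; have p0 : 0 <= p by rewrite divr_ge0 ?ler0n.
have E1 : expect (fun S : nsub => #|val S :&: A|%:R : R) = #|A|%:R * p.
  exact: hypergeometric_mean.
have E2 : expect (fun S : nsub => #|val S :&: A|%:R ^+ 2 : R) <= #|A|%:R * p + (#|A|%:R
  * p) ^+ 2.
  have -> : expect (fun S : nsub => #|val S :&: A|%:R ^+ 2 : R) =
      \sum_(x in A) \sum_(y in A) pair_prob x y.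
    under [RHS]eq_bigr do rewrite -expect_sum; rewrite -expect_sum.
    apply: eq_expect => S; rewrite expr2 card_nsub mulr_suml.
    apply: eq_bigr => x _; rewrite mulr_sumr; apply: eq_bigr => y _.
    by rewrite -natrM mulnb.
  apply: le_trans (_ : \sum_(x in A) (p + #|A|%:R * p ^+ 2) <= _); last first.
    by rewrite sumr_const -[leLHS]mulr_natl le_eqVlt; apply/orP; left; apply/eqP; ring.
  apply: ler_sum => x xA; rewrite (bigD1 x) //=; apply: lerD.
    rewrite /p -(incl_probE x); apply: le_prob => S; by case: (_ \in _).
  apply: le_trans (_ : \sum_(y in A | y != x) p ^+ 2 <= _).
    by apply: ler_sum => y /andP[_ yx]; apply: pair_prob_le; rewrite eq_sym.
  apply: le_trans (_ : \sum_(y in A) p ^+ 2 <= _); last by rewrite sumr_const mulr_natl.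
  by rewrite [leRHS](bigD1 x) //= lerDr sqr_ge0.
rewrite (_ : expect _ = expect (fun S : nsub =>
  #|val S :&: A|%:R ^+ 2 : R) - (2 * #|A|%:R * p) * expect (fun S : nsub =>
  #|val S :&: A|%:R : R) + (#|A|%:R * p) ^+ 2).
  rewrite E1; lra.
rewrite -expectZ -expectB -[Z in _ + Z](expect_cst (W := nsub)) // -expectD.
by apply: eq_expect => S; ring.
Qed.
End UniformSubset.

(** * Injective maps *)

Lemma expect_bijective (R : realFieldType) (U V : finType) (h : U -> V) (X : V -> R) :
  bijective h -> expect (fun u => X (h u)) = expect X.
Proof.
move=> bh; rewrite /expect (bij_eq_card bh); congr (_ / _).
have [g hg gh] := bh; rewrite [RHS](reindex h) //=.
by exists g => x _; [exact: hg|exact: gh].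
Qed.

Section SortedEnum.
Context (m : nat).

Lemma sorted_enum_ord (A : {set 'I_m}) : sorted ltn (map val (enum A)).
Proof.
have : subseq (map val (enum A)) (iota 0 m).
  rewrite -val_enum_ord; apply: map_subseq.
  by rewrite {1}/enum_mem -enumT; exact: filter_subseq.
move=> h; apply: (subseq_sorted _ h); first exact: ltn_trans.
exact: iota_ltn_sorted.
Qed.

Lemma nth_enum_ltn (A : {set 'I_m}) x0 i j : (i < #|A|)%N -> (j < #|A|)%N ->
  (nth x0 (enum A) i < nth x0 (enum A) j)%N = (i < j)%N.
Proof.
have K i' j' : (i' < j')%N -> (j' < #|A|)%N ->
  (nth x0 (enum A) i' < nth x0 (enum A) j')%N.
  move=> ij jA; have iA : (i' < #|A|)%N by exact: ltn_trans jA.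
  rewrite -!(nth_map x0 0 val) -?cardE //; apply: (sorted_ltn_nth ltn_trans) => //.
  - exact: sorted_enum_ord.
  - by rewrite inE size_map -cardE.
  - by rewrite inE size_map -cardE.
move=> iA jA; apply/idP/idP; last by move/K; apply.
apply: contraLR; rewrite -!leqNgt leq_eqVlt => /orP[/eqP ->//|/K h].
by apply: ltnW; exact: h.
Qed.

End SortedEnum.

Section InjectiveMaps.
Context {T : finType} (lt : rel T).
Local Notation n := #|T|.

Definition INJ m := {f : {ffun T -> 'I_m} | op_map lt f && injectiveb f}.
(** An injection into [#|T|] places is a bijection, so these are the linear extensions, stored as
    rank functions. *)
Definition LE := INJ n.

Definition ival m (f : INJ m) : {ffun T -> 'I_m} := val f.
Arguments ival : simpl never.


Lemma INJ_op m (f : INJ m) x y : lt x y -> (ival f x <= ival f y)%N.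
Proof. by have /andP[/forallP/(_ x)/forallP/(_ y)/implyP h _] := valP f. Qed.

Lemma INJ_inj m (f : INJ m) : injective (ival f).
Proof. by have /andP[_ /injectiveP] := valP f. Qed.

Lemma rank_lt m (f : INJ m) z : (#|[set y | (ival f y < ival f z)%N]| < n)%N.
Proof.
rewrite -[X in (_ < X)%N]cardsT; apply: proper_card; rewrite properT.
by apply/negP => /eqP/setP/(_ z); rewrite !inE ltnn.
Qed.

Definition rankf m (f : INJ m) : {ffun T -> 'I_n} := [ffun z => Ordinal (rank_lt f z)].

Lemma rankf_lt m (f : INJ m) x y : (rankf f x < rankf f y)%N = (ival f x < ival f y)%N.
Proof.
have K u v : (ival f u < ival f v)%N -> (rankf f u < rankf f v)%N.
  move=> uv; rewrite !ffunE /=; apply: proper_card; apply/properP; split.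
    by apply/subsetP => z; rewrite !inE => h; exact: ltn_trans uv.
  by exists u; rewrite !inE ?ltnn.
apply/idP/idP; last exact: K.
apply: contraLR; rewrite -!leqNgt leq_eqVlt => /orP[/eqP e|/K/ltnW//].
by rewrite (INJ_inj (val_inj e)).
Qed.

Lemma rankP m (f : INJ m) : op_map lt (rankf f) && injectiveb (rankf f).
Proof.
apply/andP; split.
  apply/forallP => x; apply/forallP => y; apply/implyP => xy.
  by rewrite leqNgt rankf_lt -leqNgt; exact: INJ_op.
apply/injectiveP => x y e; apply: (@INJ_inj _ f); apply: val_inj; apply/eqP.
by rewrite eqn_leq leqNgt -rankf_lt e ltnn /= leqNgt -rankf_lt e ltnn.
Qed.

Definition rank m (f : INJ m) : LE := exist _ (rankf f) (rankP f).

Section Combine.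
Context (m : nat).
Implicit Types (h : LE) (S : nsub m n).

Lemma combine_bd h S z : (ival h z < #|val S|)%N.
Proof. by rewrite (eqP (valP S)). Qed.

Definition combf h S : {ffun T -> 'I_m} := [ffun z =>
  enum_val (Ordinal (combine_bd h S z))].

Lemma combf_lt h S x y : (combf h S x < combf h S y)%N = (ival h x < ival h y)%N.
Proof.
rewrite !ffunE (enum_val_nth (combf h S x)) [enum_val _ in X in (_ < X)%N](enum_val_nth
  (combf h S x)).
by rewrite nth_enum_ltn //= combine_bd.
Qed.

Lemma combP h S : op_map lt (combf h S) && injectiveb (combf h S).
Proof.
apply/andP; split.
  apply/forallP => x; apply/forallP => y; apply/implyP => xy.
  by rewrite leqNgt combf_lt -leqNgt; exact: INJ_op.
apply/injectiveP => x y e; apply: (@INJ_inj _ h); apply: val_inj; apply/eqP.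
by rewrite eqn_leq leqNgt -(combf_lt h S) e ltnn /= leqNgt -(combf_lt h S) e ltnn.
Qed.

Definition combine (p : LE * nsub m n) : INJ m := exist _ (combf p.1 p.2) (combP p.1
  p.2).

Lemma combine_lt p x y : (ival (combine p) x < ival (combine p) y)%N = (ival p.1 x <
  ival p.1 y)%N.
Proof. exact: combf_lt. Qed.

Lemma combine_im p : [set ival (combine p) z | z : T] = val p.2.
Proof.
apply/eqP; rewrite eqEcard; apply/andP; split.
  by apply/subsetP => _ /imsetP[z _ ->]; rewrite /= ffunE enum_valP.
by rewrite (eqP (valP p.2)) card_imset //; exact: INJ_inj.
Qed.

Lemma combine_inj : injective combine.
Proof.
move=> [h S] [h' S'] e; have SS : S = S'.
  by apply: val_inj; rewrite -(combine_im (h, S)) e combine_im.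
rewrite -{}SS in e *; congr pair; apply: val_inj; apply/ffunP => z.
have : combf h S z = combf h' S z by have := congr1 (fun f : INJ m => ival f z) e.
by rewrite !ffunE => /enum_val_inj/(congr1 val) /= /val_inj.
Qed.

End Combine.

(* Positions after a cyclic shift of [0, m] (where [None] sits at m) that
   brings [c] to position -1. *)
Section Rotation.
Context (m : nat) (c : T).
Implicit Types f g : INJ m.

Definition endpos f (v : option T) : nat := if v is Some z then ival f z else m.
Definition rotn f v : nat :=
  if (ival f c < endpos f v)%N then (endpos f v - ival f c).-1 else (endpos f v + m -
    ival f c)%N.

Lemma endpos_inj f : injective (endpos f).
Proof.
move=> [x|] [y|] //=.
- by move=> /val_inj/INJ_inj ->.
- by have := ltn_ord (ival f x); move=> + e; rewrite e ltnn.
- by have := ltn_ord (ival f y); move=> + e; rewrite -e ltnn.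
Qed.

Lemma endpos_le f v : (endpos f v <= m)%N.
Proof. by case: v => [z|] //=; exact: ltnW. Qed.

Lemma rotn_lt f v : v != Some c -> (rotn f v < m)%N.
Proof.
move=> vc; rewrite /rotn; have := endpos_le f v; have := ltn_ord (ival f c).
have : endpos f v != endpos f (Some c) by apply: contra vc => /eqP/endpos_inj ->.
by rewrite /=; case: ifP; lia.
Qed.

Lemma rotn_inj f u v : u != Some c -> v != Some c -> rotn f u = rotn f v -> u = v.
Proof.
move=> uc vc e; apply: (@endpos_inj f); move: e; rewrite /rotn.
have := endpos_le f u; have := endpos_le f v; have := ltn_ord (ival f c).
have : endpos f u != endpos f (Some c) by apply: contra uc => /eqP/endpos_inj ->.
have : endpos f v != endpos f (Some c) by apply: contra vc => /eqP/endpos_inj ->.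
by rewrite /=; case: ifP; case: ifP; lia.
Qed.

Definition rotset f : {set 'I_m} := [set i : 'I_m | [exists v : option T,
  (v != Some c) && (rotn f v == i)]].

Lemma mem_rotset f (i : 'I_m) : reflect (exists2 v,
  v != Some c & rotn f v = i) (i \in rotset f).
Proof.
rewrite inE; apply: (iffP existsP) => [[v /andP[h /eqP e]]|[v h e]]; exists v => //.
by rewrite h e /=.
Qed.

Lemma card_rotset f : #|rotset f| == n.
Proof.
pose D := {v : option T | v != Some c}.
pose F (d : D) : 'I_m := Ordinal (rotn_lt f (valP d)).
have Finj : injective F.
  move=> d d' /(congr1 val) /= e; apply: val_inj; exact: rotn_inj (valP d) (valP d') e.
have -> : rotset f = [set F d | d : D].
  apply/setP => i; apply/mem_rotset/imsetP => [[v h e]|[d _ ->]].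
    by exists (exist _ v h) => //; apply: val_inj; rewrite /= e.
  by exists (val d) => //; exact: (valP d).
rewrite card_imset // card_sig; apply/eqP.
rewrite (eq_card (B := predC1 (Some c))); last by move=> x; rewrite !inE.
by have := cardC1 (Some c); rewrite card_option.
Qed.

Definition rot f : nsub m n := exist _ (rotset f) (card_rotset f).

(** The top end [None] is rotated to [(m - ival f c).-1], and the elements above [c] are exactly
    those that come before it. This locates [None] in the rotated set once the ranks are known. *)
Lemma card_rotset_lt f :
  #|[set i in rotset f | (i < (m - ival f c).-1)%N]| = #|[set z | (ival f c < ival f
    z)%N]|.
Proof.
pose F z : 'I_m := insubd (ival f c) (rotn f (Some z)).
have FE z : (ival f c < ival f z)%N -> F z = (ival f z - ival f c).-1 :> nat.
  move=> cz; rewrite val_insubd /rotn /= cz; have := ltn_ord (ival f z).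
  by case: ifP => //; lia.
have -> : [set i in rotset f | (i < (m - ival f c).-1)%N] = F @: [set z | (ival f c <
  ival f z)%N].
  apply/setP => i; rewrite inE; apply/andP/imsetP => [[/mem_rotset[v vc vi] im]|[z]].
    have := ltn_ord (ival f c); case: v vc vi => [z|] vc; rewrite /rotn /=;
      last by case: ifP; lia.
    case: ifP => cz vi fcm; last by lia.
    by exists z; rewrite ?inE //; apply: ord_inj; rewrite FE // vi.
  rewrite inE => cz ->; split; last by have := ltn_ord (ival f z); rewrite FE //; lia.
  apply/mem_rotset; exists (Some z); last by rewrite FE // /rotn /= cz.
  by apply: contraTneq cz => -[->]; rewrite ltnn.
rewrite card_in_imset // => x y; rewrite !inE => cx cy /(congr1 val) /=.
by rewrite !FE // => e; apply: (@INJ_inj _ f); apply: val_inj => /=; lia.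
Qed.

Lemma endpos_rotset f (i : 'I_m) : i = (m - ival f c).-1 :> nat -> i \in rotset f.
Proof.
by move=> e; apply/mem_rotset; exists None => //; rewrite /rotn /= ltn_ord e.
Qed.

(** If [c] were lower under [f], the rotated points before [None] for [g] would be a proper part of
    those for [f], because [None] of [g] lies in between; but equal ranks make the two numbers
    equal. *)
Lemma rank_rot_le f g : rank f = rank g -> rot f = rot g -> (ival g c <= ival f c)%N.
Proof.
move=> /(congr1 val) /= rfg /(congr1 val) /= Rfg.
have lt_fg x y : (ival f x < ival f y)%N = (ival g x < ival g y)%N.
  by rewrite -!rankf_lt rfg.
rewrite leqNgt; apply/negP => fg.
have := card_rotset_lt f; rewrite (eq_card (B := [set z | (ival g c < ival g z)%N]));
  last first.
  by move=> z; rewrite !inE lt_fg.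
rewrite -card_rotset_lt -Rfg => e.
have gm := ltn_ord (ival g c).
have bd : ((m - ival g c).-1 < m)%N by lia.
have : [set i in rotset f | (i < (m - ival g c).-1)%N] \proper [set i in rotset f | (i <
  (m - ival f c).-1)%N].
  apply/properP; split.
    by apply/subsetP => i; rewrite !inE => /andP[-> h] /=; lia.
  exists (Ordinal bd); rewrite inE /= ?ltnn ?andbF //.
  by rewrite Rfg endpos_rotset //=; lia.
by move/proper_card; rewrite e ltnn.
Qed.

Lemma rank_rot_im f g : ival f c = ival g c -> rot f = rot g ->
  [set ival f z | z : T] = [set ival g z | z : T].
Proof.
have K f1 g1 : ival f1 c = ival g1 c -> rotset f1 = rotset g1 ->
  [set ival f1 z | z : T] \subset [set ival g1 z | z : T].
  move=> e R1; apply/subsetP => _ /imsetP[z _ ->].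
  have [->|zc] := eqVneq z c; first by rewrite e imset_f.
  have zc' : Some z != Some c by apply: contra zc => /eqP[->].
  have : Ordinal (rotn_lt f1 zc') \in rotset f1 by apply/mem_rotset; exists (Some z).
  rewrite R1 => /mem_rotset[v vc /=]; have := endpos_le f1 (Some z);
    have := endpos_le g1 v.
  have zc2 : endpos f1 (Some z) != endpos f1 (Some c) by apply: contra zc' =>
    /eqP/endpos_inj ->.
  have vc2 : endpos g1 v != endpos g1 (Some c) by apply: contra vc =>
    /eqP/endpos_inj ->.
  move=> h1 h2 h3; have {h1 h2 h3} : endpos g1 v = endpos f1 (Some z).
    move: h1 h2 h3 zc2 vc2; rewrite /rotn /= e; have := ltn_ord (ival g1 c).
    by case: ifP; case: ifP; lia.
  case: v vc vc2 => [y|] _ _ /= yz; last by have := ltn_ord (ival f1 z);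
    rewrite -yz ltnn.
  by rewrite -(val_inj yz) imset_f.
move=> e /(congr1 val) /= R1; apply/eqP; rewrite eqEsubset !K //.
Qed.

Lemma rank_im_inj f g : rank f = rank g ->
  [set ival f z | z : T] = [set ival g z | z : T] -> f = g.
Proof.
have K f1 g1 : rank f1 = rank g1 -> [set ival f1 z | z : T] = [set ival g1 z | z : T] ->
    forall z, (ival g1 z <= ival f1 z)%N.
  move=> /(congr1 val) /= r1 i1 z; rewrite leqNgt; apply/negP => fg.
  have C (h : INJ m) : #|[set x in [set ival h z | z : T] | (x < ival h z)%N]| = rankf h
    z :> nat.
    rewrite ffunE /= -(card_imset _ (@INJ_inj _ h)); congr #|pred_of_set _|.
    apply/setP => x; rewrite inE; apply/andP/imsetP.
      by move=> [/imsetP[y _ ->] yz]; exists y; rewrite ?inE.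
    by move=> [y]; rewrite inE => yz ->; rewrite imset_f.
  have := C g1; rewrite -r1 -C -i1 => e.
  have : [set x in [set ival f1 z | z : T] | (x < ival f1 z)%N] \proper [set x in [set
    ival f1 z | z : T] | (x < ival g1 z)%N].
    apply/properP; split.
      by apply/subsetP => x; rewrite !inE => /andP[-> h] /=; exact: ltn_trans fg.
    by exists (ival f1 z); rewrite !inE ?ltnn ?andbF // fg imset_f.
  by move/proper_card; rewrite e ltnn.
move=> r1 i1; apply: val_inj; apply/ffunP => z; apply: val_inj; apply/eqP.
by rewrite eqn_leq !K.
Qed.

Lemma rank_rot_inj : injective (fun f => (rank f, rot f)).
Proof.
move=> f g [rfg Rfg]; apply: rank_im_inj => //; first by apply: val_inj.
have R1 : rot f = rot g by apply: val_inj.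
have r1 : rank f = rank g by apply: val_inj.
by apply: rank_rot_im => //; apply: val_inj; apply/eqP; rewrite eqn_leq !rank_rot_le.
Qed.

(** [combine] and the pair of rank and rotated set are injections in opposite directions between
    finite types, so both are bijections. The second one makes the rotated set uniform and
    independent of the linear extension. *)
Lemma combine_bij : bijective (@combine m).
Proof.
apply: inj_card_bij; first exact: combine_inj.
exact: leq_card rank_rot_inj.
Qed.

Lemma rank_rot_bij : bijective (fun f => (rank f, rot f)).
Proof.
apply: inj_card_bij; first exact: rank_rot_inj.
exact: leq_card (@combine_inj m).
Qed.

End Rotation.
End InjectiveMaps.

(** * Incompressibility *)

(** The pointwise bound [|x| <= x ^+ 2 / (2 * q) + q / 2] stands in for the Cauchy-Schwarz
    inequality. *)
Lemma expect_norm_le (R : realFieldType) (W : finType) (X : W ->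
  R) (q : R) : (0 < #|W|)%N ->
  0 < q -> expect (fun w => X w ^+ 2) <= q ^+ 2 -> expect (fun w => `|X w|) <= q.
Proof.
move=> W0 q0 h.
apply: (@le_trans _ _ (expect (fun w => (2 * q)^-1 * X w ^+ 2 + q / 2))).
  apply: ler_expect => w; rewrite -(real_normK (num_real (X w))).
  rewrite -(ler_pM2l (_ : 0 < 2 * q)) ?mulr_gt0 // mulrDr mulrA divff ?mul1r ?mulf_neq0
    ?gt_eqF //.
  have := sqr_ge0 (`|X w| - q); nra.
rewrite expectD expect_cst // expectZ.
rewrite -(ler_pM2l (_ : 0 < 2 * q)) ?mulr_gt0 // mulrDr mulrA divff ?mul1r ?mulf_neq0
  ?gt_eqF //.
nra.
Qed.

Section Incompressible.
Context (R : realFieldType) {T : finType} (lt : rel T) (D : nat) (D0 : (0 < D)%N).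
Local Notation n := #|T|.
Context (lt_irr : irreflexive lt) (n0 : (0 < n)%N) (LE0 : (0 < #|{: LE lt}|)%N).
Context (m : nat) (nm : (n <= m)%N) (mE : n%:R / m%:R = D%:R^-1 :> R).
Local Notation INJm := (INJ lt m).

Lemma nsub_gt0 : (0 < #|{: nsub m n}|)%N.
Proof.
have /card_gt0P[h _] := LE0.
have inj : injective (widen_ord nm) by move=> x y /(congr1 val) /= /val_inj.
have h1 : #|[set widen_ord nm i | i : 'I_n]| == n by rewrite card_imset // card_ord.
by apply/card_gt0P; exists (exist (fun A : {set 'I_m} => #|A| == n) _ h1).
Qed.

Lemma INJ_gt0 : (0 < #|{: INJm}|)%N.
Proof.
have /card_gt0P[x _] := n0.
by rewrite -(bij_eq_card (combine_bij lt m x)) card_prod muln_gt0 LE0 nsub_gt0.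
Qed.

Lemma expect_rot (c : T) (phi : nsub m n -> R) :
  expect (fun f : INJm => phi (rot c f)) = expect phi.
Proof.
rewrite -[RHS](expect_snd (W := LE lt)) //.
exact: (expect_bijective (fun p : LE lt * nsub m n => phi p.2) (rank_rot_bij lt m c)).
Qed.

Lemma prob_rank (u v : T) :
  prob (fun f : INJm => (ival f u < ival f v)%N) = prob (fun h : LE lt =>
    (ival h u < ival h v)%N) :> R.
Proof.
rewrite /prob -[RHS](expect_fst (W' := nsub m n)) ?nsub_gt0 // -(expect_bijective _
  (combine_bij lt m u)).
by apply: eq_expect => p; rewrite combine_lt.
Qed.

Lemma INJ_op_map m' (f : INJ lt m') : op_map lt (ival f).
Proof. by have /andP[] := valP f. Qed.

Definition of_INJ m' (f : INJ lt m') : OP lt m' := exist _ (ival f) (INJ_op_map f).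

Context (c : T).
Definition in_window (s : int) (L : nat) (x : int) := s <= x < s + L%:Z.
Definition count_win (f : OP lt m) s L := #|[set z | in_window s L (frame c f (Some
  z))]|.

Lemma frame_of_INJ (f : INJm) z : frame c (of_INJ f) (Some z) = (ival f z)%:Z - (ival f
  c)%:Z.
Proof. by []. Qed.

Section Window.
Context (s : int) (L A B : nat) (q : R).
Context (sA : - A%:Z <= s) (LA : s + L%:Z <= A%:Z + 1) (Am : (2 * A < m)%N).
Context (q0 : 0 < q) (Lq : L%:R / D%:R <= q ^+ 2).
Context (nb : (B <= #|[set z | lt z c]|)%N) (na : (B <= #|[set z | lt c z]|)%N).
Context (B0 : (0 < B)%N) (LB : (L%:R / D%:R) * (2 * A%:R / D%:R) <= B%:R :> R).

(** The places on the rotated circle of the offsets in the window: a positive offset [x] goes to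
    [x - 1], a negative one to [x + m]. *)
Definition residues : {set 'I_m} := [set i : 'I_m | in_window s L (i%:Z + 1) ||
  in_window s L (i%:Z - m%:Z)].

(** Offset 0 is [c] itself and has no place; the value [m] is out of range, so that [insub] discards
    it. *)
Definition residue (k : 'I_L) : nat :=
  let x := s + k%:Z in
  if 0 < x then absz (x - 1) else if x < 0 then absz (x + m%:Z) else m.

Lemma card_residues : (#|residues| <= L <= #|residues|.+1)%N.
Proof.
pose g k : option 'I_m := insub (residue k).
have gE (k : 'I_L) : (s + k%:Z != 0 /\ exists2 i : 'I_m,
  g k = Some i & i = residue k :> nat) \/
    (s + k%:Z = 0 /\ g k = None).
  have kL := ltn_ord k; rewrite /g; case: insubP => [i h e|].
    by left; split; [move: h; rewrite /residue /=; do ?case: ifP; lia|exists i].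
  by rewrite /residue /= => h; right; split => //; move: h; do ?case: ifP; lia.
have ginj : injective g.
  move=> k k' e; apply: ord_inj; have kL := ltn_ord k; have kL' := ltn_ord k'.
  case: (gE k) => [[h [i -> hi]] | [h E]] in e *;
    case: (gE k') => [[h' [i' E' hi']] | [h' E']].
  - move: e; rewrite E' => -[ii]; move: hi hi'; rewrite ii => ->; rewrite /residue /=;
    do ?case: ifP; lia.
  - by rewrite E' in e.
  - by rewrite E' E in e.
  - by lia.
have gL : #|[set g k | k : 'I_L]| = L by rewrite card_imset // card_ord.
apply/andP; split.
  rewrite -[leqRHS]gL -(card_imset _ (@Some_inj _)).
  apply/subset_leq_card/subsetP => _ /imsetP[i + ->]; rewrite inE /in_window => h.
  have im := ltn_ord i.
  have [x hx wx] : exists2 x : int, x = i%:Z + 1 \/ x = i%:Z - m%:Z & s <= x < s + L%:Z.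
    by case/orP: h => h; [exists (i%:Z + 1) | exists (i%:Z - m%:Z)] => //; [left|right].
  have kL : (absz (x - s)%R < L)%N by lia.
  have sx : s + (absz (x - s)%R)%:Z = x by lia.
  apply/imsetP; exists (Ordinal kL) => //.
  case: (gE (Ordinal kL)) => /= [[_ [j -> hj]] | [h0 _]]; last by case: hx; lia.
  congr Some; apply: ord_inj; rewrite hj /residue /= sx.
  by case: hx => ->; do ?case: ifP; lia.
rewrite -[leqLHS]gL; apply: leq_trans (_ : #|None |: [set Some i | i in residues]| <=
  _)%N; last first.
  by rewrite cardsU1 card_imset; [case: (_ \notin _); lia|exact: Some_inj].
apply/subset_leq_card/subsetP => _ /imsetP[k _ ->]; rewrite !inE.
case: (gE k) => [[h [i -> hi]] | [_ ->]] //=.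
have kL := ltn_ord k; have im := ltn_ord i.
apply: imset_f; rewrite inE /in_window hi; move: im hi; rewrite /residue /=;
  do ?case: ifP; lia.
Qed.

Definition near_end (f : INJm) := (ival f c < A)%N || (m <= ival f c + A)%N.

Definition rotated (f : INJm) z : 'I_m := insubd (ival f c) (rotn c f (Some z)).

Lemma rotatedE f z : z != c -> rotated f z = rotn c f (Some z) :> nat.
Proof. by move=> zc; rewrite val_insubd rotn_lt //; apply: contra zc => /eqP[->]. Qed.

Lemma ival_neq (f : INJm) z : z != c -> ival f z != ival f c :> nat.
Proof. by apply: contra => /eqP/ord_inj/INJ_inj ->. Qed.

Lemma rotated_inj f (A' : {set T}) : c \notin A' -> {in A' &, injective (rotated f)}.
Proof.
move=> cA x y xA yA /(congr1 (@nat_of_ord m)).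
have xc : x != c by apply: contraNneq cA => <-.
have yc : y != c by apply: contraNneq cA => <-.
rewrite !rotatedE // => e; apply/Some_inj/(rotn_inj _ _ e).
  by apply: contra xc => /eqP[->].
by apply: contra yc => /eqP[->].
Qed.

Lemma rotated_rotset f z : z != c -> rotated f z \in rotset c f.
Proof.
by move=> zc; apply/mem_rotset; exists (Some z); rewrite ?rotatedE //;
  apply: contra zc => /eqP[->].
Qed.

Lemma count_win_le f : (count_win (of_INJ f) s L <= #|rotset c f :&: residues|.+1)%N.
Proof.
rewrite /count_win (cardsD1 c) -add1n leq_add // ?leq_b1 //.
rewrite -(card_in_imset (@rotated_inj f _ _)); last by rewrite !inE eqxx.
apply/subset_leq_card/subsetP => _ /imsetP[z + ->];
  rewrite !inE frame_of_INJ => /andP[zc h].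
have := rotated_rotset f zc; rewrite inE => -> /=.
rewrite rotatedE // /rotn /=; have := ival_neq f zc; have := ltn_ord (ival f z);
  have := ltn_ord (ival f c).
by move: h; rewrite /in_window; case: ifP; lia.
Qed.

(** Away from the ends the window does not wrap around the circle, and [None] falls outside it. *)
Lemma rotset_residues_le f : ~~ near_end f ->
  (#|rotset c f :&: residues| <= count_win (of_INJ f) s L)%N.
Proof.
rewrite /near_end => nbad; apply: leq_trans (leq_imset_card (rotated f) _).
apply/subset_leq_card/subsetP => i; rewrite inE => /andP[/mem_rotset[v vc vi] iR].
have fc := ltn_ord (ival f c).
case: v vc vi => [z|] vc; last first.
  by move: iR; rewrite inE /in_window /rotn /= fc => h e; move: h; rewrite -e; lia.
have zc : z != c by apply: contra vc => /eqP ->.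
rewrite -rotatedE // => /ord_inj e; rewrite -{}e in iR *; apply: imset_f.
move: iR; rewrite !inE frame_of_INJ rotatedE // /in_window /rotn /=.
have := ival_neq f zc; have := ltn_ord (ival f z).
by case: ifP; lia.
Qed.

Lemma card_ord_lt (a : nat) : (#|[set i : 'I_m | (i < a)%N]| <= a)%N.
Proof.
pose F (i : 'I_m) : option 'I_a := insub (i : nat).
have Finj : {in [set i : 'I_m | (i < a)%N] &, injective F}.
  move=> i j; rewrite !inE /F => ia ja; rewrite !insubT => -[e]; exact: ord_inj.
rewrite -(card_in_imset Finj) -[leqRHS](card_ord a) -[leqRHS](card_imset _ (@Some_inj
  _)).
apply/subset_leq_card/subsetP => _ /imsetP[i + ->]; rewrite inE => ia.
by rewrite /F insubT; apply: imset_f.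
Qed.

Lemma card_ord_ge (a : nat) : (#|[set i : 'I_m | (m <= i + a)%N]| <= a)%N.
Proof.
apply: leq_trans (card_ord_lt a); rewrite -(card_imset _ rev_ord_inj).
apply/subset_leq_card/subsetP => _ /imsetP[i + ->]; rewrite !inE /= => ia.
have := ltn_ord i; lia.
Qed.

Lemma prob_rotset_ge (Y : {set 'I_m}) (Q : pred INJm) : (#|Y| <= A)%N ->
  (forall f, Q f -> (B <= #|rotset c f :&: Y|)%N) ->
    prob Q <= (A%:R / D%:R) / B%:R :> R.
Proof.
move=> YA QB.
have Bp : (0 : R) < B%:R by rewrite ltr0n.
apply: le_trans (_ : prob (fun f => B%:R <= (#|rotset c f :&: Y|%:R : R)) <= _).
  by apply: le_prob => f /QB; rewrite ler_nat.
apply: le_trans (markov Bp _) _; first by move=> f; rewrite ler0n.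
rewrite ler_wpM2r ?invr_ge0 ?ler0n //.
rewrite (expect_rot c (fun S => #|val S :&: Y|%:R)) hypergeometric_mean;
  last exact: nsub_gt0.
by rewrite mE ler_wpM2r ?invr_ge0 ?ler0n // ler_nat.
Qed.

Lemma lt_ival (f : INJm) x y : lt x y -> (ival f x < ival f y)%N.
Proof.
move=> xy; rewrite ltn_neqAle INJ_op // andbT; apply/eqP => /ord_inj/INJ_inj e.
by move: xy; rewrite e lt_irr.
Qed.

(** If [c] is within [A] of the bottom, its at least [B] predecessors all rotate into the last [A]
    places, where a uniform subset has on average at most [A / D] points. Markov's inequality
    applies, and the top is symmetric. *)
Lemma prob_near_end : prob near_end <= 2 * (A%:R / D%:R) / B%:R :> R.
Proof.
apply: le_trans (probU _ _) _; rewrite -mulrA mulr_natl mulr2n; apply: lerD.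
  apply: (prob_rotset_ge (card_ord_ge A)) => f fA; apply: leq_trans nb _.
  rewrite -(card_in_imset (@rotated_inj f _ _)); last by rewrite inE lt_irr.
  apply/subset_leq_card/subsetP => _ /imsetP[z + ->]; rewrite inE => zc.
  have zc' : z != c by apply: contraTneq zc => ->; rewrite lt_irr.
  rewrite in_setI rotated_rotset //= inE rotatedE // /rotn /=; have := lt_ival f zc.
  by case: ifP; lia.
apply: (prob_rotset_ge (card_ord_lt A)) => f fA; apply: leq_trans na _.
rewrite -(card_in_imset (@rotated_inj f _ _)); last by rewrite inE lt_irr.
apply/subset_leq_card/subsetP => _ /imsetP[z + ->]; rewrite inE => zc.
have zc' : z != c by apply: contraTneq zc => ->; rewrite lt_irr.
rewrite in_setI rotated_rotset //= inE rotatedE // /rotn /=; have := lt_ival f zc.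
have := ltn_ord (ival f z); by case: ifP; lia.
Qed.

Lemma incompress_INJ :
  expect (fun f : INJm => `|(count_win (of_INJ f) s L)%:R - L%:R / D%:R| : R) <= 2 * q +
    3.
Proof.
have D1 : D%:R^-1 <= 1 :> R by rewrite invf_le1 ?ltr0n // ler1n.
have D2 : 0 <= D%:R^-1 :> R by rewrite invr_ge0 ler0n.
set l : R := L%:R / D%:R.
have Lq' : l <= q ^+ 2 by []; have LB' : l * (2 * A%:R / D%:R) <= B%:R by [].
pose Z (S : nsub m n) : R := #|val S :&: residues|%:R - #|residues|%:R * (n%:R / m%:R).
have EZ : expect (fun S => `|Z S|) <= q.
  apply: expect_norm_le => //; first exact: nsub_gt0.
  apply: le_trans (hypergeometric_variance R nsub_gt0 residues) _.
  rewrite mE; apply: le_trans Lq'; rewrite ler_wpM2r // ler_nat.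
  by have /andP[] := card_residues.
(* Near an end only the upper bound on the count survives; the full window mean [l] is charged
   there. *)
apply: (@le_trans _ _ (expect (fun f : INJm =>
  2 * `|Z (rot c f)| + 2 + l * (near_end f)%:R))).
  apply: ler_expect => f; rewrite /Z mE /=.
  have h1 := count_win_le f; have h2 := @rotset_residues_le f.
  have /andP[h3 h4] := card_residues.
  have h3' : #|residues|%:R / D%:R <= l by rewrite /l ler_wpM2r // ler_nat.
  have h4' : l <= #|residues|%:R / D%:R + 1.
    rewrite (@le_trans _ _ (#|residues|.+1%:R / D%:R)) //;
      first by rewrite ler_wpM2r // ler_nat.
    by rewrite -natr1 mulrDl lerD2l mul1r.
  set x := count_win _ _ _ in h1 h2 *; set y := #|_ :&: _| in h1 h2 *.
  have h1' : (x%:R : R) <= y%:R + 1 by rewrite natr1 ler_nat.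
  have x0 : (0 : R) <= x%:R by rewrite ler0n.
  have n1 := ler_norm (y%:R - #|residues|%:R / D%:R : R).
  have n2 := ler_norm (- (y%:R - #|residues|%:R / D%:R : R)); rewrite normrN in n2.
  rewrite ler_norml; case: (near_end f) h2 => h2.
    by rewrite mulr1; apply/andP; split; lra.
  have : (y%:R : R) <= x%:R by rewrite ler_nat h2.
  by rewrite mulr0 => h5; apply/andP; split; lra.
rewrite !expectD expect_cst ?INJ_gt0 // !expectZ (expect_rot c (fun S => `|Z S|)).
have pb : l * prob near_end <= 1.
  have l0 : 0 <= l by rewrite /l mulr_ge0 ?ler0n.
  apply: le_trans (ler_wpM2l l0 prob_near_end) _; have := ltr0n R B; rewrite B0 => Bp;
    rewrite [leLHS]mulrA ler_pdivrMr ?Bp // mul1r.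
  by apply: le_trans LB'; rewrite mulrA.
rewrite -/(prob near_end); lra.
Qed.

End Window.
End Incompressible.

(** * Order-preserving maps are rarely non-injective *)

Section NonInjective.
Context {T : finType} (lt : rel T).
Local Notation n := #|T|.

(** The value at [u] is redundant in such a map, as it can be read off at [v]; overwriting it freely
    yields [m] maps from each. *)
Lemma card_collision m (u v : T) : u != v ->
  (#|[set f : {ffun T -> 'I_m} | f u == f v]| * m <= m ^ n)%N.
Proof.
move=> uv; have -> : (m ^ n = #|{: {ffun T -> 'I_m}}|)%N by rewrite card_ffun card_ord.
pose F (p : 'I_m * {f : {ffun T -> 'I_m} | f u == f v}) : {ffun T -> 'I_m} :=
  [ffun z => if z == u then p.1 else val p.2 z].
have Finj : injective F.
  move=> [i f] [j g] /ffunP e.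
  have := e u; rewrite !ffunE eqxx /= => ->; congr pair; apply: val_inj;
    apply/ffunP => z.
  have [->|zu] := eqVneq z u; last by have := e z; rewrite !ffunE (negbTE zu).
  rewrite (eqP (valP f)) (eqP (valP g)).
  by have := e v; rewrite !ffunE eq_sym (negbTE uv).
have := leq_card _ Finj; rewrite card_prod card_ord card_sig mulnC.
by rewrite (eq_card (B := [set f : {ffun T -> 'I_m} | f u == f v])) // => f;
  rewrite !inE.
Qed.

Definition noninj m (f : OP lt m) : bool := ~~ injectiveb (val f).

Lemma ffact_ge m k : ((m - k) ^ k <= m ^_ k)%N.
Proof.
have : forall j, (j <= k)%N -> ((m - k) ^ j <= m ^_ j)%N.
  elim=> [//|j IH] jk; rewrite expnSr ffactnSr leq_mul ?IH //; first exact: ltnW.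
  by rewrite leq_sub2l // ltnW.
by apply.
Qed.

(** Colliding maps number at most [n ^ 2 * m ^ n / m]. One linear extension already gives ['C(m, n)]
    order-preserving maps, one per image, and for [2 * n <= m] this is at least [m ^ n] up to a
    factor depending on [n] only. *)
Lemma card_noninj m (LE0 : (0 < #|{: LE lt}|)%N) : (2 * n <= m)%N -> (0 < n)%N ->
  (#|[set f : OP lt m | noninj f]| * m <= n ^ 2 * (2 ^ n * n`!) * #|{: OP lt m}|)%N.
Proof.
move=> nm n0.
have C : ('C(m, n) <= #|{: OP lt m}|)%N.
  have /card_gt0P[x _] := n0.
  apply: (@leq_trans #|{: INJ lt m}|).
    rewrite -(bij_eq_card (combine_bij lt m x)) card_prod.
    have -> : #|{: nsub m n}| = 'C(m, n).
      rewrite -[m in RHS](card_ord m) -card_draws card_sig.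
      by apply: eq_card => S; rewrite !inE.
    by rewrite leq_pmull.
  apply: (leq_card (@of_INJ _ lt m)) => f g /(congr1 val) /= e; exact: val_inj.
have mn : (m ^ n <= 2 ^ n * n`! * 'C(m, n))%N.
  rewrite -mulnA [(n`! * _)%N]mulnC bin_ffact.
  apply: (@leq_trans (2 ^ n * (m - n) ^ n)); last by rewrite leq_mul2l ffact_ge orbT.
  by rewrite -expnMn leq_exp2r //; lia.
rewrite -mulnA; apply: (@leq_trans (n ^ 2 * m ^ n)); last first.
  by rewrite leq_mul2l; apply/orP; right; apply: leq_trans mn _;
    rewrite leq_mul2l C orbT.
apply: (@leq_trans ((\sum_(p : T * T | p.1 != p.2) #|[set f : {ffun T ->
  'I_m} | f p.1 == f p.2]|) * m)).
  rewrite leq_mul2r; apply/orP; right.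
  rewrite -(card_imset _ (@val_inj _ _ (OP lt m))).
  apply: leq_trans (_ : (#|\bigcup_(p : T * T | p.1 != p.2) [set f : {ffun T ->
    'I_m} | f p.1 == f p.2]| <= _)%N).
    apply/subset_leq_card/subsetP => _ /imsetP[f + ->];
      rewrite inE /noninj => /injectivePn[x [y xy e]].
    by apply/bigcupP; exists (x, y); rewrite ?inE //=; apply/eqP.
  apply: (big_ind2 (fun (A : {set {ffun T ->
    'I_m}}) k => #|A| <= k)%N) => // [|A a B b Aa Bb].
    by rewrite cards0.
  by apply: leq_trans (leq_add Aa Bb); rewrite cardsU leq_subr.
rewrite big_distrl /=; apply: (@leq_trans (\sum_(p : T * T | p.1 != p.2) m ^ n)).
  by apply: leq_sum => p; exact: card_collision.
rewrite sum_nat_const leq_mul2r; apply/orP; right.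
by apply: leq_trans (max_card _) _; rewrite card_prod -mulnn.
Qed.

Context (R : realFieldType) (LE0 : (0 < #|{: LE lt}|)%N) (n0 : (0 < n)%N).

Definition collision_const := (n ^ 2 * (2 ^ n * n`!))%N.

Section Fixed.
Context (D M : nat) (D2 : (1 < D)%N) (M0 : (0 < M)%N) (DM : (M * collision_const <=
  D)%N).
Local Notation m := (n * D)%N.

Lemma OP_gt0 : (0 < #|{: OP lt m}|)%N.
Proof.
have /card_gt0P[f _] := @INJ_gt0 T lt n0 LE0 m (leq_pmulr _ (ltnW D2)).
by apply/card_gt0P; exists (of_INJ f).
Qed.

Lemma prob_noninj : prob (@noninj m) <= M%:R^-1 :> R.
Proof.
have o0 := OP_gt0; have M0' : (0 : R) < M%:R by rewrite ltr0n.
rewrite /prob /expect ler_pdivrMr ?ltr0n // -natr_sum.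
rewrite (_ : (\sum_f noninj f)%N = #|[set f : OP lt m | noninj f]|); last first.
  by rewrite -sum1_card [RHS]big_mkcond; apply: eq_bigr => f _; rewrite inE;
    case: noninj.
rewrite mulrC ler_pdivlMr // -natrM ler_nat.
have h := @card_noninj m LE0 (_ : 2 * n <= m)%N n0;
  rewrite mulnC leq_mul2l D2 orbT in h.
have {h} := h isT; rewrite -/collision_const => h.
have k0 : (0 < collision_const)%N by rewrite !muln_gt0 !expn_gt0 n0 fact_gt0.
rewrite -(leq_pmul2l k0); apply: leq_trans h.
rewrite mulnCA leq_mul2l; apply/orP; right; rewrite mulnC.
by apply: leq_trans DM _; rewrite leq_pmull.
Qed.

(* Conditioning on injectivity changes the expectation by at most the range times the
   probability of a collision. *)
Lemma expect_OP (X : OP lt m -> R) (K : R) : (forall f, 0 <= X f <= K) ->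
  `|expect X - expect (fun f : INJ lt m => X (of_INJ f))| <= K / M%:R.
Proof.
move=> XK.
have o0 := OP_gt0.
have i0 := @INJ_gt0 T lt n0 LE0 m (leq_pmulr _ (ltnW D2)).
have o0R : (0 : R) < #|{: OP lt m}|%:R by rewrite ltr0n.
have i0R : (0 : R) < #|{: INJ lt m}|%:R by rewrite ltr0n.
have of_INJ_inj : injective (@of_INJ _ lt m) by move=> f g /(congr1 val) /= e;
  exact: val_inj.
have SI (Y : OP lt m -> R) : \sum_(f | ~~ noninj f) Y f = \sum_(g : INJ lt m) Y (of_INJ
  g).
  rewrite -(big_imset _ (in2W of_INJ_inj)) /=; apply: eq_bigl => f; rewrite negbK.
  apply/idP/imsetP => [fi|[g _ ->]]; last by have /andP[] := valP g.
  have fP : op_map lt (val f) && injectiveb (val f) by rewrite (valP f) fi.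
  by exists (exist _ (val f) fP) => //; apply: val_inj.
set o : R := #|{: OP lt m}|%:R in o0R *; set i : R := #|{: INJ lt m}|%:R in i0R *.
have K0 : 0 <= K.
  by have /card_gt0P[f _] := o0; have /andP[] := XK f; exact: le_trans.
pose a := \sum_(g : INJ lt m) X (of_INJ g); pose b := \sum_(f | noninj f) X f.
have a0 : 0 <= a by rewrite sumr_ge0 // => g _; have /andP[] := XK (of_INJ g).
have aK : a <= K * i.
  rewrite /a mulr_natr -sumr_const; apply: ler_sum => g _;
    by have /andP[] := XK (of_INJ g).
have b0 : 0 <= b by rewrite sumr_ge0 // => g _; have /andP[] := XK g.
have oi : o = i + \sum_(f : OP lt m | noninj f) 1.
  have -> : o = \sum_(f : OP lt m) 1 by rewrite sumr_const.
  by rewrite (bigID (@noninj m)) /= addrC (SI (fun=> 1)) sumr_const.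
have bK : b <= K * (o - i).
  rewrite oi [i + _]addrC addrK mulr_sumr; apply: ler_sum => f _; rewrite mulr1.
  by have /andP[] := XK f.
have pn : (o - i) / o <= M%:R^-1.
  apply: le_trans prob_noninj; rewrite /prob /expect {1}oi [i + _]addrC addrK.
  rewrite ler_wpM2r ?invr_ge0 ?ler0n // [leLHS]big_mkcond; apply: ler_sum => f _;
    by case: noninj.
have -> : expect X = (a + b) / o.
  by rewrite /expect (bigID (@noninj m)) /= addrC SI.
rewrite -[expect _]/(a / i).
have -> : (a + b) / o - a / i = b / o - a / i * ((o - i) / o).
  by field; rewrite !gt_eqF.
have bo : 0 <= b / o <= K / M%:R.
  apply/andP; split; first by rewrite divr_ge0 // ltW.
  apply: (@le_trans _ _ (K * ((o - i) / o))).
    by rewrite mulrA ler_wpM2r // invr_ge0 ltW.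
  by rewrite ler_wpM2l.
have ai : 0 <= a / i * ((o - i) / o) <= K / M%:R.
  have h : 0 <= (o - i) / o.
    by rewrite divr_ge0 ?(ltW o0R) // {1}oi [i + _]addrC addrK sumr_ge0.
  have h' : 0 <= a / i by rewrite divr_ge0 // ltW.
  by rewrite mulr_ge0 //=; apply: ler_pM => //; rewrite ler_pdivrMr.
by rewrite ler_norml; apply/andP; split; lra.
Qed.

End Fixed.
End NonInjective.

(** * Geometric tails *)

Section Tails.
Context (R : realFieldType) {T : finType} (lt : rel T) (m : nat) (c z : T).
Context (OP0 : (0 < #|{: OP lt m}|)%N).
Local Notation OPm := (OP lt m).
Local Notation X f := (frame c f (Some z)).
Context (b : int) (l G : nat) (rho : R).
Context (rho0 : 0 < rho) (Grho : 2 <= G%:R * rho).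
Context (core : rho <= prob (fun f : OPm => b <= X f < b + l%:Z)).

(* Disjoint translates of the core block: one of the first G is light. *)
Lemma light_block (sg : int) : sg = 1 \/ sg = -1 ->
  exists2 g : nat, (0 < g <= G)%N &
  prob (fun f : OPm => b <= X f - sg * (g * l)%:Z < b + l%:Z) <= rho / 2.
Proof.
move=> sg1.
have G0 : (0 < G)%N.
  by rewrite lt0n; apply: contraTneq Grho => ->; rewrite mul0r -ltNge.
have S : \sum_(i < G) prob (fun f : OPm =>
  b <= X f - sg * (i.+1 * l)%:Z < b + l%:Z) <= 1 :> R.
  rewrite -expect_sum; apply: (@le_trans _ _ (expect (fun _ : OPm => 1 : R)));
    last by rewrite expect_cst.
  apply: ler_expect => f.
  have [i hi|none] := pickP (fun i : 'I_G => b <= X f - sg * (i.+1 * l)%:Z < b + l%:Z).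
    rewrite (bigD1 i) //= hi big1 ?addr0 // => j ji.
    case hj : (_ <= _ < _) => //; exfalso.
    have mono u v : (u < v)%N -> (u.+1 * l + l <= v.+1 * l)%N.
      by move=> uv; rewrite addnC -mulSn leq_mul2r ltnS uv orbT.
    have : (i < j)%N || (j < i)%N by rewrite -neq_ltn eq_sym.
    by move: hi hj; case: sg1 => -> h1 h2 /orP[/mono|/mono]; lia.
  by rewrite big1 // => i _; rewrite none.
have [/existsP[i hi]|] := boolP [exists i : 'I_G, prob (fun f : OPm =>
  b <= X f - sg * (i.+1 * l)%:Z < b + l%:Z) <= rho / 2].
  by exists i.+1 => //=.
rewrite negb_exists => /forallP h.
have : \sum_(i < G) (rho / 2) < 1 :> R.
  apply: lt_le_trans S; apply: ltr_sum => [|i _]; last by rewrite ltNge h.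
  by apply/hasP; exists (Ordinal G0); rewrite ?mem_index_enum.
rewrite sumr_const card_ord -[_ *+ G]mulr_natl => h1; exfalso; move: Grho h1;
  set x : R := G%:R; lra.
Qed.

(** Log-concavity with shift [g * l] trades the core for its light translate: the tail beyond
    [s + g * l] is at most half of the tail beyond [s]. *)
Lemma tail_right k : prob (fun f : OPm =>
  b + l%:Z + (k * (G * l))%:Z <= X f) <= 2^-1 ^+ k :> R.
Proof.
have [g /andP[g0 gG] hg] := light_block (or_introl erefl).
elim: k => [|k IH]; first by rewrite expr0 prob_le1.
set s := b + l%:Z + (k * (G * l))%:Z in IH *.
have LC := log_concave (R := R) lt m c (beta := (g * l)%:Z) z (A := fun x : int =>
  b <= x < b + l%:Z) (B := fun y : int => s + (g * l)%:Z <= y) isT.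
have sep (x y : int) : b <= x < b + l%:Z -> s + (g * l)%:Z <= y -> (g * l)%:Z < y - x.
  by rewrite /s => h1 h2; have : 0 <= (k * (G * l))%:Z by []; lia.
have {LC sep} LC := LC sep.
have E1 : prob (fun f : OPm => s + (g * l)%:Z <= X f + (g * l)%:Z) = prob (fun f : OPm
  => s <= X f) :> R.
  by apply: eq_prob => f; rewrite lerD2r.
rewrite E1 in LC.
have E2 : prob (fun f : OPm => b + l%:Z + (k.+1 * (G * l))%:Z <= X f) <= prob (fun f :
  OPm => s + (g * l)%:Z <= X f) :> R.
  apply: le_prob => f; apply: le_trans; rewrite /s mulSn.
  have : (g * l <= G * l)%N by rewrite leq_mul2r gG orbT.
  lia.
apply: le_trans E2 _.
have {LC} LC : rho * prob (fun f : OPm =>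
  s + (g * l)%:Z <= X f) <= rho / 2 * prob (fun f : OPm => s <= X f).
  apply: le_trans (_ : prob (fun f : OPm => b <= X f < b + l%:Z) * prob (fun f : OPm =>
    s + (g * l)%:Z <= X f) <= _).
    by rewrite ler_wpM2r // prob_ge0.
  apply: le_trans LC _; rewrite mulrC ler_wpM2r ?prob_ge0 //.
  by apply: le_trans hg; apply: le_prob => f; rewrite mul1r.
rewrite -mulrA ler_pM2l // in LC; apply: le_trans LC _.
by rewrite exprS ler_wpM2l // invr_ge0.
Qed.

Lemma tail_left k : prob (fun f : OPm => X f < b - (k * (G * l))%:Z) <= 2^-1 ^+ k :> R.
Proof.
have [g /andP[g0 gG] hg] := light_block (or_intror erefl).
elim: k => [|k IH]; first by rewrite expr0 prob_le1.
set s := b - (k * (G * l))%:Z in IH *.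
have LC := log_concave (R := R) lt m c (beta := (g * l)%:Z) z (A := fun x : int =>
  x < s - (g * l)%:Z) (B := fun y : int => b <= y < b + l%:Z) isT.
have sep (x y : int) : x < s - (g * l)%:Z -> b <= y < b + l%:Z -> (g * l)%:Z < y - x.
  by rewrite /s => h1 h2; have : 0 <= (k * (G * l))%:Z by []; lia.
have {LC sep} LC := LC sep.
have E1 : prob (fun f : OPm => X f - (g * l)%:Z < s - (g * l)%:Z) = prob (fun f : OPm =>
  X f < s) :> R.
  by apply: eq_prob => f; rewrite ltrD2r.
rewrite E1 in LC.
have E2 : prob (fun f : OPm => X f < b - (k.+1 * (G * l))%:Z) <= prob (fun f : OPm =>
  X f < s - (g * l)%:Z) :> R.
  apply: le_prob => f => h; apply: lt_le_trans h _; rewrite /s mulSn.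
  have : (g * l <= G * l)%N by rewrite leq_mul2r gG orbT.
  lia.
apply: le_trans E2 _.
have {LC} LC : rho * prob (fun f : OPm =>
  X f < s - (g * l)%:Z) <= rho / 2 * prob (fun f : OPm => X f < s).
  apply: le_trans (_ : prob (fun f : OPm => b <= X f < b + l%:Z) * prob (fun f : OPm =>
    X f < s - (g * l)%:Z) <= _).
    by rewrite ler_wpM2r // prob_ge0.
  rewrite mulrC; apply: le_trans LC _; rewrite ler_wpM2r ?prob_ge0 //.
  by apply: le_trans hg; apply: le_prob => f; rewrite mulN1r opprK.
rewrite -mulrA ler_pM2l // in LC; apply: le_trans LC _.
by rewrite exprS ler_wpM2l // invr_ge0.
Qed.

Lemma sum_half K : \sum_(k < K) 2^-1 ^+ k <= 2 :> R.
Proof.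
suff -> : \sum_(k < K) 2^-1 ^+ k = 2 - 2 * 2^-1 ^+ K :> R.
  by rewrite lerBlDr lerDl mulr_ge0 // exprn_ge0 // invr_ge0.
elim: K => [|K IH]; first by rewrite big_ord0 expr0; ring.
rewrite big_ord_recr IH exprS /=; set x := _ ^+ K; by field.
Qed.

(** A layer-cake bound in blocks of length [h], by which the geometric tails are summed to a
    mean. *)
Lemma block_sum h K (x : int) : x <= (K * h)%:Z ->
  x%:~R <= h%:R * \sum_(k < K) ((k * h)%:Z <= x)%R%:R :> R.
Proof.
elim: K => [|K IH xK].
  by move=> x0; rewrite big_ord0 mulr0 lerz0.
rewrite big_ord_recr mulrDr /=; have [xk'|xk'] := lerP x (K * h)%:Z.
  by apply: le_trans (IH xk') _; rewrite lerDl mulr_ge0.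
rewrite (eq_bigr (fun=> 1)); last first.
  by move=> i _; rewrite (_ : _ <= x) //; apply: le_trans (ltW xk');
    rewrite lez_nat leq_mul2r ltnW ?orbT.
rewrite sumr_const card_ord (ltW xk') -mulrDr -natrD addn1 -natrM.
by rewrite -[(_ * _)%:R]/((h * K.+1)%N%:Z%:~R) ler_int mulnC.
Qed.

(** Each of the two tails adds at most [2 * G * l], and the core adds [l]. *)
Lemma mean_dist : (0 < l)%N ->
  expect (fun f : OPm => `|X f - b|%:~R : R) <= (l * (4 * G + 1))%:R.
Proof.
move=> l0; have G0 : (0 < G)%N.
  by rewrite lt0n; apply: contraTneq Grho => ->; rewrite mul0r -ltNge.
pose h := (G * l)%N; have h0 : (0 < h)%N by rewrite muln_gt0 G0.
pose K := (m + absz b + 1)%N.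
apply: (@le_trans _ _ (expect (fun f : OPm =>
  l%:R + h%:R * \sum_(k < K) (b + l%:Z + (k * h)%:Z <= X f)%R%:R
    + h%:R * \sum_(k < K) (X f < b - (k * h)%:Z)%R%:R : R))).
  apply: ler_expect => f.
  have Xm : `|X f| <= m%:Z.
    by rewrite /frame; have := value_lt f z; have := value_ge0 f z;
      have := value_lt f c; have := value_ge0 f c; lia.
  have Kh : (m + absz b)%:Z <= (K * h)%:Z.
    by rewrite lez_nat (@leq_trans K) ?leq_pmulr // /K leq_addr.
  have [bX|Xb] := lerP (b + l%:Z) (X f).
    apply: (@le_trans _ _ (l%:R + h%:R * \sum_(k < K) (b + l%:Z + (k * h)%:Z <= X
      f)%R%:R)); last first.
      by rewrite lerDl mulr_ge0 // sumr_ge0.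
    have := @block_sum h K (X f - b - l%:Z) _;
      rewrite (eq_bigr (fun k : 'I_K => (b + l%:Z + (k * h)%:Z <= X f)%R%:R));
      last first.
      by move=> k _; congr (nat_of_bool _)%:R; lia.
    move=> H; have {}H := H ltac:(lia).
    rewrite (_ : `|X f - b| = l%:Z + (X f - b - l%:Z)); last by lia.
    by rewrite intrD lerD2l.
  have [Xb'|bX] := ltrP (X f) b.
    apply: (@le_trans _ _ (l%:R + h%:R * \sum_(k < K) (X f < b - (k * h)%:Z)%R%:R));
      last first.
      by rewrite lerD2r lerDl mulr_ge0 // sumr_ge0.
    have := @block_sum h K (b - X f - 1) _;
      rewrite (eq_bigr (fun k : 'I_K => (X f < b - (k * h)%:Z)%R%:R)); last first.
      by move=> k _; congr (nat_of_bool _)%:R; lia.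
    move=> H; have {}H := H ltac:(lia).
    apply: (@le_trans _ _ ((l%:Z + (b - X f - 1))%:~R)); first by rewrite ler_int; lia.
    by rewrite intrD lerD2l.
  apply: (@le_trans _ _ (l%:Z%:~R)); first by rewrite ler_int; lia.
  by rewrite -addrA lerDl addr_ge0 // mulr_ge0 // sumr_ge0.
rewrite !expectD expect_cst // !expectZ !expect_sum.
have := sum_half K => hK.
apply: (@le_trans _ _ (l%:R + h%:R * 2 + h%:R * 2)); last first.
  by rewrite /h !natrM natrD natrM; lra.
have hR : (0 : R) <= h%:R by rewrite ler0n.
rewrite lerD // ?lerD2l ler_wpM2l //; apply: le_trans hK; apply: ler_sum => k _.
  exact: tail_right.
exact: tail_left.
Qed.

End Tails.

(** * The local overlap profile *)

Section Profile.
Context (R : realFieldType) {T : finType} (lt : rel T) (m w : nat) (c : T).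
Context (lt_irr : irreflexive lt)
  (wT : forall A : {set T}, {in A &, forall x y, ~~ lt x y} -> (#|A| <= w)%N).
Context (OP0 : (0 < #|{: OP lt m}|)%N).
Local Notation OPm := (OP lt m).
Local Notation X f z := (frame c f (Some z)).

(** [lam] is the density of the elements, and [e0] bounds the mean fluctuation uniformly over the
    windows within [A] of the anchor. *)
Definition incompressible (A : nat) (lam e0 : R) := forall (s : int) (L : nat),
  - A%:Z <= s -> s + L%:Z <= A%:Z -> (L <= A)%N ->
  expect (fun f : OPm => `|(count_win c f s L)%:R - lam * L%:R|) <= e0.

Lemma count_winE (f : OPm) s L : (count_win c f s L)%:Z = \sum_z (s <= X f z < s +
  L%:Z)%R%:Z.
Proof.
rewrite /count_win -sum1_card big_mkcond /= -[LHS]natz natr_sum.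
by apply: eq_bigr => z _; rewrite inE /in_window; case: (_ <= _ < _).
Qed.

Context (A : nat) (lam e0 : R) (incA : incompressible A lam e0).

Lemma Fbar_stable (beta : nat) (a a' : int) : a' <= a ->
  - A%:Z <= a' - beta%:Z -> a <= A%:Z -> a - a' <= A%:Z ->
  `|Fbar lt m c beta%:Z a - Fbar lt m c beta%:Z a'| <= 4 * w%:R * e0.
Proof.
move=> aa' h1 h2 h3; apply: le_trans (Fbar_close m c lt_irr wT (beta := beta%:Z) isT a
  a') _.
pose L := absz (a - a'); have LE : L%:Z = a - a' by rewrite /L; lia.
have level_diffE (p : OPm * OPm) : level_diff c beta%:Z a a' p =
    (count_win c p.1 (a' - beta%:Z) L)%:Z - (count_win c p.2 a' L)%:Z.
  rewrite !count_winE -sumrB; apply: eq_bigr => z _; rewrite /level_change LE; lia.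
rewrite natrM (_ : 4 * w%:R * e0 = 2 * w%:R * (2 * e0)); last by ring.
rewrite ler_wpM2l ?mulr_ge0 //.
apply: (@le_trans _ _ (expect (fun p : OPm * OPm =>
   `|(count_win c p.1 (a' - beta%:Z) L)%:R - lam * L%:R| + `|(count_win c p.2 a' L)%:R -
     lam * L%:R| : R))).
  apply: ler_expect => p; rewrite level_diffE intr_norm intrB.
  rewrite (_ : _ - _ = ((count_win c p.1 (a' - beta%:Z) L)%:R - lam * L%:R) -
    ((count_win c p.2 a' L)%:R - lam * L%:R)); last first.
    by rewrite /=; ring.
  exact: ler_normB.
rewrite expectD (expect_fst (W' := OPm) (fun f =>
  `|(count_win c f (a' - beta%:Z) L)%:R - lam * L%:R|)) //.
rewrite (expect_snd (W := OPm) (fun f => `|(count_win c f a' L)%:R - lam * L%:R|)) //.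
by rewrite mulr_natl mulr2n; apply: lerD; apply: incA; lia.
Qed.

Context (r : nat).

(* The expected number of points that the two maps both put near the level [a]; by
   [WfunE] it is a combination of window masses and of values of [Fbar],
   all of which are almost independent of [a]. *)
Definition Wfun (a : int) : R := \sum_z prob (fun f : OPm => a <= X f z < a + r%:Z) *
   prob (fun f : OPm => a - r%:Z <= X f z < a + 2 * r%:Z).

Definition Fz (z : T) (t : int) : R := prob (fun f : OPm => X f z < t).

Lemma prob_win z (s t : int) : s <= t ->
  prob (fun f : OPm => s <= X f z < t) = Fz z t - Fz z s.
Proof.
move=> st; rewrite /Fz -expectB; apply: eq_expect => f.
have [h1|h1] := lerP s (X f z); have [h2|h2] := ltrP (X f z) t;
  rewrite /= ?subr0 ?subrr //; lia.
Qed.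

Lemma FbarE (beta a : int) : Fbar lt m c beta a = \sum_z Fz z (a - beta) * (1 - Fz z a).
Proof.
apply: eq_bigr => z _; congr (_ * _); rewrite -probC //; apply: eq_prob => f; lia.
Qed.

Definition mass (a : int) : R := \sum_z prob (fun f : OPm => a <= X f z < a + r%:Z).

Lemma massE a : mass a = expect (fun f : OPm => (count_win c f a r)%:R).
Proof.
rewrite /mass /prob -expect_sum; apply: eq_expect => f;
  rewrite -[RHS]/((count_win c f a r)%:Z%:~R).
by rewrite count_winE rmorph_sum.
Qed.

(** Write the wide-window probability as 1 minus the two outer tails. Multiplied by
    [Fz z (a + r) - Fz z a], either tail becomes a difference of two products of the shape that
    [FbarE] sums. *)
Lemma WfunE a : Wfun a = mass a
   - (Fbar lt m c r%:Z (a + 2 * r%:Z) - Fbar lt m c (2 * r)%:Z (a + 2 * r%:Z))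
   - (Fbar lt m c r%:Z a - Fbar lt m c (2 * r)%:Z (a + r%:Z)).
Proof.
rewrite !FbarE -!sumrB; apply: eq_bigr => z _.
rewrite !prob_win; try lia.
have -> : a + 2 * r%:Z - r%:Z = a + r%:Z by lia.
have -> : a + 2 * r%:Z - (2 * r)%:Z = a by lia.
have -> : a + r%:Z - (2 * r)%:Z = a - r%:Z by lia.
ring.
Qed.

Lemma mass_close a : - A%:Z <= a -> a + r%:Z <= A%:Z -> (r <= A)%N ->
  `|mass a - lam * r%:R| <= e0.
Proof.
move=> h1 h2 h3; apply: le_trans (incA h1 h2 h3).
rewrite massE -[lam * r%:R in leLHS](expect_cst OP0) -expectB; exact: ler_norm_expect.
Qed.

(** Four values of [Fbar] move by at most [4 * w * e0] each, and two masses differ from [lam * r] by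
    at most [e0] each. *)
Lemma Wfun_stable a : - A%:Z + 4 * r%:Z <= a -> a <= A%:Z - 4 * r%:Z ->
  `|Wfun a - Wfun 0| <= (16 * w + 2)%:R * e0.
Proof.
move=> h1 h2; have rA : (4 * r <= A)%N by lia.
have m1 := mass_close (_ : - A%:Z <= a) (_ : a + r%:Z <= A%:Z) (_ : r <= A)%N.
have {}m1 := m1 ltac:(lia) ltac:(lia) ltac:(lia).
have m0 := mass_close (_ : - A%:Z <= 0) (_ : 0 + r%:Z <= A%:Z) (_ : r <= A)%N.
have {}m0 := m0 ltac:(lia) ltac:(lia) ltac:(lia).
have St (beta : nat) (u v : int) : (beta <= 2 * r)%N -> `|u - v| <= A%:Z ->
  - A%:Z <= u - beta%:Z -> - A%:Z <= v - beta%:Z ->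
    u <= A%:Z -> v <= A%:Z -> `|Fbar lt m c beta%:Z u - Fbar lt m c beta%:Z v| <= 4 *
      w%:R * e0.
  move=> hb huv hu hv hu' hv'; have [vu|uv] := lerP v u.
    by apply: Fbar_stable; lia.
  by rewrite distrC; apply: Fbar_stable; lia.
have s1 := St r (a + 2 * r%:Z) (0 + 2 * r%:Z) ltac:(lia) ltac:(lia) ltac:(lia)
  ltac:(lia) ltac:(lia) ltac:(lia).
have s2 := St (2 * r)%N (a + 2 * r%:Z) (0 + 2 * r%:Z) ltac:(lia) ltac:(lia) ltac:(lia)
  ltac:(lia) ltac:(lia) ltac:(lia).
have s3 := St r a 0 ltac:(lia) ltac:(lia) ltac:(lia) ltac:(lia) ltac:(lia) ltac:(lia).
have s4 := St (2 * r)%N (a + r%:Z) (0 + r%:Z) ltac:(lia) ltac:(lia) ltac:(lia)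
  ltac:(lia) ltac:(lia) ltac:(lia).
rewrite !WfunE natrD natrM.
move: s1 s2 s3 s4 m0 m1; rewrite !ler_norml =>
  /andP[? ?] /andP[? ?] /andP[? ?] /andP[? ?] /andP[? ?] /andP[? ?].
by apply/andP; split; lra.
Qed.

Context (rho : R) (rho0 : 0 < rho) (W0 : rho * (lam * r%:R) <= Wfun 0)
  (e0r : 2 * (16 * w + 2)%:R * e0 <= rho * (lam * r%:R)) (e0r' : e0 <= lam * r%:R).

(** Elements with wide-window probability below [rho / 8] contribute at most [rho / 8] times the
    mass, which is half of the lower bound [rho * lam * r / 2] for [Wfun a]. Every other element
    contributes at most 1 beyond that. *)
Lemma path_dense a : - A%:Z + 4 * r%:Z <= a -> a <= A%:Z - 4 * r%:Z ->
  rho / 4 * (lam * r%:R) <= #|[set z | rho / 8 <= prob (fun f : OPm =>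
    a - r%:Z <= X f z < a + 2 * r%:Z)]|%:R.
Proof.
move=> h1 h2; have := Wfun_stable h1 h2; rewrite ler_norml => /andP[lo _].
have := mass_close (_ : - A%:Z <= a) (_ : a + r%:Z <= A%:Z) (_ : r <= A)%N.
move=> /(_ ltac:(lia) ltac:(lia) ltac:(lia)); rewrite ler_norml => /andP[_ hi].
have Wa : Wfun a <= #|[set z | rho / 8 <= prob (fun f : OPm =>
  a - r%:Z <= X f z < a + 2 * r%:Z)]|%:R
   + rho / 8 * mass a.
  rewrite /mass mulr_sumr -sum1_card natr_sum [in leRHS]big_mkcond -big_split /=.
  apply: ler_sum => z _; rewrite inE;
    set x := prob (fun f : OPm => a <= X f z < a + r%:Z).
  set y := prob (fun f : OPm => a - r%:Z <= X f z < a + 2 * r%:Z).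
  have x0 : 0 <= x by exact: prob_ge0.
  have x1 : x <= 1 by exact: prob_le1.
  have y0 : 0 <= y by exact: prob_ge0.
  have y1 : y <= 1 by exact: prob_le1.
  have rx : 0 <= rho / 8 * x by rewrite mulr_ge0 // divr_ge0 // ltW.
  case: (leP (rho / 8) y) => yr; last by rewrite add0r mulrC ler_wpM2r // ltW.
  by apply: le_trans (mulr_ile1 x0 y0 x1 y1) _; rewrite lerDl.
have h8 : rho / 8 * mass a <= rho / 8 * (2 * (lam * r%:R)).
  rewrite ler_wpM2l ?divr_ge0 ?(ltW rho0) //.
  rewrite lerBlDr in hi; apply: le_trans hi _.
  by rewrite mulr_natl mulr2n lerD2r.
have lo' : rho * (lam * r%:R) - (16 * w + 2)%:R * e0 <= Wfun a.
  by rewrite lerBrDr in lo; apply: le_trans lo; rewrite [leRHS]addrC lerD2r.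
have e2 : (16 * w + 2)%:R * e0 <= rho * (lam * r%:R) / 2.
  by rewrite ler_pdivlMr // [leLHS]mulrC [leLHS]mulrA.
move: (le_trans lo' Wa) h8 e2.
set x := lam * r%:R; set y := rho * x; set N := #|_|%:R; set K := _ * e0.
rewrite (_ : rho / 8 * (2 * x) = y / 4); last by rewrite /y; field.
rewrite (_ : rho / 4 * x = y / 4); last by rewrite /y; field.
move=> g1 g2 g3; lra.
Qed.

End Profile.

(** * Distances *)

Section Chains.
Context {T : finType} (lt : rel T) (w : nat)
  (wT : forall A : {set T}, {in A &, forall x y, ~~ lt x y} -> (#|A| <= w)%N).

(* Peeling off the minimal elements costs at most w of them. *)
Lemma long_chain h (U : {set T}) : (w * h < #|U|)%N ->
  exists x s, [/\ path lt x s, {subset x :: s <= U} & size s = h].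
Proof.
elim: h U => [|h IH] U.
  by rewrite muln0 => /card_gt0P[x xU]; exists x, [::]; split => // y;
    rewrite inE => /eqP ->.
pose M := [set x in U | [forall y in U, ~~ lt y x]].
have Mw : (#|M| <= w)%N.
  by apply: wT => x y; rewrite !inE => /andP[xU _] /andP[_ /forall_inP]; apply.
rewrite mulnS => hU; have [|x [s [xs sU sz]]] := IH (U :\: M).
  by rewrite cardsD (setIidPr _) ?ltn_subRL; [lia|apply/subsetP => x;
    rewrite inE => /andP[]].
have := sU x (mem_head _ _); rewrite !inE => /andP[xM xU].
move: xM; rewrite xU negb_forall /= => /existsP[y];
  rewrite negb_imply negbK => /andP[yU yx].
exists y, (x :: s); split => /=; [by rewrite yx| |by rewrite sz].
move=> z; rewrite inE => /orP[/eqP -> //|/sU]; by rewrite inE => /andP[].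
Qed.

End Chains.

Section Distance.
Context (R : realFieldType) {T : finType} (lt : rel T) (m : nat).
Context (OP0 : (0 < #|{: OP lt m}|)%N).
Local Notation OPm := (OP lt m).
Local Notation X c f z := (frame c f (Some z)).

Definition dist (u v : T) : R := expect (fun f : OPm => `|value f u - value f v|%:~R).
Definition dev (c z : T) (a : int) : R := expect (fun f : OPm => `|X c f z - a|%:~R).

Lemma dist_sym u v : dist u v = dist v u.
Proof. by apply: eq_expect => f; rewrite distrC. Qed.

Lemma dist_tri u v x : dist u x <= dist u v + dist v x.
Proof.
rewrite -expectD; apply: ler_expect => f; rewrite -intrD ler_int; exact: ler_distD.
Qed.

Lemma dist_dev c y z a : dist y z <= dev c y a + dev c z a.
Proof.
rewrite -expectD; apply: ler_expect => f; rewrite -intrD ler_int /frame; lia.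
Qed.

Lemma dev_dist c y z a : dev c y a <= dist y z + dev c z a.
Proof.
rewrite -expectD; apply: ler_expect => f; rewrite -intrD ler_int /frame; lia.
Qed.

Lemma dist_shift c y z a b : dist y z <= dev c y a + dev c z b + `|a - b|%:~R.
Proof.
rewrite -[Z in _ + Z](expect_cst OP0) -!expectD; apply: ler_expect => f;
  rewrite -!intrD ler_int /frame; lia.
Qed.

Lemma dev_core c z (a : int) (l l' G : nat) (rho : R) : (0 < l + l')%N -> 0 < rho ->
  2 <= G%:R * rho ->
  rho <= prob (fun f : OPm => a - l%:Z <= X c f z < a + l'%:Z) ->
  dev c z a <= ((l + l') * (4 * G + 1) + l)%:R.
Proof.
move=> l0 rho0 Grho core.
have core' : rho <= prob (fun f : OPm =>
  a - l%:Z <= X c f z < (a - l%:Z) + (l + l')%N%:Z).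
  apply: le_trans core _; apply: le_prob => f; lia.
have := mean_dist OP0 rho0 Grho core' l0.
rewrite natrD => h; rewrite -[l%:R in leRHS]/(l%:Z%:~R : R).
apply: le_trans (_ : expect (fun f : OPm =>
  `|X c f z - (a - l%:Z)|%:~R + l%:Z%:~R) <= _).
  by apply: ler_expect => f; rewrite -intrD ler_int; lia.
by rewrite expectD expect_cst // lerD2r.
Qed.

Lemma markov_dev c z a (B : nat) : (0 < B)%N -> dev c z a <= B%:R ->
  1 / 2 <= prob (fun f : OPm => a - (2 * B)%:Z <= X c f z < a + (2 * B)%:Z) :> R.
Proof.
move=> B0 dB.
have B0' : (0 : R) < (2 * B)%:R by rewrite ltr0n muln_gt0.
have M := @markov R _ (fun f : OPm => `|X c f z - a|%:~R : R) _ B0'.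
have {}M : prob (fun f : OPm => (2 * B)%:R <= `|X c f z - a|%:~R :> R) <= 1 / 2 :> R.
  apply: le_trans (M _) _; first by move=> f; rewrite ler0z.
  by rewrite ler_pdivrMr // natrM -[1 / 2 * _]mulrC; apply: le_trans dB _; lra.
have : prob (fun f : OPm => ~~ ((2 * B)%:R <= `|X c f z - a|%:~R :> R)) <=
   prob (fun f : OPm => a - (2 * B)%:Z <= X c f z < a + (2 * B)%:Z) :> R.
  apply: le_prob => f; rewrite -[(2 * B)%:R]/((2 * B)%N%:Z%:~R) ler_int; lia.
by rewrite probC //; apply: le_trans; lra.
Qed.

(* With probability at least [eps / 2] the element [y] lies within [E * B] of [z], and by
   log-concavity such a block bounds the mean distance. *)
Lemma cross_dist z z' y (eps : R) (B E : nat) : (0 < B)%N -> 0 < eps ->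
  4 <= E%:R * eps ->
  dist z z' <= B%:R ->
  eps <= prob (fun f : OPm => (value f z < value f y) && (value f y <= value f z')) ->
  dist z y <= (E * B * (8 * E + 3))%:R.
Proof.
move=> B0 eps0 Eeps dB ev.
have E0 : (0 < E)%N by rewrite lt0n; apply: contraTneq Eeps => ->; rewrite mul0r -ltNge.
have l0 : (0 : R) < (E * B)%:R by rewrite ltr0n muln_gt0 E0.
have M := @markov R _ (fun f : OPm => `|value f z - value f z'|%:~R : R) _ l0.
have {}M : prob (fun f : OPm => (E * B)%:R <= `|value f z - value f z'|%:~R :> R) <= eps
  / 2 :> R.
  apply: le_trans (M _) _; first by move=> f; rewrite ler0z.
  rewrite ler_pdivrMr // natrM; apply: le_trans dB _.
  have : (0 : R) <= B%:R by rewrite ler0n.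
  nra.
have core : eps / 2 <= prob (fun f : OPm => 0 - (E * B)%:Z <= X z f y < 0 + (E * B)%:Z).
  have : prob (fun f : OPm => (value f z < value f y) && (value f y <= value f z')) <=
     prob (fun f : OPm => (0 - (E * B)%:Z <= X z f y < 0 + (E * B)%:Z) || ((E * B)%:R <=
       `|value f z - value f z'|%:~R :> R)) :> R.
    apply: le_prob => f; rewrite -[(E * B)%:R]/((E * B)%N%:Z%:~R) ler_int /frame; lia.
  have := probU (fun f : OPm => (0 - (E * B)%:Z <= X z f y < 0 + (E * B)%:Z)) (fun f :
    OPm => (E * B)%:R <= `|value f z - value f z'|%:~R :> R) (R := R).
  set p1 := prob (fun f : OPm => (_ < _) && _) in ev *;
    set p2 := prob (fun f : OPm => (_ <= _ < _)) ; set p3 := prob (fun _ => _ || _).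
  move=> h1 h2; lra.
have l0' : (0 < E * B + E * B)%N by rewrite addn_gt0 muln_gt0 E0 B0.
have e2 : 0 < eps / 2 by rewrite divr_gt0.
have Ee2 : 2 <= E%:R * (eps / 2) by lra.
have h := dev_core l0' e2 Ee2 core.
have -> : dist z y = dev z y 0 by apply: eq_expect => f; rewrite /frame subr0 distrC.
apply: le_trans h _; rewrite ler_nat; nia.
Qed.

(** By Markov each element is in a block of length [4 * B] around its centre with probability at
    least 1/2, so its tails halve every [16 * B]. If [u] does not come after [y], one of the two has
    strayed [k] such steps. *)
Lemma separated c y u (a b : int) (B k : nat) : (0 < B)%N ->
  dev c y a <= B%:R -> dev c u b <= B%:R -> (4 + 32 * k)%N%:Z * B%:Z < b - a ->
  prob (fun f : OPm => value f u <= value f y) <= 2 * 2^-1 ^+ k :> R.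
Proof.
move=> B0 /(markov_dev B0) cy /(markov_dev B0) cu ab.
have half0 : (0 : R) < 1 / 2 by rewrite divr_gt0.
have G4 : (2 : R) <= 4%:R * (1 / 2) by lra.
pose l := (4 * B)%N.
have cy' : 1 / 2 <= prob (fun f : OPm =>
  a - (2 * B)%:Z <= X c f y < (a - (2 * B)%:Z) + l%:Z) :> R.
  by apply: le_trans cy _; apply: le_prob => f; rewrite /l; lia.
have cu' : 1 / 2 <= prob (fun f : OPm =>
  b - (2 * B)%:Z <= X c f u < (b - (2 * B)%:Z) + l%:Z) :> R.
  by apply: le_trans cu _; apply: le_prob => f; rewrite /l; lia.
have t1 := tail_right OP0 half0 G4 cy' k.
have t2 := tail_left OP0 half0 G4 cu' k.
apply: le_trans (le_prob (B := fun f : OPm =>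
  (a - (2 * B)%:Z + l%:Z + (k * (4 * l))%:Z <= X c f y) || (X c f u < b - (2 * B)%:Z -
  (k * (4 * l))%:Z)) _) _.
  move=> f; rewrite /frame /l; nia.
by apply: le_trans (probU _ _) _; rewrite mulr_natl mulr2n lerD.
Qed.

End Distance.

(** * Crossing a path *)

Lemma discrete_crossing (S : nat -> bool) N : S 0%N -> ~~ S N ->
  exists i, [/\ (i < N)%N, S i & ~~ S i.+1].
Proof.
elim: N => [-> //|N IH] S0 SN; have [SN'|SN'] := boolP (S N); first by exists N.
by have [i [iN Si Si']] := IH S0 SN'; exists i; split => //; exact: ltnW.
Qed.

Lemma bucket (R : realFieldType) (lo del x : R) N : lo <= x -> x < lo + N%:R * del ->
  exists i : 'I_N, lo + i%:R * del <= x < lo + i.+1%:R * del.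
Proof.
elim: N => [|N IH] lx xN; first by move: (le_lt_trans lx xN); rewrite mul0r addr0 ltxx.
have [xN'|Nx] := ltP x (lo + N%:R * del).
  by have [i hi] := IH lx xN'; exists (widen_ord (leqnSn N) i).
by exists ord_max; rewrite Nx.
Qed.

Lemma pigeonhole_sets (T : finType) N (Z : {set T}) (Zi : 'I_N ->
  {set T}) : (0 < N)%N ->
  (forall z, z \in Z -> exists i, z \in Zi i) -> exists i, (#|Z| <= N * #|Zi i|)%N.
Proof.
move=> N0 cov; apply/existsP; apply: contraT; rewrite negb_exists => /forallP h.
have : (#|Z| <= \sum_i #|Zi i|)%N.
  apply: (@leq_trans #|\bigcup_i Zi i|).
    by apply/subset_leq_card/subsetP => z /cov[i zi]; apply/bigcupP; exists i.
  apply: (big_ind2 (fun (A : {set T}) k => #|A| <= k)%N) => // [|A a B b Aa Bb].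
    by rewrite cards0.
  by apply: leq_trans (leq_add Aa Bb); rewrite cardsU leq_subr.
have [i0 _] : exists i : 'I_N, true by exists (Ordinal N0).
pose M := \max_i #|Zi i|.
have [j jM] : exists j, M = #|Zi j| by exists [arg max_(i > i0) #|Zi i|]; rewrite /M;
  exact: bigmax_eq_arg.
have := h j; rewrite -ltnNge -jM => hj sumZ.
have : (\sum_i #|Zi i| <= N * M)%N.
  by rewrite -[N in leqRHS]card_ord -sum_nat_const; apply: leq_sum => i _;
    exact: leq_bigmax.
lia.
Qed.

Section ChainMass.
Context (R : realFieldType) {T : finType} (lt : rel T) (m : nat).
Context (lt_irr : irreflexive lt) (lt_tr : transitive lt) (OP0 : (0 < #|{: OP lt
  m}|)%N).
Local Notation OPm := (OP lt m).
Local Notation X c f z := (frame c f (Some z)).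
Local Notation dist := (dist R lt m).
Context (x : T) (s : seq T) (xs : path lt x s) (r : nat).

(** Chain elements never lie below the anchor [x], and Markov keeps each within [r] of it with
    probability at least 7/8, whose square exceeds 3/4. *)
Lemma chain_mass : (forall z, z \in x :: s -> dist z x <= r%:R / 8) -> (0 < r)%N ->
  3 / 4 * (size s).+1%:R <= Wfun R lt m x r 0.
Proof.
move=> hd r0; have r0' : (0 : R) < r%:R by rewrite ltr0n.
have us : uniq (x :: s) by apply: (sorted_uniq lt_tr lt_irr) => /=.
rewrite /Wfun (bigID (mem (x :: s))) /= -[leLHS]addr0; apply: lerD; last first.
  by apply: sumr_ge0 => z _; rewrite mulr_ge0 // prob_ge0.
rewrite -big_uniq //= -[size s]/(size (x :: s)).-1 /=.
have -> : 3 / 4 * (size s).+1%:R = \sum_(z <- x :: s) (3 / 4) :> R.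
  by rewrite big_const_seq count_predT iter_addr addr0 mulr_natr.
rewrite [leLHS]big_seq_cond [leRHS]big_seq_cond; apply: ler_sum => z;
  rewrite andbT => zs.
have zx (f : OPm) : 0 <= X x f z.
  move: zs; rewrite inE => /orP[/eqP ->|zs]; first by rewrite frame_c.
  have /allP h := order_path_min lt_tr xs; rewrite /frame subr_ge0; apply: value_mono;
    exact: h.
have p78 : 7 / 8 <= prob (fun f : OPm => X x f z < r%:Z) :> R.
  have Mk := @markov R _ (fun f : OPm => `|value f z - value f x|%:~R) _ r0'.
  have {}Mk : prob (fun f : OPm => r%:R <= `|value f z - value f x|%:~R :> R) <= 1 / 8
    :> R.
    apply: le_trans (Mk _) _; first by move=> f; rewrite ler0z.
    by rewrite ler_pdivrMr // mul1r mulrC; exact: hd.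
  have : prob (fun f : OPm => ~~ (r%:R <= `|value f z - value f x|%:~R :> R)) <= prob
    (fun f : OPm => X x f z < r%:Z) :> R.
    by apply: le_prob => f; rewrite -[r%:R]/(r%:Z%:~R) ler_int /frame; lia.
  rewrite probC //; lra.
have q1 : prob (fun f : OPm => X x f z < r%:Z) <= prob (fun f : OPm =>
  0 <= X x f z < 0 + r%:Z) :> R.
  by apply: le_prob => f; rewrite zx add0r.
have q2 : prob (fun f : OPm => X x f z < r%:Z) <= prob (fun f : OPm =>
  0 - r%:Z <= X x f z < 0 + 2 * r%:Z) :> R.
  by apply: le_prob => g; have := zx g; lia.
apply: le_trans (_ : 7 / 8 * (7 / 8) <= _); first lra.
by apply: ler_pM; rewrite ?divr_ge0 //;
  [exact: le_trans p78 q1 | exact: le_trans p78 q2].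
Qed.

End ChainMass.

Section Step.
Context (R : realFieldType) {T : finType} (lt : rel T) (m : nat).
Context (OP0 : (0 < #|{: OP lt m}|)%N).
Local Notation OPm := (OP lt m).
Local Notation X c f z := (frame c f (Some z)).
Local Notation dist := (dist R lt m).
Local Notation dev := (dev R lt m).

Definition before u v : R := prob (fun f : OPm => value f u < value f v).

Context (eps : R) (eps0 : 0 < eps)
  (unb : forall u v, u != v -> before u v <= 1 / 2 - eps \/ 1 / 2 + eps <= before u v).

Lemma far_prob c y z (a : int) (B0 B1 : R) (M : nat) : (0 < M)%N -> dist y c <= B0 ->
  dev c z a <= B1 ->
  4 * (B0 + B1) <= M%:R ->
  prob (fun f : OPm => M%:Z <= `|X c f y| + `|X c f z - a|) <= 1 / 4 :> R.
Proof.
move=> M0 dB eB BM; have M0' : (0 : R) < M%:R by rewrite ltr0n.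
have Mk := @markov R _ (fun f : OPm => (`|X c f y| + `|X c f z - a|)%:~R) _ M0'.
rewrite (_ : prob _ = prob (fun f : OPm =>
  M%:R <= (`|X c f y| + `|X c f z - a|)%:~R :> R)); last first.
  by apply: eq_prob => f; rewrite -[M%:R]/(M%:Z%:~R) ler_int.
apply: le_trans (Mk _) _; first by move=> f; rewrite ler0z addr_ge0.
rewrite ler_pdivrMr // (_ : expect _ = dist y c + dev c z a); first lra.
by rewrite /dist /dev -expectD; apply: eq_expect => f; rewrite intrD.
Qed.

Section Crossing.
Context (c y : T) (r N0 C1 E : nat) (B0 : R) (r0 : (0 < r)%N) (N00 : (0 < N0)%N) (C10 :
  (0 < C1)%N).
Context (Eeps : 4 <= E%:R * eps).
Definition level (i : nat) : int := (i * r)%:Z - (N0 * r)%:Z.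
Context (pathc : forall i, (i <= 2 * N0)%N ->
  exists z, dev c z (level i) <= (C1 * r)%:R).
Context (yc : dist y c <= B0) (far : 4 * (B0 + (C1 * r)%:R) <= (N0 * r)%:R).

(* Since no pair is balanced, the probability that [y] comes after the element near level
   [i] jumps from [1 / 2 + eps] to [1 / 2 - eps] between two consecutive levels. *)
Lemma crossing : exists i z, [/\ (i <= 2 * N0)%N, dev c z (level i) <= (C1 * r)%:R &
  dist y z <= (E * (3 * C1 * r) * (8 * E + 3))%:R].
Proof.
have M0 : (0 < N0 * r)%N by rewrite muln_gt0 N00.
have ar : (C1 * r + C1 * r + r <= 3 * (C1 * r))%N by have := leq_pmull r C10; lia.
pose S i := [exists z, (dev c z (level i) <= (C1 * r)%:R) && (1 / 2 < before z y)].
have S0 : S 0%N.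
  have [z ez] := pathc (leq0n _); apply/existsP; exists z; rewrite ez /=.
  have := far_prob M0 yc ez far.
  have : prob (fun f : OPm => ~~ ((N0 * r)%:Z <= `|X c f y| + `|X c f z - level 0|)) <=
    before z y.
    by apply: le_prob => f; rewrite /level /frame; lia.
  rewrite probC //; lra.
have SN : ~~ S (2 * N0)%N.
  rewrite negb_exists; apply/forallP => z; rewrite negb_and -leNgt.
  case: (boolP (dev c z _ <= _)) => //= ez.
  have := far_prob M0 yc ez far.
  have : before z y <= prob (fun f : OPm =>
    ((N0 * r)%:Z <= `|X c f y| + `|X c f z - level (2 * N0)|)).
    apply: le_prob => f; rewrite /level /frame.
    have : (2 * N0 * r)%:Z = (N0 * r)%:Z + (N0 * r)%:Z by lia.
    lia.
  lra.
have [i [iN /existsP[z /andP[ez zy]] nS]] := discrete_crossing S0 SN.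
have [z' ez'] := pathc iN.
(* The gap hypothesis says nothing about [y] against itself, but then [y] is itself an element of
   the path. *)
have [z'y|z'y] := eqVneq z' y.
  exists i.+1, z'; split => //; rewrite z'y /dist (eq_expect (Y := fun=> 0)) ?expect_cst
    //.
  by move=> f; rewrite subrr normr0.
have zny : z != y.
  have yy : before y y = 0.
    by rewrite /before /prob (eq_expect (Y := fun=> 0)) ?expect_cst // => f;
      rewrite ltxx.
  by apply: contraTneq zy => ->; rewrite -leNgt yy divr_ge0.
have b1 : 1 / 2 + eps <= before z y by have [|//] := unb zny; lra.
have b2 : before z' y <= 1 / 2 - eps.
  have [//|h] := unb z'y; case/negP: nS; apply/existsP; exists z'; rewrite ez' /=.
  by apply: lt_le_trans h; rewrite ltrDl.
exists i, z; split => //; first exact: ltnW.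
rewrite dist_sym; apply: (cross_dist OP0 (z' := z')) (Eeps) _ _ => //.
- by rewrite !muln_gt0 C10.
- apply: le_trans (dist_shift R OP0 c z z' (level i) (level i.+1)) _.
  have -> : `|level i - level i.+1| = r%:Z.
    rewrite /level [(i.+1 * r)%N]mulSn PoszD;
      move: (Posz (i * r)) (Posz (N0 * r)) => a b.
    have -> : a - b - (r%:Z + a - b) = - r%:Z by ring.
    by rewrite normrN ger0_norm.
  apply: le_trans (lerD (lerD ez ez') (lexx _)) _.
  by rewrite -pmulrn -!natrD ler_nat -[(3 * C1 * r)%N]mulnA.
(* The drop of at least [2 * eps] is at most the probability that [y] falls between [z] and [z']. *)
have : before z y <= prob (fun f : OPm =>
  (value f z < value f y) && (value f y <= value f z')) + before z' y.
  rewrite -expectD; apply: ler_expect => f; rewrite -natrD ler_nat leNgt.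
  by case: (value f z < value f y); case: (value f z' < value f y).
lra.
Qed.

End Crossing.

End Step.

(** * The iteration step *)

Lemma level_bounds (i n r : nat) : (i <= 2 * n)%N ->
  - ((n + 5) * r)%N%:Z + 4 * r%:Z <= level r n i /\ level r n i <= ((n + 5) * r)%N%:Z -
    4 * r%:Z.
Proof.
move=> le_in; have : (i * r <= 2 * n * r)%N by rewrite leq_mul2r le_in orbT.
by rewrite /level -mulnA mulnDl; move: (i * r)%N (n * r)%N => a b; lia.
Qed.

(** The factor 38 comes from [2 + 4 + 32 * k <= 38 * k]. *)
Lemma rate_arith (a b r k : nat) : (0 < k)%N ->
  ((a + b) * r + (a + b) * r + (4 + 32 * k) * ((a + b) * r) <= k * ((b + 2 * a + 38 * (a
    + b)) * r))%N.
Proof.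
move=> k0; rewrite [((b + 2 * a + _) * r)%N]mulnDl mulnDr -[(38 * _ * _)%N]mulnA.
by apply: leq_trans (leq_addl _ _); move: ((a + b) * r)%N => x; nia.
Qed.

Section Step.
Context (R : realFieldType) {T : finType} (lt : rel T) (m w D : nat).
Context (lt_irr : irreflexive lt) (lt_tr : transitive lt)
  (wT : forall A : {set T}, {in A &, forall x y, ~~ lt x y} -> (#|A| <= w)%N).
Context (OP0 : (0 < #|{: OP lt m}|)%N) (D0 : (0 < D)%N) (w0 : (0 < w)%N).
Local Notation OPm := (OP lt m).
Local Notation X c f z := (frame c f (Some z)).
Local Notation dist := (dist R lt m).
Local Notation dev := (dev R lt m).
Local Notation lam := (D%:R^-1 : R).
Local Notation before := (before R lt m).

Definition ball (y : T) (t : nat) : {set T} := [set z | dist y z <= (t * D)%:R].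

(* Pigeonhole the mean positions of the ball into intervals of length [r0 / 8]; a crowded
   interval contains a long chain, all of whose elements are close to one another. *)
Lemma find_center (c0 : R) (y : T) (t r0 : nat) : 0 < c0 -> (0 < r0 <= t)%N ->
  c0 * t%:R <= #|ball y t|%:R ->
  exists2 c, c \in ball y t & c0 / (23 * w%:R) * (lam * (D * r0)%:R) <= Wfun R lt m c (D
    * r0) 0.
Proof.
move=> c00 /andP[r00 r0t] dense; set Z := ball y t in dense *.
pose mu z : R := expect (fun f : OPm => (value f z - value f y)%:~R).
pose N := ((16 * t) %/ r0).+1.
have N1 : (16 * t < N * r0)%N by rewrite ltn_ceil.
have N2 : (N * r0 <= 17 * t)%N.
  by rewrite mulSn; have := leq_trunc_div (16 * t) r0; lia.
pose del : R := (D * r0)%:R / 8; pose lo : R := - (t * D)%:R.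
have muZ z : z \in Z -> lo <= mu z < lo + N%:R * del.
  rewrite inE => dz; have : `|mu z| <= (t * D)%:R.
    apply: le_trans (ler_norm_expect _) (le_trans _ dz).
    by apply: ler_expect => f; rewrite -intr_norm ler_int; lia.
  rewrite ler_norml => /andP[h1 h2]; rewrite h1 /=; apply: le_lt_trans h2 _.
  rewrite /lo /del -ltrBlDl opprK -mulr2n.
  have h : (16 * t * D)%:R < (N * r0 * D)%:R :> R by rewrite ltr_nat ltn_mul2r D0.
  rewrite mulrA ltr_pdivlMr //.
  have -> : (t * D)%:R *+ 2 * 8 = (16 * t * D)%:R :> R by rewrite !natrM; ring.
  by have -> : N%:R * (D * r0)%:R = (N * r0 * D)%:R :> R by rewrite !natrM; ring.
pose Zi (i : 'I_N) := [set z in Z | lo + i%:R * del <= mu z < lo + i.+1%:R * del].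
have [i hi] : exists i, (#|Z| <= N * #|Zi i|)%N.
  apply: pigeonhole_sets => // z zZ; have /andP[h1 h2] := muZ z zZ.
  by have [i hi] := bucket h1 h2; exists i; rewrite inE zZ.
have t0 : (0 < t)%N by apply: leq_trans r0t.
have Z0 : (0 < #|Z|)%N.
  by rewrite -(ltr0n R); apply: lt_le_trans dense; rewrite mulr_gt0 // ltr0n.
have Zi0 : (0 < #|Zi i|)%N by move: hi; case: (#|Zi i|) => //; rewrite muln0 leqNgt Z0.
pose h := (#|Zi i|.-1 %/ w)%N.
have hw : (w * h < #|Zi i|)%N.
  by have := leq_trunc_div #|Zi i|.-1 w; rewrite -/h mulnC; lia.
have hw' : (#|Zi i| <= h.+1 * w)%N.
  by have := ltn_ceil #|Zi i|.-1 w0; rewrite -/h; lia.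
have [x [s [xs sZ sh]]] := long_chain wT hw.
have xZ : x \in Zi i by apply: sZ; rewrite mem_head.
exists x; first by move: xZ; rewrite inE => /andP[].
have hd z : z \in x :: s -> dist z x <= (D * r0)%:R / 8.
  move=> zs; have zZ := sZ z zs.
  have -> : dist z x = mu z - mu x.
    rewrite /mu -expectB; apply: eq_expect => f; rewrite -intrB.
    have : value f x <= value f z.
      move: zs; rewrite inE => /orP[/eqP -> //|zs]; apply: value_mono.
      by have /allP := order_path_min lt_tr xs; apply.
    by rewrite -subr_ge0 => /ger0_norm ->; rewrite opprB addrA subrK.
  move: xZ zZ; rewrite !inE => /and3P[_ h1 _] /and3P[_ _ h2].
  rewrite -/del; move: h1 h2; rewrite -natr1 mulrDl mul1r; lra.
have := chain_mass lt_irr lt_tr OP0 xs hd; rewrite muln_gt0 D0 r00 => /(_ isT);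
  apply: le_trans.
rewrite sh; have -> : lam * (D * r0)%:R = r0%:R.
  by rewrite natrM mulrA mulVf ?mul1r // pnatr_eq0 -lt0n.
have w0' : (0 : R) < w%:R by rewrite ltr0n.
have h1 : c0 * (t%:R * r0%:R) <= 17 * t%:R * (h.+1%:R * w%:R).
  rewrite mulrA; apply: le_trans (_ : #|Z|%:R * r0%:R <= _); first by rewrite ler_wpM2r.
  rewrite -natrM -[17]/(17%:R) -!natrM ler_nat.
  apply: leq_trans (_ : N * #|Zi i| * r0 <= _)%N; first by rewrite leq_mul2r hi orbT.
  by rewrite mulnAC leq_mul.
have t0' : (0 : R) < t%:R by rewrite ltr0n.
have h2 : c0 * r0%:R <= 17 * (h.+1%:R * w%:R).
  by rewrite -(ler_pM2l t0'); apply: le_trans (le_trans h1 _); rewrite le_eqVlt;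
    apply/orP; left; apply/eqP; ring.
rewrite mulrAC ler_pdivrMr ?mulr_gt0 //; apply: le_trans h2 _.
have : (0 : R) <= h.+1%:R * w%:R by rewrite mulr_ge0.
lra.
Qed.

Context (eps : R) (eps0 : 0 < eps)
  (unb : forall u v, u != v -> before u v <= 1 / 2 - eps \/ 1 / 2 + eps <= before u v).

Context (y : T) (c0 : R) (c00 : 0 < c0) (k t s G E Kc : nat).
Local Notation rho := (c0 / (23 * w%:R)).
Local Notation C1 := (12 * G + 4)%N.
Local Notation C2 := (E * 3 * C1 * (8 * E + 3))%N.
Local Notation C4 := (38 * (C1 + C2))%N.
Local Notation C8 := (14 + 4 * C1)%N.
Local Notation q := (Kc * C8 * s)%N.
Local Notation r0 := (Kc * q)%N.
Local Notation r := (D * r0)%N.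
Local Notation A := (D * q ^ 2)%N.
Local Notation N0 := (C8 * s - 5)%N.

(** [C1 * r] bounds the deviation of a path element, by [dev_core] on a block of length [3 * r];
    [C2 * r] bounds the distance to the path, by [crossing]; [C4] covers the distance between levels
    that cannot be separated. [C8] makes the path longer than the distance to be crossed, and
    [r0 = Kc * q] makes the fluctuation [6 * q] small against the [r0] elements expected in a
    window. The rate is the new scale divided by [s]. *)
Definition step_rate := (Kc * Kc * C8 * (C2 + 2 * C1 + C4))%N.
Definition step_density : R := rho / 4 / (C2 + 2 * C1 + C4)%:R.

Context (k0 : (0 < k)%N) (s0 : (0 < s)%N) (kts : (k * t <= s ^ 2)%N) (r0t : (r0 <=
  t)%N).
Context (Grho : 2 <= G%:R * (rho / 8)) (Eeps : 4 <= E%:R * eps) (Kc6 : (6 <= Kc)%N)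
  (Kcrho : 12 * (16 * w + 2)%:R <= rho * Kc%:R).
Context (inc : forall c, c \in ball y t -> incompressible lt m c A lam (6 * q%:R)).
Context (dense : c0 * t%:R <= #|ball y t|%:R).

Lemma C8s : (C1 * 4 + 5 + 9 * s <= C8 * s)%N.
Proof. by have := leq_pmulr (C1 * 4 + 5) s0; lia. Qed.

(** The spare levels provide the margin [4 * r] that [path_dense] asks for. *)
Lemma levelsE : ((N0 + 5) * r = A)%N.
Proof.
have -> : (N0 + 5 = C8 * s)%N by have := C8s; move: (C8 * s)%N => a; lia.
rewrite -mulnn; ring.
Qed.

Lemma r0_gt0 : (0 < r0)%N.
Proof. by rewrite !muln_gt0 s0 !andbT; have := Kc6; case: (Kc). Qed.

Lemma lam_r : lam * r%:R = r0%:R.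
Proof. by rewrite natrM mulrA mulVf ?mul1r // pnatr_eq0 -lt0n. Qed.

Lemma rho_gt0 : 0 < rho.
Proof. by rewrite divr_gt0 // mulr_gt0 // ltr0n. Qed.

Lemma step_path c (i : nat) : c \in ball y t ->
  rho * (lam * r%:R) <= Wfun R lt m c r 0 ->
  (i <= 2 * N0)%N ->
  rho / 4 * r0%:R <= #|[set z | dev c z (level r N0 i) <= (C1 * r)%:R]|%:R :> R.
Proof.
move=> cy Wc iN; have r00 := r0_gt0; have rho0 := rho_gt0.
have q0 : (0 : R) <= q%:R by rewrite ler0n.
have e1 : 2 * (16 * w + 2)%:R * (6 * q%:R) <= rho * (lam * r%:R).
  have -> : 2 * (16 * w + 2)%:R * (6 * q%:R) = 12 * (16 * w + 2)%:R * q%:R :> R by ring.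
  rewrite lam_r [r0%:R]natrM [leRHS]mulrA.
  by rewrite ler_wpM2r.
have e2 : 6 * q%:R <= lam * r%:R by rewrite lam_r [r0%:R]natrM ler_wpM2r // ler_nat.
have lv : - A%:Z + 4 * r%:Z <= level r N0 i /\ level r N0 i <= A%:Z - 4 * r%:Z.
  by rewrite -levelsE; exact: level_bounds.
have := path_dense lt_irr wT OP0 (inc cy) rho0 Wc e1 e2 (proj1 lv) (proj2 lv).
rewrite lam_r => h; apply: le_trans h _; rewrite ler_nat;
  apply/subset_leq_card/subsetP => z.
rewrite !inE => core.
have l0 : (0 < r + 2 * r)%N by rewrite addn_gt0 muln_gt0 D0 r00.
have rho8 : 0 < rho / 8 by rewrite divr_gt0.
have core' : rho / 8 <= prob (fun f : OPm =>
  level r N0 i - r%:Z <= X c f z < level r N0 i + (2 * r)%N%:Z).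
  by rewrite PoszM.
apply: le_trans (dev_core OP0 l0 rho8 Grho core') _.
by rewrite ler_nat; apply: eq_leq; ring.
Qed.

(** The path reaches [N0 * r] to either side of [c], of order [D * s ^ 2], while [u] is within
    [(k + 1) * t * D] of [c] and [k * t <= s ^ 2]. *)
Lemma step_cross c u : c \in ball y t -> rho * (lam * r%:R) <= Wfun R lt m c r 0 ->
  dist u c <= ((k + 1) * t * D)%:R ->
  exists i z, [/\ (i <= 2 * N0)%N, dev c z (level r N0 i) <= (C1 * r)%:R & dist u z <=
    (C2 * r)%:R].
Proof.
move=> cy Wc uc; have r00 := r0_gt0.
have rr : (0 < r)%N by rewrite muln_gt0 D0.
have NN : (4 * C1 + 9 * s <= N0)%N by have := C8s; move: (C8 * s)%N => a; lia.
have N00 : (0 < N0)%N by apply: leq_trans NN; lia.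
have pathc i : (i <= 2 * N0)%N -> exists z, dev c z (level r N0 i) <= (C1 * r)%:R.
  move=> iN; have := step_path cy Wc iN.
  have : (0 : R) < rho / 4 * r0%:R.
    by apply: mulr_gt0; [apply: divr_gt0; first exact: rho_gt0 | rewrite ltr0n].
  move=> h1 h2; have := lt_le_trans h1 h2; rewrite ltr0n => /card_gt0P[z].
  by rewrite inE; exists z.
have far : 4 * (((k + 1) * t * D)%:R + (C1 * r)%:R) <= (N0 * r)%:R :> R.
  rewrite -natrD -natrM ler_nat.
  have h1 : ((4 * C1 + 9 * s) * r <= N0 * r)%N by rewrite leq_mul2r NN orbT.
  apply: leq_trans h1; rewrite [leqRHS]mulnDl [leqLHS]mulnDr [leqLHS]addnC.
  apply: leq_add; first by rewrite mulnA.
  have h2 : ((k + 1) * t <= 2 * s ^ 2)%N.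
    by rewrite mulnDl mul1n; have := leq_pmull t k0; lia.
  have h3 : (s <= r0)%N by rewrite /= mulnA leq_pmull // !muln_gt0; have := Kc6;
    case: (Kc).
  apply: (@leq_trans (4 * (2 * s ^ 2 * D))).
    by rewrite leq_mul2l leq_mul2r h2 !orbT.
  rewrite -mulnn; apply: (@leq_trans (9 * s * (D * s))).
    by rewrite -!mulnA [(s * D)%N]mulnC; move: (s * (D * s))%N => a; lia.
  by rewrite leq_mul2l [(D * s <= _)%N]leq_mul2l h3 !orbT.
have [i [z [h1 h2 h3]]] := crossing OP0 eps0 unb rr N00 (ltac:(by rewrite addn_gt0 orbT)
  : (0 < C1)%N) Eeps pathc uc far.
exists i, z; split => //; apply: le_trans h3 _; rewrite ler_nat; apply: eq_leq; ring.
Qed.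

(** Both [y] and an undecided [u] are close to path elements of known levels. Levels more than
    [(4 + 32 * k) * B] apart would decide the pair with error at most [2 * 2^-1 ^+ k], below [eta];
    so the levels are close, and with them [y] and [u]. The path elements at the level of [y] renew
    the density of the ball. *)
Lemma iteration_step (eta : R) : 2 * 2^-1 ^+ k < eta ->
  (forall u, eta <= before u y -> eta <= before y u -> dist y u <= (k * t * D)%:R) ->
  step_density * (step_rate * s)%:R <= #|ball y (step_rate * s)|%:R /\
  (forall u, eta <= before u y -> eta <= before y u ->
    dist y u <= (k * (step_rate * s) * D)%:R).
Proof.
move=> etak near; have r00 := r0_gt0.
have rr : (0 < r)%N by rewrite muln_gt0 D0.
have rt : (0 < r0 <= t)%N by rewrite r00.
have [c cy Wc] := find_center c00 rt dense.
have yc : dist y c <= (t * D)%:R by move: cy; rewrite inE.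
have [i [z [iN zi yz]]] : exists i z, [/\ (i <= 2 * N0)%N,
  dev c z (level r N0 i) <= (C1 * r)%:R & dist y z <= (C2 * r)%:R].
  by apply: step_cross => //; apply: le_trans yc _;
    rewrite ler_nat leq_mul2r mulnDl mul1n leq_addl orbT.
have rateE : (step_rate * s * D = (C2 + 2 * C1 + C4) * r)%N by rewrite /step_rate; ring.
split.
  have -> : step_density * (step_rate * s)%:R = rho / 4 * r0%:R.
    have -> : (step_rate * s = (C2 + 2 * C1 + C4) * r0)%N by rewrite /step_rate; ring.
    by rewrite natrM /step_density mulrA divfK // pnatr_eq0 -lt0n ltn_addr // ltn_addl
      // muln_gt0 addn_gt0 orbT.
  apply: le_trans (step_path cy Wc iN) _; rewrite ler_nat;
    apply/subset_leq_card/subsetP => z'.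
  rewrite !inE => z'i; rewrite rateE; apply: le_trans (dist_tri R lt m y z z') _.
  apply: le_trans (lerD yz (dist_dev R OP0 c z z' (level r N0 i))) _.
  apply: le_trans (lerD (lexx _) (lerD zi z'i)) _.
  by rewrite -!natrD ler_nat -!mulnDl leq_mul2r addnn -mul2n leq_addr orbT.
move=> u uy yu; have yu' := near u uy yu.
have [j [z' [jN z'j uz']]] : exists i z, [/\ (i <= 2 * N0)%N,
  dev c z (level r N0 i) <= (C1 * r)%:R & dist u z <= (C2 * r)%:R].
  apply: step_cross => //; apply: le_trans (dist_tri R lt m u y c) _; rewrite dist_sym.
  by apply: le_trans (lerD yu' yc) _;
    rewrite -natrD ler_nat -mulnDl leq_mul2r mulnDl mul1n leqnn orbT.
pose B := ((C1 + C2) * r)%N.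
have B0 : (0 < B)%N by rewrite muln_gt0 rr !addn_gt0 orbT.
have yB : dev c y (level r N0 i) <= B%:R.
  by apply: le_trans (dev_dist R OP0 c y z _) (le_trans (lerD yz zi) _);
    rewrite -natrD ler_nat /B; apply: eq_leq; ring.
have uB : dev c u (level r N0 j) <= B%:R.
  by apply: le_trans (dev_dist R OP0 c u z' _) (le_trans (lerD uz' z'j) _);
    rewrite -natrD ler_nat /B; apply: eq_leq; ring.
set a := level r N0 i in yB zi z'j *; set b := level r N0 j in uB z'j *.
have ab1 : b - a <= (4 + 32 * k)%N%:Z * B%:Z.
  rewrite leNgt; apply/negP => /(separated OP0 B0 yB uB) h.
  have : before u y <= prob (fun f : OPm => value f u <= value f y) by apply: le_prob =>
    f /ltW.
  lra.
have ab2 : a - b <= (4 + 32 * k)%N%:Z * B%:Z.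
  rewrite leNgt; apply/negP => /(separated OP0 B0 uB yB) h.
  have : before y u <= prob (fun f : OPm => value f y <= value f u) by apply: le_prob =>
    f /ltW.
  lra.
apply: le_trans (dist_shift R OP0 c y u a b) _.
have ab : `|a - b| <= ((4 + 32 * k) * B)%N%:Z by rewrite PoszM ler_norml ab2 andbT lerNl
  opprB.
rewrite -(ler_int R) in ab; apply: le_trans (lerD (lerD yB uB) ab) _.
by rewrite -pmulrn -!natrD ler_nat -mulnA rateE /B rate_arith.
Qed.

End Step.

(** * The initial scale *)

Section Initial.
Context (R : realFieldType) {T : finType} (lt : rel T) (m w D : nat).
Context (lt_irr : irreflexive lt) (lt_tr : transitive lt)
  (wT : forall A : {set T}, {in A &, forall x y, ~~ lt x y} -> (#|A| <= w)%N).
Context (OP0 : (0 < #|{: OP lt m}|)%N) (D0 : (0 < D)%N) (w0 : (0 < w)%N).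
Local Notation OPm := (OP lt m).
Local Notation X c f z := (frame c f (Some z)).
Local Notation dist := (dist R lt m).
Local Notation dev := (dev R lt m).
Local Notation lam := (D%:R^-1 : R).
Local Notation before := (before R lt m).

Definition incomp (x : T) : {set T} := [set z | [&& z != x, ~~ lt x z & ~~ lt z x]].

Lemma dist0 y u : dist y u = dev y u 0.
Proof. by apply: eq_expect => f; rewrite /frame subr0 distrC. Qed.

Lemma lamD n : lam * (D * n)%:R = n%:R.
Proof. by rewrite natrM mulrA mulVf ?mul1r // pnatr_eq0 -lt0n. Qed.

Lemma few_points y (A : nat) (e0 : R) (s : int) (L n : nat) : incompressible lt m y A
  lam e0 ->
  - A%:Z <= s -> s + L%:Z <= A%:Z -> (L <= A)%N -> n%:R + 4 * e0 <= lam * L%:R ->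
    0 < e0 ->
  prob (fun f : OPm => (count_win y f s L <= n)%N) <= 1 / 4 :> R.
Proof.
move=> inc h1 h2 h3 h4 e00; have e4 : 0 < 4 * e0 by rewrite mulr_gt0.
have Mk := @markov R _ (fun f : OPm => `|(count_win y f s L)%:R - lam * L%:R|) _ e4.
apply: le_trans (_ : prob (fun f : OPm =>
  4 * e0 <= `|(count_win y f s L)%:R - lam * L%:R|) <= _).
  apply: le_prob => f fn; rewrite distrC ler_normr; apply/orP; left.
  have : (count_win y f s L)%:R <= n%:R :> R by rewrite ler_nat.
  lra.
apply: le_trans (Mk _) _ => //.
rewrite ler_pdivrMr // mulrA mul1r mulVf ?mul1r ?pnatr_eq0 //.
exact: inc.
Qed.

Section AtPoint.
Context (y : T) (n q : nat) (n0 : (0 < n)%N) (q24 : (24 * q <= n)%N) (q0 : (0 < q)%N)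
  (qn : (8 * n + 1 <= q ^ 2)%N).
Context (incy : incompressible lt m y (D * q ^ 2) lam (6 * q%:R)).
Context (incn : forall x, (#|incomp x| <= n)%N).
Local Notation L := (D * (8 * n))%N.

Lemma L_le : (L + 1 <= D * q ^ 2)%N.
Proof.
apply: leq_trans (_ : D * (8 * n + 1) <= _)%N; last by rewrite leq_mul2l qn orbT.
by rewrite mulnDr muln1 leq_add2l.
Qed.

Lemma e0_le : 4 * (6 * q%:R) <= n%:R :> R.
Proof. by rewrite mulrA -[4 * 6]natrM -natrM ler_nat. Qed.

Lemma e0_gt0 : 0 < 6 * q%:R :> R.
Proof. by rewrite mulr_gt0 // ltr0n. Qed.

(** If [u] were more than [L] away from [y], the elements in the window between them would be
    incomparable to [y] or to [u]. There are at most [2 * n] of those, while about [8 * n] are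
    expected. *)
Lemma incomp_dist u : u \in incomp y -> dist y u <= (424 * n * D)%:R.
Proof.
rewrite inE => /and3P[uy ny nu]; have LA := L_le; have e1 := e0_le; have e2 := e0_gt0.
have lL : lam * L%:R = (8 * n)%:R by rewrite lamD.
have e3 : (2 * n)%:R + 4 * (6 * q%:R) <= lam * L%:R by rewrite lL !natrM; lra.
have i2 : (#|incomp y :|: incomp u| <= 2 * n)%N.
  apply: leq_trans (_ : #|incomp y| + #|incomp u| <= _)%N;
    first by rewrite cardsU leq_subr.
  by rewrite mul2n -addnn leq_add.
have up : prob (fun f : OPm => (1 + L%:Z <= X y f u)) <= 1 / 4 :> R.
  apply: le_trans (few_points incy (s := 1) (L := L) (n := 2 * n) _ _ _ e3 e2); try lia.
  apply: le_prob => f h; apply: leq_trans i2; apply/subset_leq_card/subsetP => z.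
  rewrite !inE /in_window => hz.
  have n1 : ~~ lt z y by apply/negP => /(value_mono f); move: hz; rewrite /frame; lia.
  have n2 : ~~ lt u z by apply/negP => /(value_mono f); move: hz h; rewrite /frame; lia.
  have n3 : z != y by apply: contraTneq hz => ->; rewrite frame_c; lia.
  have n4 : z != u by apply: contraTneq hz => ->; move: h; lia.
  rewrite n1 n2 n3 n4 andbT /= -negb_and; apply/negP => /andP[yz zu].
  by move: ny; rewrite (lt_tr yz zu).
have down : prob (fun f : OPm => (X y f u < - L%:Z)) <= 1 / 4 :> R.
  apply: le_trans (few_points incy (s := - L%:Z) (L := L) (n := 2 * n) _ _ _ e3 e2);
    try lia.
  apply: le_prob => f h; apply: leq_trans i2; apply/subset_leq_card/subsetP => z.
  rewrite !inE /in_window => hz.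
  have n1 : ~~ lt y z by apply/negP => /(value_mono f); move: hz; rewrite /frame; lia.
  have n2 : ~~ lt z u by apply/negP => /(value_mono f); move: hz h; rewrite /frame; lia.
  have n3 : z != y by apply: contraTneq hz => ->; rewrite frame_c; lia.
  have n4 : z != u by apply: contraTneq hz => ->; move: h; lia.
  rewrite n1 n2 n3 n4 /= andbT -negb_and; apply/negP => /andP[zy uz].
  by move: nu; rewrite (lt_tr uz zy).
have core : 1 / 2 <= prob (fun f : OPm => 0 - L%:Z <= X y f u < 0 + (L + 1)%N%:Z) :> R.
  have hU := probU (R := R) (fun f : OPm => (1 + L%:Z <= X y f u)) (fun f : OPm =>
    (X y f u < - L%:Z)).
  have hC := probC (R := R) OP0 (fun f : OPm =>
    (1 + L%:Z <= X y f u) || (X y f u < - L%:Z)).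
  have : prob (fun f : OPm => ~~ ((1 + L%:Z <= X y f u) || (X y f u < - L%:Z))) <=
     prob (fun f : OPm => 0 - L%:Z <= X y f u < 0 + (L + 1)%N%:Z) :> R by apply: le_prob
       => f; lia.
  lra.
have l0 : (0 < L + (L + 1))%N by rewrite addn_gt0 addn1 orbT.
have half0 : (0 : R) < 1 / 2 by rewrite divr_gt0.
have G4 : (2 : R) <= 4%:R * (1 / 2) by lra.
rewrite dist0; apply: le_trans (dev_core OP0 l0 half0 G4 core) _; rewrite ler_nat.
have : (1 <= D * n)%N by rewrite muln_gt0 D0.
have -> : (L = 8 * (D * n))%N by rewrite mulnCA.
have -> : (424 * n * D = 424 * (D * n))%N by rewrite -mulnA [(n * D)%N]mulnC.
by move: (D * n)%N; clear; lia.
Qed.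

(** If a window just above [y] holds fewer than [h] elements, counting [y], any element above [y] in
    it belongs here, since everything between it and [y] is in the window too. *)
Definition upto (h : nat) : {set T} :=
  [set z | ((z == y) || lt y z) && (#|[set t | ((t == y) || lt y t) && lt t z]| < h)%N].

(** A chain of more than [h] elements would give its last member at least [h] predecessors that are
    equal to or above [y]. *)
Lemma card_upto h : (0 < h)%N -> (#|upto h| <= w * h)%N.
Proof.
move=> h0; rewrite leqNgt; apply/negP => hU.
have [x [s [xs sU sh]]] := long_chain wT hU.
have lU := sU _ (mem_last x s); move: (lU); rewrite inE => /andP[_]; apply/negP;
  rewrite -leqNgt.
have us : uniq (x :: s) by apply: (sorted_uniq lt_tr lt_irr).
rewrite -{1}sh -(size_belast x s).
have /card_uniqP <- : uniq (belast x s) by move: us;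
  rewrite lastI rcons_uniq => /andP[].
apply/subset_leq_card/subsetP => z zb; rewrite inE.
have zs : z \in x :: s by rewrite lastI mem_rcons inE zb orbT.
have := sU z zs; rewrite inE => /andP[-> _] /=.
move: xs zb; clear -lt_tr; elim: s x => [|a s IH] x //= /andP[xa as_].
rewrite inE => /orP[/eqP ->|zb]; last exact: IH.
have xas : path lt x (a :: s) by rewrite /= xa.
by have /allP h := order_path_min lt_tr xas; apply: h; exact: mem_last.
Qed.

(** Unless it is overcrowded, the window above [y] draws only on the at most [17 * w * n] elements
    of [Rel]. Those that hit it with probability below [1 / (17 * w)] account for at most [n] of the
    mean, so at least [6 * n] others remain, and [dev_core] bounds their distance; 1096 is
    [8 * 137]. *)
Lemma initial_dense : (6 * n <= #|ball R lt m D y (1096 * w * n)|)%N.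
Proof.
have LA := L_le; have e1 := e0_le; have e2 := e0_gt0.
pose Rel := incomp y :|: upto (16 * n).
have cRel : (#|Rel| <= 17 * w * n)%N.
  apply: leq_trans (_ : #|incomp y| + #|upto (16 * n)| <= _)%N;
    first by rewrite cardsU leq_subr.
  have h1 := incn y; have h2 : (#|upto (16 * n)| <= w * (16 * n))%N by apply: card_upto;
    rewrite muln_gt0.
  have h3 : (n <= w * n)%N by rewrite leq_pmull.
  apply: leq_trans (leq_add (leq_trans h1 h3) h2) _.
  by rewrite -[(17 * w * n)%N]mulnA mulnCA -mulSn.
pose P z : R := prob (fun f : OPm => 1 <= X y f z < L%:Z).
have n24 : (24 <= n)%N by apply: leq_trans q24; rewrite leq_pmulr.
have n24R : 24 <= n%:R :> R by rewrite ler_nat.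
have L0 : (0 < L)%N by rewrite !muln_gt0 D0.
have lL : lam * L%:R = 8 * n%:R by rewrite lamD natrM.
have i1 : expect (fun f : OPm => `|(count_win y f 0 L)%:R - lam * L%:R|) <= 6 * q%:R.
  by apply: incy; move: LA; clear; lia.
have i2 : expect (fun f : OPm => `|(count_win y f 1 L.-1)%:R - lam * L.-1%:R|) <= 6 *
  q%:R.
  by apply: incy; move: LA L0; clear; lia.
have lL' : 8 * n%:R - 1 <= lam * L.-1%:R.
  rewrite -lL -subn1 natrB // mulrBr mulr1 lerB // invf_le1 ?ltr0n //; by rewrite ler1n.
have sumP : 7 * n%:R <= \sum_(z in Rel) P z.
  have point (f : OPm) : (count_win y f 1 L.-1)%:R <= \sum_(z in Rel) (1 <= X y f z <
    L%:Z)%R%:R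
      + 2 * `|(count_win y f 0 L)%:R - 8 * n%:R| :> R.
    have [big|few] := leqP (16 * n) (count_win y f 0 L).
      have h1 : (count_win y f 1 L.-1 <= count_win y f 0 L)%N.
        apply/subset_leq_card/subsetP => z; rewrite !inE /in_window; move: L0; clear;
          lia.
      rewrite -(ler_nat R) in h1; rewrite -(ler_nat R) natrM in big.
      have h2 := ler_norm ((count_win y f 0 L)%:R - 8 * n%:R : R).
      have h3 : 0 <= \sum_(z in Rel) (1 <= X y f z < L%:Z)%R%:R :> R by apply: sumr_ge0
        => z _.
      by move: h1 big h2 h3; lra.
    rewrite -[leLHS]addr0; apply: lerD; last by rewrite mulr_ge0.
    rewrite /count_win -sum1_card natr_sum [leLHS]big_mkcond [leRHS]big_mkcond.
    apply: ler_sum => z _; rewrite inE /in_window.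
    have -> : (1 <= X y f z < 1 + L.-1%:Z) = (1 <= X y f z < L%:Z) by move: L0; clear;
      lia.
    case hz : (1 <= X y f z < L%:Z); last by case: ifP.
    rewrite (_ : z \in Rel) //; rewrite !inE.
    have n1 : ~~ lt z y by apply/negP => /(value_mono f); move: hz; rewrite /frame;
      clear; lia.
    have n3 : z != y by apply: contraTneq hz => ->; rewrite frame_c.
    rewrite n1 n3 /= andbT; case yz : (lt y z) => //=.
    rewrite orbT /=; apply: leq_ltn_trans few; apply/subset_leq_card/subsetP => t;
      rewrite !inE /in_window => /andP[yt tz].
    have h1 : value f y <= value f t by case/orP: yt => [/eqP ->//|/(value_mono f)].
    have h2 := value_mono f tz; move: hz h1 h2; rewrite /frame; clear; lia.
  have := ler_expect point; rewrite expectD expectZ expect_sum.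
  move=> h1; have : lam * L.-1%:R - 6 * q%:R <= expect (fun f : OPm =>
    (count_win y f 1 L.-1)%:R).
    rewrite lerBlDr -lerBlDl; apply: le_trans i2.
    rewrite -[lam * L.-1%:R in leLHS](expect_cst OP0) -expectB; apply: ler_expect => f.
    by rewrite distrC ler_norm.
  rewrite lL in i1; rewrite -/(prob _) in h1.
  move: h1 i1 lL' e1 n24R; rewrite /P; lra.
have w0' : (0 : R) < w%:R by rewrite ltr0n.
have many : 6 * n%:R <= #|[set z in Rel | 1 / (17 * w%:R) <= P z]|%:R :> R.
  have : \sum_(z in Rel) P z <= #|[set z in Rel | 1 / (17 * w%:R) <= P z]|%:R + 1 / (17
    * w%:R) * #|Rel|%:R.
    have -> : #|[set z in Rel | 1 / (17 * w%:R) <= P z]|%:R = \sum_(z in Rel) (1 / (17 *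
      w%:R) <= P z)%R%:R :> R.
      rewrite -sum1_card natr_sum [LHS]big_mkcond [RHS]big_mkcond;
        apply: eq_bigr => z _.
      by rewrite inE; case: (z \in Rel) => //=; case: (_ <= P z).
    rewrite [1 / (17 * w%:R) * #|_|%:R]mulr_natr -sumr_const -big_split;
      apply: ler_sum => z _ /=.
    have r0 : 0 <= 1 / (17 * w%:R) :> R by rewrite divr_ge0 // mulr_ge0.
    case: (leP (1 / (17 * w%:R)) (P z)) => h; last by rewrite add0r ltW.
    by apply: le_trans (prob_le1 OP0 _) _; rewrite lerDl.
  have : 1 / (17 * w%:R) * #|Rel|%:R <= n%:R :> R.
    rewrite div1r mulrC ler_pdivrMr ?mulr_gt0 // -natrM -natrM ler_nat.
    by apply: leq_trans cRel _; rewrite mulnC.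
  move: sumP; lra.
rewrite -(ler_nat R) natrM; apply: le_trans many _; rewrite ler_nat.
apply/subset_leq_card/subsetP => z; rewrite !inE => /andP[_ Pz].
have r0 : 0 < 1 / (17 * w%:R) :> R by rewrite divr_gt0 // mulr_gt0.
have G2 : 2 <= (34 * w)%:R * (1 / (17 * w%:R)) :> R.
  by rewrite div1r ler_pdivlMr ?mulr_gt0 // natrM; lra.
have core : 1 / (17 * w%:R) <= prob (fun f : OPm =>
  0 - 0%N%:Z <= X y f z < 0 + L%:Z) :> R.
  by apply: le_trans Pz _; apply: le_prob => f; clear; lia.
rewrite dist0; apply: le_trans (dev_core OP0 (L0 : 0 < 0 + L)%N r0 G2 core) _.
rewrite ler_nat add0n addn0; apply: (@leq_trans (L * (137 * w))).
  by rewrite leq_mul2l; apply/orP; right; move: w0; clear; lia.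
by apply: eq_leq; ring.
Qed.

End AtPoint.
End Initial.

(** * Counting around an anchor *)

Section Counting.
Context (R : realFieldType) {T : finType} (lt : rel T) (m D : nat).
Context (OP0 : (0 < #|{: OP lt m}|)%N) (D0 : (0 < D)%N).
Local Notation OPm := (OP lt m).
Local Notation X c f z := (frame c f (Some z)).
Local Notation dist := (dist R lt m).
Local Notation lam := (D%:R^-1 : R).

Lemma expect_count_le c A (e0 : R) s L : incompressible lt m c A lam e0 ->
  - A%:Z <= s -> s + L%:Z <= A%:Z -> (L <= A)%N ->
  expect (fun f : OPm => (count_win c f s L)%:R) <= lam * L%:R + e0.
Proof.
move=> inc h1 h2 h3; rewrite -lerBlDl; apply: le_trans (inc _ _ h1 h2 h3).
rewrite -[lam * L%:R in leLHS](expect_cst OP0) -expectB; apply: ler_expect => f;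
  exact: ler_norm.
Qed.

(** By Markov each member is in the window of radius [2 * r * D] with probability at least 1/2, and
    at most [10 * r] elements are expected there. *)
Lemma ball_count y (r : nat) : (4 <= r)%N ->
  incompressible lt m y (D * r ^ 2) lam (6 * r%:R) ->
  (#|ball R lt m D y r| <= 20 * r)%N.
Proof.
move=> r4 inc; have r0 : (0 < r)%N by apply: leq_trans r4.
have B0 : (0 < r * D)%N by rewrite muln_gt0 r0.
have LA : (2 * (2 * (r * D)) <= D * r ^ 2)%N.
  by rewrite -mulnn [(D * _)%N]mulnC -mulnA mulnA leq_mul2r; apply/orP; right; nia.
have E := expect_count_le (s := - (2 * (r * D))%N%:Z) (L := 2 * (2 * (r * D))) inc.
have {}E : expect (fun f : OPm => (count_win y f (- (2 * (r * D))%N%:Z) (2 * (2 * (r *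
  D))))%:R) <= lam * (2 * (2 * (r * D)))%:R + 6 * r%:R.
  by apply: E; move: LA; clear; lia.
have lE : lam * (2 * (2 * (r * D)))%:R = 4 * r%:R.
  rewrite mulnA mulnA mulnC natrM mulrA mulVf ?mul1r ?pnatr_eq0 -?lt0n // natrM; ring.
have : (1 / 2) * #|ball R lt m D y r|%:R <= 4 * r%:R + 6 * r%:R :> R.
  rewrite -lE; apply: le_trans E; rewrite mulr_natr -sumr_const.
  apply: (@le_trans _ _ (\sum_(u in ball R lt m D y r) prob (fun f : OPm =>
    0 - (2 * (r * D))%:Z <= X y f u < 0 + (2 * (r * D))%:Z))).
    apply: ler_sum => u; rewrite inE => uy; apply: markov_dev => //.
    by rewrite -(dist0 R).
  rewrite -expect_sum; apply: ler_expect => f.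
  rewrite -natr_sum ler_nat /count_win -sum1_card big_mkcond [leqRHS]big_mkcond.
  apply: leq_sum => u _; case: (u \in _) => //; rewrite inE /in_window.
  set P1 := (_ <= _ < _); set P2 := (_ <= _ < _).
  by have -> : P1 = P2 by rewrite /P1 /P2; clear; lia.
move=> h; rewrite -(ler_nat R) natrM; lra.
Qed.

Section Anchors.
Context (c y : T) (q t : nat) (q0 : (0 < q)%N) (t0 : (0 < t)%N) (tq : (2 * t + 1 <= q ^
  2)%N).
Context (inc : incompressible lt m c (D * q ^ 2) lam (6 * q%:R)) (cy : dist c y <= (t *
  D)%:R).

Lemma windowed (s : int) (S : {set T}) :
  - (D * q ^ 2)%N%:Z <= s -> s + (2 * (t * D))%N%:Z <= (D * q ^ 2)%N%:Z ->
  (forall (f : OPm) z, z \in S -> `|X c f y| < (2 * (t * D))%N%:Z ->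
    s <= X c f z < s + (2 * (t * D))%N%:Z) ->
  (#|S| <= 4 * t + 12 * q)%N.
Proof.
move=> h1 h2 hS; have B0 : (0 < t * D)%N by rewrite muln_gt0 t0.
have LA : (2 * (t * D) <= D * q ^ 2)%N.
  rewrite mulnA [(D * _)%N]mulnC leq_mul2r; apply/orP; right.
  by apply: leq_trans tq; rewrite leq_addr.
have E := expect_count_le inc h1 h2 LA.
have lE : lam * (2 * (t * D))%:R = 2 * t%:R.
  rewrite mulnA mulnC natrM mulrA mulVf ?mul1r ?pnatr_eq0 -?lt0n // natrM; ring.
have M0 : (0 : R) < (2 * (t * D))%:R by rewrite ltr0n muln_gt0.
have Mk := @markov R _ (fun f : OPm => `|value f c - value f y|%:~R) _ M0.
have {}Mk : prob (fun f : OPm => (2 * (t * D))%:R <= `|value f c - value f y|%:~R :> R)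
  <= 1 / 2 :> R.
  apply: le_trans (Mk _) _; first by move=> f; rewrite ler0z.
  by rewrite ler_pdivrMr // natrM -[1 / 2 * _]mulrC; apply: le_trans cy _; lra.
have half := probC (R := R) OP0 (fun f : OPm =>
  (2 * (t * D))%:R <= `|value f c - value f y|%:~R :> R).
have : #|S|%:R * prob (fun f : OPm =>
  ~~ ((2 * (t * D))%:R <= `|value f c - value f y|%:~R :> R)) <= 2 * t%:R + 6 * q%:R :>
  R.
  rewrite -lE; apply: le_trans E; rewrite -expectZ; apply: ler_expect => f.
  case: (boolP ((2 * (t * D))%:R <= `|value f c - value f y|%:~R :> R)) => hf /=;
    first by rewrite mulr0.
  rewrite mulr1 ler_nat; apply/subset_leq_card/subsetP => z zS; rewrite inE;
    apply: hS => //.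
  by move: hf; rewrite -ltNge pmulrn ltr_int /frame distrC.
move=> h; rewrite -(ler_nat R) natrD !natrM.
have : (0 : R) <= #|S|%:R by rewrite ler0n.
nra.
Qed.

(** Such elements are trapped in a window as soon as [y] is within [2 * t * D] of [c], which has
    probability at least 1/2. This will exclude anchors deep inside the padding. *)
Lemma few_above (S : {set T}) : (forall z, z \in S -> lt c z && lt z y) ->
  (#|S| <= 4 * t + 12 * q)%N.
Proof.
move=> hS; have h : (2 * (t * D) + D <= D * q ^ 2)%N.
  by rewrite mulnA [(D * _)%N]mulnC -mulSnr leq_mul2r -addn1 tq orbT.
apply: (@windowed 0); try (move: h; clear; lia).
move=> f z /hS/andP[/(value_mono f) h1 /(value_mono f) h2]; move: h1 h2; rewrite /frame;
  clear; lia.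
Qed.

Lemma few_below (S : {set T}) : (forall z, z \in S -> lt y z && lt z c) ->
  (#|S| <= 4 * t + 12 * q)%N.
Proof.
move=> hS; have h : (2 * (t * D) + D <= D * q ^ 2)%N.
  by rewrite mulnA [(D * _)%N]mulnC -mulSnr leq_mul2r -addn1 tq orbT.
apply: (@windowed (1 - (2 * (t * D))%N%:Z)); try (move: h D0; clear; lia).
move=> f z /hS/andP[/(value_mono f) h1 /(value_mono f) h2]; move: h1 h2; rewrite /frame;
  clear; lia.
Qed.

End Anchors.
End Counting.

(** * From injective to order-preserving maps *)

Section FromInjective.
Context (R : realFieldType) {T : finType} (lt : rel T) (D M : nat).
Local Notation n := #|T|.
Local Notation m := (n * D)%N.
Context (lt_irr : irreflexive lt) (n0 : (0 < n)%N) (LE0 : (0 < #|{: LE lt}|)%N)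
  (D2 : (1 < D)%N) (M0 : (0 < M)%N) (DM : (M * collision_const (T := T) <= D)%N).

(** [2 * q ^ 4 <= B] makes the event that [c] is near an end cheap even when weighted by a window
    mean of [q ^ 2]. Injective maps give [2 * q + 3], and collisions add at most 1. *)
Lemma incompressible_mid c (B q : nat) : (0 < q)%N -> (B <= #|[set z | lt z c]|)%N ->
  (B <= #|[set z | lt c z]|)%N ->
  (2 * q ^ 4 <= B)%N -> (n + q ^ 2 <= M)%N ->
  incompressible lt m c (D * q ^ 2) (D%:R^-1 : R) (6 * q%:R).
Proof.
move=> q0 nb na qB qM s L h1 h2 h3.
have D0 : (0 < D)%N by apply: ltnW.
have B0 : (0 < B)%N by apply: leq_trans qB; rewrite muln_gt0 expn_gt0 q0.
have mE : n%:R / m%:R = D%:R^-1 :> R.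
  by rewrite natrM invfM mulrA divff ?mul1r // pnatr_eq0 -lt0n.
have D0' : (0 : R) < D%:R by rewrite ltr0n.
have q0' : (0 : R) < q%:R by rewrite ltr0n.
have Lq : L%:R / D%:R <= q%:R ^+ 2 :> R.
  by rewrite ler_pdivrMr // -natrX -natrM ler_nat mulnC.
have l0 : 0 <= L%:R / D%:R :> R by rewrite divr_ge0.
have Am : (2 * (D * q ^ 2) < m)%N.
  rewrite mulnCA mulnC ltn_mul2r D0 /=.
  have : (B < n)%N.
    apply: leq_ltn_trans nb _; rewrite -[n]cardsT; apply: proper_card; rewrite properT.
    by apply/negP => /eqP/setP/(_ c); rewrite !inE lt_irr.
  apply: leq_ltn_trans; apply: leq_trans qB; rewrite leq_mul2l /=.
  by rewrite leq_pexp2l.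
have LB : (L%:R / D%:R) * (2 * (D * q ^ 2)%:R / D%:R) <= B%:R :> R.
  have -> : 2 * (D * q ^ 2)%:R / D%:R = 2 * q%:R ^+ 2 :> R.
    by rewrite natrM natrX; field; rewrite gt_eqF.
  apply: le_trans (_ : q%:R ^+ 2 * (2 * q%:R ^+ 2) <= _).
    by rewrite ler_wpM2r // mulr_ge0 // exprn_ge0 // ltW.
  have -> : q%:R ^+ 2 * (2 * q%:R ^+ 2) = (2 * q ^ 4)%:R :> R by rewrite natrM natrX;
    ring.
  by rewrite ler_nat.
have LA : s + L%:Z <= (D * q ^ 2)%N%:Z + 1 by apply: le_trans h2 _; rewrite lerDl.
have inj := incompress_INJ D0 lt_irr n0 LE0 (leq_pmulr n D0) mE h1 LA Am q0' Lq nb na B0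
  LB.
pose K : R := n%:R + q%:R ^+ 2.
pose Y (f : OP lt m) : R := `|(count_win c f s L)%:R - L%:R / D%:R|.
have YK f : 0 <= Y f <= K.
  rewrite /Y normr_ge0 /=; apply: le_trans (ler_normB _ _) _;
    rewrite normr_nat ger0_norm //.
  by rewrite lerD // ler_nat max_card.
have := expect_OP LE0 n0 D2 M0 DM YK; rewrite ler_norml => /andP[_ h].
have KM : K / M%:R <= 1.
  by rewrite ler_pdivrMr ?ltr0n // mul1r /K -natrX -natrD ler_nat.
have q1 : (1 : R) <= q%:R by rewrite ler1n.
have -> : expect (fun f : OP lt m =>
  `|(count_win c f s L)%:R - D%:R^-1 * L%:R|) = expect Y.
  by apply: eq_expect => f; rewrite mulrC.
have {}inj : expect (fun f : INJ lt m => Y (of_INJ f)) <= 2 * q%:R + 3 by [].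
lra.
Qed.

Definition prec (u v : T) : R := prob (fun h : LE lt => (ival h u < ival h v)%N).

Lemma before_prec u v : `|before R lt m u v - prec u v| <= M%:R^-1.
Proof.
rewrite /prec -(prob_rank R LE0 (leq_pmulr n (ltnW D2))).
have YK (f : OP lt m) : 0 <= ((value f u < value f v)%R%:R : R) <= 1.
  by case: (_ < _); rewrite /= ?lexx ?ler01.
by have := expect_OP LE0 n0 D2 M0 DM YK; rewrite div1r.
Qed.

End FromInjective.

(** * Iterating down *)

Section State.
Context (R : realFieldType) {T : finType} (lt : rel T) (m D : nat).

Definition near (y : T) (eta : R) (r : nat) := forall u,
  eta <= before R lt m u y -> eta <= before R lt m y u -> dist R lt m y u <= (r * D)%:R.

Definition unbalanced (eps : R) := forall u v : T, u != v ->
  before R lt m u v <= 1 / 2 - eps \/ 1 / 2 + eps <= before R lt m u v.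

Record setting (w : nat) (eps : R) : Prop := Setting {
  set_irr : irreflexive lt;
  set_tr : transitive lt;
  set_wT : forall A : {set T}, {in A &, forall x y, ~~ lt x y} -> (#|A| <= w)%N;
  set_OP0 : (0 < #|{: OP lt m}|)%N;
  set_D0 : (0 < D)%N;
  set_unb : unbalanced eps }.
End State.

Section Constants.
Context (R : archiRealFieldType).

Lemma nat_above (x y : R) : 0 < y -> exists n : nat, x <= n%:R * y.
Proof.
move=> y0; exists (Num.bound (`|x| / y)).
have : `|x| / y < (Num.bound (`|x| / y))%:R.
  by apply: archi_boundP; rewrite divr_ge0 // ltW.
by rewrite ltr_pdivrMr // => /ltW; apply: le_trans; exact: ler_norm.
Qed.

(** The constants depend on [w], [eps] and the density [c0] only, so four steps can be chained
    before the poset is given. *)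
Lemma step_exists (w : nat) (eps c0 : R) : (0 < w)%N -> 0 < eps -> 0 < c0 ->
  exists (rate r1 q1 : nat) (c1 : R), [/\ (0 < rate)%N, (0 < q1)%N, 0 < c1 &
  forall (T : finType) (lt : rel T) (m D : nat), setting lt m D w eps ->
  forall (y : T) (k t s : nat) (eta : R), (0 < k)%N -> (0 < s)%N ->
    (k * t <= s ^ 2)%N ->
  (r1 * s <= t)%N ->
  (forall c, c \in ball R lt m D y t ->
    incompressible lt m c (D * (q1 * s) ^ 2) (D%:R^-1 : R) (6 * (q1 * s)%:R)) ->
  c0 * t%:R <= #|ball R lt m D y t|%:R -> 2 * 2^-1 ^+ k < eta ->
    near lt m D y eta (k * t) ->
  c1 * (rate * s)%:R <= #|ball R lt m D y (rate * s)|%:R /\ near lt m D y eta (k * (rate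
    * s))].
Proof.
move=> w0 eps0 c00; have w0' : (0 : R) < w%:R by rewrite ltr0n.
pose rho := c0 / (23 * w%:R); have rho0 : 0 < rho by rewrite divr_gt0 // mulr_gt0.
have rho8 : 0 < rho / 8 by rewrite divr_gt0.
have [G hG] := nat_above 2 rho8.
have [E hE] := nat_above 4 eps0.
have [K hK] := nat_above (12 * (16 * w + 2)%:R) rho0.
pose Kc := (K + 6)%N.
have K6 : (6 <= Kc)%N by rewrite leq_addl.
have Kc0 : (0 < Kc)%N by apply: leq_trans K6.
have hKc : 12 * (16 * w + 2)%:R <= rho * Kc%:R.
  by apply: le_trans hK _; rewrite mulrC ler_pM2l // ler_nat leq_addr.
have d0 : (0 < E * 3 * (12 * G + 4) * (8 * E + 3) + 2 * (12 * G + 4) + 38 * (12 * G + 4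
  + E * 3 * (12 * G + 4) * (8 * E + 3)))%N.
  by rewrite ltn_addr // ltn_addl // muln_gt0 addn_gt0 orbT.
exists (step_rate G E Kc), (Kc * (Kc * (14 + 4 * (12 * G + 4))))%N,
  (Kc * (14 + 4 * (12 * G + 4)))%N, (step_density w c0 G E).
split.
- by rewrite /step_rate muln_gt0 d0 andbT !muln_gt0 Kc0.
- by rewrite muln_gt0 Kc0.
- by rewrite /step_density; apply: divr_gt0; [apply: divr_gt0|rewrite ltr0n].
move=> T lt m D [irr tr wT OP0 D0 unb] y k t s eta k0 s0 kts rt inc dense etak nr.
apply: (iteration_step irr tr wT OP0 D0 w0 eps0 unb c00 k0 s0 kts _ hG hE K6 hKc inc
  dense etak nr).
by move: rt; rewrite -!mulnA.
Qed.

Lemma near_count (w : nat) (eps : R) : (0 < w)%N -> 0 < eps -> exists V : nat,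
  forall v, (V <= v)%N ->
  forall (T : finType) (lt : rel T) (m D : nat), setting lt m D w eps ->
  forall (y : T) (n : nat) (eta : R), (v ^ 128 <= n)%N -> (1096 * w * n <= v ^ 129)%N ->
  (forall x, #|incomp lt x| <= n)%N ->
  (forall c q, c \in ball R lt m D y (1096 * w * n) -> (0 < q <= n)%N ->
     incompressible lt m c (D * q ^ 2) (D%:R^-1 : R) (6 * q%:R)) ->
  2 * 2^-1 ^+ v < eta ->
  (#|[set u | (eta <= before R lt m u y)%R && (eta <= before R lt m y u)%R]| <= v ^
    13)%N.
Proof.
move=> w0 eps0; have w0' : (0 : R) < w%:R by rewrite ltr0n.
(* [initial_dense] finds [6 * n] elements within [1096 * w * n]. *)
pose c0 : R := 6 / (1096 * w%:R); have c00 : 0 < c0 by rewrite divr_gt0 // mulr_gt0.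
have [r0 [a0 [q0 [c1 [r00 q00 c10 step0]]]]] := step_exists w0 eps0 c00.
have [r1 [a1 [q1 [c2 [r10 q10 c20 step1]]]]] := step_exists w0 eps0 c10.
have [r2 [a2 [q2 [c3 [r20 q20 c30 step2]]]]] := step_exists w0 eps0 c20.
have [r3 [a3 [q3 [c4 [r30 q30 c40 step3]]]]] := step_exists w0 eps0 c30.
exists (r0 + r1 + r2 + r3 + (a0 + a1 + a2 + a3) + (q0 + q1 + q2 + q3) + 400)%N => v Vv.
move=> T lt m D st y n eta vn nv incn inc etav.
have [irr tr wT OP0 D0 unb] := st.
have v0 : (0 < v)%N by apply: leq_trans Vv; rewrite addn_gt0 orbT.
have [[b0 b1 b2 b3] [e0 e1 e2 e3] [f0 f1 f2 f3] big] : [/\ [/\ r0 <= v, r1 <= v,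
  r2 <= v & r3 <= v],
   [/\ a0 <= v, a1 <= v, a2 <= v & a3 <= v], [/\ q0 <= v, q1 <= v,
     q2 <= v & q3 <= v] & 400 <= v]%N.
  by move: Vv; clear; split; try split; lia.
have pw i j : (i <= j)%N -> (v ^ i <= v ^ j)%N by move=> ij; rewrite leq_pexp2l.
have mw a i j : (a <= v)%N -> (i < j)%N -> (a * v ^ i <= v ^ j)%N.
  move=> av ij; apply: leq_trans (_ : v ^ i.+1 <= _)%N; last exact: pw.
  by rewrite expnS leq_mul2r av orbT.
pose t0 := (1096 * w * n)%N.
have n_big : (v <= n)%N by apply: leq_trans vn; rewrite -{1}(expn1 v) pw.
have n_t0 : (n <= t0)%N by rewrite leq_pmull // muln_gt0.
have n0 : (0 < n)%N by apply: leq_trans n_big.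
have eta0 : 0 < eta by apply: le_lt_trans etav;
  rewrite mulr_ge0 // exprn_ge0 // invr_ge0.
have ball_mono a b : (a <= b)%N -> forall c, c \in ball R lt m D y a ->
  c \in ball R lt m D y b.
  move=> ab c; rewrite !inE => h; apply: le_trans h _;
    by rewrite ler_nat leq_mul2r ab orbT.
have yball : y \in ball R lt m D y t0.
  rewrite inE /dist (eq_expect (Y := fun=> 0)) ?expect_cst //.
  by move=> f; rewrite subrr normr0.
pose q := (n %/ 24)%N.
have q24 : (24 * q <= n)%N by rewrite mulnC leq_trunc_div.
have q400 : (400 <= q)%N.
  rewrite leq_divRL //; apply: leq_trans vn; apply: leq_trans (pw 2 128 isT).
  by rewrite -mulnn leq_mul //; exact: leq_trans big.
have q0' : (0 < q)%N by exact: leq_trans q400.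
have qn48 : (n <= 48 * q)%N.
  by have := ltn_ceil n (isT : (0 < 24)%N); rewrite -/q; move: q0'; clear; lia.
have qn : (8 * n + 1 <= q ^ 2)%N.
  rewrite -mulnn; apply: (@leq_trans (400 * q)); last by rewrite leq_mul2r q400 orbT.
  by move: qn48 q0'; clear; lia.
have qle : (0 < q <= n)%N by rewrite q0' (leq_trans _ q24) // leq_pmull.
have nearI u : eta <= before R lt m u y -> eta <= before R lt m y u ->
  u \in incomp lt y.
  move=> uy yu; rewrite inE; apply/and3P; split.
  - apply: contraTneq uy => ->; rewrite -ltNge /before /prob (eq_expect (Y := fun=> 0))
    ?expect_cst // => f.
    by rewrite ltxx.
  - apply: contraTN uy => yu'; rewrite -ltNge /before /prob (eq_expect (Y := fun=> 0))
    ?expect_cst // => f.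
    by rewrite ltNge (value_mono f yu').
  - apply: contraTN yu => uy'; rewrite -ltNge /before /prob (eq_expect (Y := fun=> 0))
    ?expect_cst // => f.
    by rewrite ltNge (value_mono f uy').
have near0 : near lt m D y eta (v * t0).
  move=> u uy yu; have iy := inc y q yball qle.
  apply: le_trans (incomp_dist tr OP0 D0 w0 n0 q24 q0' qn iy incn (nearI u uy yu)) _.
  rewrite ler_nat leq_mul2r; apply/orP; right; rewrite mulnA leq_mul2r; apply/orP;
    right.
  by apply: (@leq_trans (1 * (1096 * 1))) => //; rewrite leq_mul // leq_mul.
have dense0 : c0 * t0%:R <= #|ball R lt m D y t0|%:R.
  have -> : c0 * t0%:R = (6 * n)%:R.
    by rewrite /c0 /t0 !natrM; field; rewrite gt_eqF.
  by rewrite ler_nat; exact: (initial_dense irr tr wT OP0 D0 w0 n0 q24 q0' qn (inc y q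
    yball qle) incn).
have vp i : (0 < v ^ i)%N by rewrite expn_gt0 v0.
have incs t qq i : (t <= t0)%N -> (0 < qq <= v)%N -> (i < 128)%N ->
  forall c, c \in ball R lt m D y t ->
    incompressible lt m c (D * (qq * v ^ i) ^ 2) (D%:R^-1 : R) (6 * (qq * v ^ i)%:R).
  move=> tt /andP[qq0 qqv] i128 c /(ball_mono _ _ tt) cb; apply: inc => //.
  by rewrite muln_gt0 qq0 vp /=; apply: leq_trans vn; exact: mw.
have vle i : (i <= 128)%N -> (v ^ i <= t0)%N.
  by move=> hi; apply: leq_trans n_t0; apply: leq_trans vn; exact: pw.
have sq i j : (i <= 2 * j)%N -> forall t, (t <= v ^ i.-1)%N -> (0 < i)%N ->
  (v * t <= (v ^ j) ^ 2)%N.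
  move=> ij t tv i0; rewrite -expnM mulnC; apply: leq_trans (_ : v ^ i <= _)%N;
    last by rewrite pw // mulnC.
  by rewrite -(prednK i0) expnS mulnC leq_mul2l tv orbT.
(* With [k = v] the products [k * t] are at most [v ^ 130], [v ^ 67], [v ^ 36], [v ^ 20], hence at
   most the squares of the powers used here; each rate costs one more factor [v]. *)
pose t1 := (r0 * v ^ 65)%N; pose t2 := (r1 * v ^ 34)%N; pose t3 := (r2 * v ^ 18)%N;
  pose t4 := (r3 * v ^ 10)%N.
have [t1v t2v t3v t4v] : [/\ t1 <= v ^ 66, t2 <= v ^ 35,
  t3 <= v ^ 19 & t4 <= v ^ 11]%N by split; exact: mw.
have [d1 near1] : c1 * t1%:R <= #|ball R lt m D y t1|%:R /\ near lt m D y eta (v * t1).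
  apply: (step0 _ _ _ _ st _ _ t0) => //.
  - exact: (sq 130).
  - by apply: leq_trans (vle 66 isT); exact: mw.
  - by apply: incs => //; rewrite q00.
have [d2 near2] : c2 * t2%:R <= #|ball R lt m D y t2|%:R /\ near lt m D y eta (v * t2).
  apply: (step1 _ _ _ _ st _ _ t1) => //.
  - exact: (sq 67).
  - apply: (@leq_trans (v ^ 65)); [exact: mw|exact: leq_pmull].
  - by apply: incs => //; [exact: leq_trans t1v (vle _ _)|rewrite q10].
have [d3 near3] : c3 * t3%:R <= #|ball R lt m D y t3|%:R /\ near lt m D y eta (v * t3).
  apply: (step2 _ _ _ _ st _ _ t2) => //.
  - exact: (sq 36).
  - apply: (@leq_trans (v ^ 34)); [exact: mw|exact: leq_pmull].
  - by apply: incs => //; [exact: leq_trans t2v (vle _ _)|rewrite q20].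
have [d4 near4] : c4 * t4%:R <= #|ball R lt m D y t4|%:R /\ near lt m D y eta (v * t4).
  apply: (step3 _ _ _ _ st _ _ t3) => //.
  - exact: (sq 20).
  - apply: (@leq_trans (v ^ 18)); [exact: mw|exact: leq_pmull].
  - by apply: incs => //; [exact: leq_trans t3v (vle _ _)|rewrite q30].
apply: leq_trans (_ : #|ball R lt m D y (v ^ 12)| <= _)%N.
  apply/subset_leq_card/subsetP => u; rewrite !inE => /andP[uy yu].
  apply: le_trans (near4 u uy yu) _; rewrite ler_nat leq_mul2r; apply/orP; right.
  by rewrite (expnS v 11) leq_mul2l t4v orbT.
apply: leq_trans (ball_count OP0 D0 (_ : 4 <= v ^ 12)%N _) _.
- by apply: leq_trans (pw 1%N 12 isT); rewrite expn1; apply: leq_trans big.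
- by apply: inc => //; rewrite vp /=; apply: leq_trans vn; exact: pw.
- by apply: mw => //; apply: leq_trans big.
Qed.
End Constants.

(** * Ranks in a linear extension *)

Section Positions.
Context (R : realFieldType) {T : finType} (lt : rel T).
Local Notation N := #|T|.
Local Notation LE := (LE lt).
Context (lt_irr : irreflexive lt) (LE0 : (0 < #|{: LE}|)%N).
Implicit Types (h : LE) (z u : T).

Definition pos h z : nat := ival h z.

Lemma pos_lt h z : (pos h z < N)%N. Proof. exact: ltn_ord. Qed.

Lemma pos_inj h : injective (pos h).
Proof. by move=> x y /ord_inj/INJ_inj. Qed.

Lemma ival_bij h : bijective (ival h).
Proof. by apply: inj_card_bij; [exact: INJ_inj|rewrite card_ord]. Qed.

Lemma pos_surj h k : (k < N)%N -> exists z, pos h z = k.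
Proof.
by move=> kN; have [g _ gK] := ival_bij h; exists (g (Ordinal kN)); rewrite /pos gK.
Qed.

Lemma pos_mono h x y : lt x y -> (pos h x < pos h y)%N.
Proof. by move=> xy; exact: lt_ival. Qed.

Lemma card_before h u : #|[set z | (pos h z < pos h u)%N]| = pos h u.
Proof.
have [g gK Kg] := ival_bij h.
rewrite -(card_imset _ (@INJ_inj _ _ _ h)).
have -> : [set ival h z | z in [set z | (pos h z < pos h u)%N]] = [set i : 'I_N | (i <
  pos h u)%N].
  apply/setP => i; rewrite inE; apply/imsetP/idP => [[z]|iu];
    first by rewrite inE => ? ->.
  by exists (g i); rewrite ?inE /pos Kg.
rewrite -[RHS]card_ord.
pose F (i : 'I_(pos h u)) : 'I_N := widen_ord (ltnW (pos_lt h u)) i.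
have Fi : injective F by move=> i j /(congr1 val) /= /ord_inj.
rewrite -(card_imset _ Fi); apply: eq_card => i; rewrite inE;
  apply/idP/imsetP => [iu|[j _ ->]].
  by exists (Ordinal iu) => //; apply: ord_inj.
by rewrite /= ltn_ord.
Qed.

Lemma card_window h (k : int) (a : nat) : (#|[set z | (`|(pos h z)%:Z - k| <= a%:Z)%R]|
  <= 2 * a + 1)%N.
Proof.
have aux z : `|(pos h z)%:Z - k| <= a%:Z ->
  (absz ((pos h z)%:Z - k + a%:Z)%R < 2 * a + 1)%N by lia.
pose F z : option 'I_(2 * a + 1) := insub (absz ((pos h z)%:Z - k + a%:Z)%R).
have Fi : {in [set z | `|(pos h z)%:Z - k| <= a%:Z] &, injective F}.
  move=> x y; rewrite !inE => hx hy; rewrite /F (insubT (fun i =>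
    (i < 2 * a + 1)%N) (aux x hx)) (insubT (fun i => (i < 2 * a + 1)%N) (aux y hy)) =>
    -[e].
  by apply: (@pos_inj h); move: hx hy e; clear; lia.
rewrite -(card_in_imset Fi) -[leqRHS](card_ord (2 * a + 1)) -[leqRHS](card_imset _
  (@Some_inj _)).
apply/subset_leq_card/subsetP => _ /imsetP[z + ->]; rewrite inE => hz.
by rewrite /F (insubT (fun i => (i < 2 * a + 1)%N) (aux z hz)); apply: imset_f.
Qed.

Local Notation prec := (prec R lt).

Lemma prec_sum u z : u != z -> prec u z + prec z u = 1.
Proof.
move=> uz; rewrite -expectD -[RHS](expect_cst (W := LE)) //; apply: eq_expect => h.
have : pos h u != pos h z by apply: contra uz => /eqP/pos_inj ->.
by rewrite /pos; case: ltngtP => //= _ _; rewrite ?addr0 ?add0r.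
Qed.

Lemma prec_lt u z : lt u z -> prec u z = 1.
Proof.
move=> uz; rewrite /prec /prob (eq_expect (Y := fun=> 1)) ?expect_cst // => h.
by rewrite lt_ival.
Qed.

Lemma prec_gt u z : lt u z -> prec z u = 0.
Proof.
move=> uz; rewrite /prec /prob (eq_expect (Y := fun=> 0)) ?expect_cst // => h.
by rewrite ltnNge ltnW ?lt_ival.
Qed.

Lemma prec_refl u : prec u u = 0.
Proof.
by rewrite /prec /prob (eq_expect (Y := fun=> 0)) ?expect_cst // => h; rewrite ltnn.
Qed.

Definition mostly_before z u := 1 / 2 < prec z u.
(* The rank [u] would have if every majority verdict held. *)
Definition median_rank u : nat := #|[set z | mostly_before z u]|.
Definition misplaced h z u := (pos h z < pos h u)%N != mostly_before z u.

Lemma misplaced_incomp h z u : misplaced h z u -> z \in incomp lt u.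
Proof.
rewrite /misplaced inE => m; apply/and3P; split.
- apply: contraNneq m => ->; rewrite ltnn /mostly_before prec_refl ltNge divr_ge0 //.
- apply: contraNN m => uz; rewrite ltnNge ltnW ?pos_mono //= /mostly_before prec_gt //
  ltNge divr_ge0 //.
- apply: contraNN m => zu; rewrite pos_mono // /mostly_before prec_lt // eq_sym eqb_id;
  lra.
Qed.

Lemma pos_median_rank h u : (`|(pos h u)%:Z - (median_rank u)%:Z| <= \sum_z (misplaced h
  z u)%:Z).
Proof.
rewrite -{1}(card_before h u) /median_rank -!sum1_card [in X in X%:Z - _]big_mkcond [in
  X in _ - X%:Z]big_mkcond /=.
rewrite -![Posz (\sum_i _)]natz !natr_sum -sumrB;
  apply: le_trans (ler_norm_sum _ _ _) _.
apply: ler_sum => z _; rewrite !inE /misplaced.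
by case: (_ < _)%N; case: (mostly_before z u).
Qed.

Context (s Pi : nat) (eta : R).
Context (eta0 : 0 < eta) (eta2 : eta <= 1 / 2).
Definition nearset u : {set T} := [set z | (eta <= prec z u) && (eta <= prec u z)].
Context (near_s : forall u, (#|nearset u| <= s)%N) (inc_Pi : forall u,
  (#|incomp lt u| <= Pi)%N).

Lemma pos_median_rank_Pi h u : `|(pos h u)%:Z - (median_rank u)%:Z| <= Pi%:Z.
Proof.
apply: le_trans (pos_median_rank h u) _.
have : (\sum_z misplaced h z u <= Pi)%N.
  apply: leq_trans (inc_Pi u); rewrite -sum1_card [leqRHS]big_mkcond;
    apply: leq_sum => z _.
  by case m : (misplaced h z u) => //; rewrite (misplaced_incomp m).
rewrite -lez_nat => h1; apply: le_trans h1; rewrite -[Posz (\sum_z _)]natz natr_sum.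
by apply: ler_sum => z _; rewrite natz.
Qed.

Definition far_misplaced h u : nat := #|[set z in incomp lt u :\: nearset u | misplaced
  h z u]|.

Lemma pos_median_rank_s h u : `|(pos h u)%:Z - (median_rank u)%:Z| <= s%:Z +
  (far_misplaced h u)%:Z.
Proof.
apply: le_trans (pos_median_rank h u) _.
have : (\sum_z misplaced h z u <= s + far_misplaced h u)%N.
  apply: leq_trans (_ : #|[set z | misplaced h z u]| <= _)%N.
    by rewrite -sum1_card [leqRHS]big_mkcond; apply: leq_sum => z _; rewrite inE;
      case: misplaced.
  apply: leq_trans (_ : #|nearset u :|: [set z in incomp lt u :\: nearset u | misplaced
    h z u]| <= _)%N.
    apply/subset_leq_card/subsetP => z; rewrite in_setU inE in_set in_setD => m.
    by rewrite m (misplaced_incomp m) !andbT orbN.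
  by rewrite cardsU (leq_trans (leq_subr _ _)) // leq_add.
rewrite -lez_nat PoszD => h1; apply: le_trans h1;
  rewrite -[Posz (\sum_z _)]natz natr_sum.
by apply: ler_sum => z _; rewrite natz.
Qed.

(** Outside [nearset] one of the two orders has probability below [eta <= 1 / 2], so the majority
    verdict is the other one. *)
Lemma prob_misplaced z u : z \in incomp lt u -> z \notin nearset u ->
  prob (fun h : LE => misplaced h z u) <= eta :> R.
Proof.
rewrite !inE negb_and -!ltNge => /and3P[zu _ _] nz.
have S := prec_sum zu; rewrite /misplaced; case m : (mostly_before z u).
  have -> : prob (fun h : LE => (pos h z < pos h u)%N != true) = prec u z :> R.
    apply: eq_prob => h; have : pos h u != pos h z by apply: contra zu =>
      /eqP/pos_inj ->.
    by rewrite /pos; case: ltngtP.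
  move: m; rewrite /mostly_before => m; case/orP: nz; lra.
have -> : prob (fun h : LE => (pos h z < pos h u)%N != false) = prec z u :> R.
  by apply: eq_prob => h; rewrite eqbF_neg negbK.
move/negbT: m; rewrite /mostly_before -leNgt => m; case/orP: nz; lra.
Qed.

Lemma expect_far_misplaced u : expect (fun h : LE =>
  (far_misplaced h u)%:R) <= Pi%:R * eta :> R.
Proof.
apply: (@le_trans _ _ (\sum_(z in incomp lt u :\: nearset u) eta)); last first.
  rewrite sumr_const -[leLHS]mulr_natl ler_wpM2r ?(ltW eta0) // ler_nat.
  by apply: leq_trans (inc_Pi u); rewrite subset_leq_card // subsetDl.
apply: (@le_trans _ _ (\sum_(z in incomp lt u :\: nearset u) prob (fun h : LE =>
  misplaced h z u))).
  rewrite -expect_sum; apply: ler_expect => h;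
    rewrite /far_misplaced -sum1_card natr_sum big_mkcond [leRHS]big_mkcond.
  by apply: ler_sum => z _; rewrite in_set; case: (z \in _ :\: _) => //=;
    case: misplaced.
by apply: ler_sum => z; rewrite in_setD => /andP[h1 h2]; exact: prob_misplaced.
Qed.

Definition deviant h u := s%:Z < `|(pos h u)%:Z - (median_rank u)%:Z|.

Lemma prob_deviant u : prob (fun h : LE => deviant h u) <= Pi%:R * eta :> R.
Proof.
apply: le_trans (expect_far_misplaced u); apply: ler_expect => h.
case d : (deviant h u) => //; rewrite ler1n.
by move: d (pos_median_rank_s h u); rewrite /deviant; lia.
Qed.

Context (Pieta : Pi%:R * eta <= 1 / 2 :> R).

Lemma prob_close u : 1 / 2 <= prob (fun h : LE => ~~ deviant h u) :> R.
Proof. by have := prob_deviant u; have := Pieta; rewrite probC //; lra. Qed.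

(** Each member has rank within [M + s] of [k] with probability at least 1/2, and at most
    [2 * (M + s) + 1] ranks are available. *)
Lemma card_crowd (k : int) (M : nat) : (#|[set z | (`|(median_rank z)%:Z - k| <=
  M%:Z)%R]| <= 4 * (M + s) + 2)%N.
Proof.
set C := [set z | _].
have : #|C|%:R * (1 / 2) <= (2 * (M + s) + 1)%:R :> R.
  apply: (@le_trans _ _ (\sum_(z in C) prob (fun h : LE => ~~ deviant h z))).
    by rewrite mulr_natl -sumr_const; apply: ler_sum => z _; exact: prob_close.
  rewrite -expect_sum -[leRHS](expect_cst LE0); apply: ler_expect => h.
  rewrite -natr_sum ler_nat; apply: leq_trans (card_window h k (M + s)).
  rewrite -sum1_card big_mkcond [leqRHS]big_mkcond; apply: leq_sum => z _; rewrite !inE.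
  case: ifP => // zC; case d : (deviant h z) => //=.
  by rewrite (_ : `|(pos h z)%:Z - k| <= _) //; move: d zC; rewrite /deviant; lia.
move=> h; rewrite -(ler_nat R) (_ : 4 * (M + s) + 2 = 2 * (2 * (M + s) + 1))%N;
  last by clear; lia.
by rewrite natrM -ler_pdivrMl // mulrC -div1r.
Qed.

End Positions.

(** * Adjacent swaps *)

Section AdjacentSwap.
Context (R : realFieldType) {T : finType} (lt : rel T).
Local Notation N := #|T|.
Local Notation LE := (LE lt).
Context (lt_irr : irreflexive lt) (LE0 : (0 < #|{: LE}|)%N).
Context (U : {set T}) (upU : forall x y, lt x y -> x \in U -> y \in U).
Implicit Types (h : LE) (z u : T).

Definition inU h (k : nat) : bool := [exists z in U, pos h z == k].

Lemma inU_pos h z k : pos h z = k -> inU h k = (z \in U).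
Proof.
move=> zk; apply/existsP/idP => [[y /andP[yU /eqP yk]]|zU]; last by exists z;
  rewrite zU zk /=.
by rewrite -(@pos_inj _ _ h y z) // yk zk.
Qed.

Section At.
Context (k : nat) (kN : (k.+1 < N)%N).
Let i : 'I_N := Ordinal (ltnW kN).
Let j : 'I_N := Ordinal kN.

Definition transposed h : {ffun T -> 'I_N} := [ffun z => tperm i j (ival h z)].
(** [insubd] returns [h] itself when the exchange violates the order, which keeps the map total and
    an involution. *)
Definition adj_swap h : LE := insubd h (transposed h).

Lemma transposed_inj h : injectiveb (transposed h).
Proof. by apply/injectiveP => x y; rewrite !ffunE => /perm_inj/INJ_inj. Qed.

Lemma ival_adj_swap h : ival (adj_swap h) = if op_map lt (transposed h) then transposed
  h else ival h.
Proof. by rewrite /ival val_insubd transposed_inj andbT. Qed.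

Lemma adj_swapK : involutive adj_swap.
Proof.
move=> h; apply: val_inj; rewrite -[LHS]/(ival _) -[RHS]/(ival h) ival_adj_swap.
have E := ival_adj_swap h; case ok : (op_map lt (transposed h)) in E.
  have -> : transposed (adj_swap h) = ival h.
    by apply/ffunP => z; rewrite ffunE E ffunE tpermK.
  have -> : op_map lt (ival h) by apply/forallP => x; apply/forallP => y; apply/implyP;
    exact: INJ_op.
  by [].
have -> : transposed (adj_swap h) = transposed h by apply/ffunP => z; rewrite !ffunE E.
by rewrite ok.
Qed.

Lemma tperm_nat (a : 'I_N) : tperm i j a = (if a == k :> nat then k.+1 else if a == k.+1
  :> nat then k else a) :> nat.
Proof.
case: tpermP => [->|->|/eqP n1 /eqP n2] /=; rewrite ?eqxx //;
  first by case: eqP => // ->.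
by rewrite -(inj_eq (@ord_inj N)) /= in n1; rewrite -(inj_eq (@ord_inj N)) /= in n2;
  rewrite (negbTE n1) (negbTE n2).
Qed.

Lemma stuck h : ~~ op_map lt (transposed h) ->
  exists x y, [/\ lt x y, pos h x = k & pos h y = k.+1].
Proof.
rewrite negb_forall => /existsP[x]; rewrite negb_forall => /existsP[y].
rewrite negb_imply => /andP[xy]; rewrite !ffunE -ltnNge => yx; exists x, y.
suff [] : ival h x = k :> nat /\ ival h y = k.+1 :> nat by [].
have := pos_mono lt_irr h xy; rewrite /pos => hxy; move: yx; rewrite !tperm_nat.
by do 4?[case: eqP]; move: hxy; clear; move=> *; split; lia.
Qed.

Lemma inU_swap h (l : 'I_N) : op_map lt (transposed h) ->
  inU (adj_swap h) l = inU h (tperm i j l).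
Proof.
move=> ok; apply: eq_existsb => z; congr (_ && _).
rewrite /pos ival_adj_swap ok ffunE; apply/eqP/eqP => [/ord_inj <-|/ord_inj ->];
  by rewrite tpermK.
Qed.

Lemma inU_swapS h : op_map lt (transposed h) -> inU (adj_swap h) k.+1 = inU h k.
Proof. by move=> ok; rewrite -[k.+1]/(nat_of_ord j) inU_swap // tpermR. Qed.

Lemma inU_swap_other h l : (l < N)%N -> l != k -> l != k.+1 ->
  inU (adj_swap h) l = inU h l.
Proof.
move=> lN lk lk'; case ok : (op_map lt (transposed h)).
  rewrite -[l in LHS]/(nat_of_ord (Ordinal lN)) inU_swap // tpermD //;
    rewrite -val_eqE /= eq_sym //.
have -> : adj_swap h = h by apply: val_inj; have := ival_adj_swap h; rewrite ok.
by [].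
Qed.

(* If the swap is illegal, the element at rank [k] lies below the one at rank [k + 1], and
   [U] is an up-set. *)
Lemma inU_swap_le h : (inU h k)%:R <= (inU (adj_swap h) k.+1)%:R :> R.
Proof.
case ok : (op_map lt (transposed h)); first by rewrite inU_swapS.
have -> : adj_swap h = h by apply: val_inj; have := ival_adj_swap h; rewrite ok.
have [x [y [xy xk yk]]] := stuck (negbT ok).
rewrite (inU_pos xk) (inU_pos yk) ler_nat; case xU : (x \in U) => //.
by rewrite (upU xy xU).
Qed.

Definition freq (l : nat) : R := prob (fun h : LE => inU h l).
Definition freq2 (l l' : nat) : R := prob (fun h : LE => inU h l && inU h l').

Lemma freqS : freq k <= freq k.+1.
Proof.
rewrite {2}/freq /prob -(expect_bij _ adj_swapK); apply: ler_expect => h;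
  exact: inU_swap_le.
Qed.

(** The swap at [k] does not touch rank [l], so the joint frequency gains at most what the single
    frequency gains. *)
Lemma freq2S l : (l < N)%N -> l != k -> l != k.+1 ->
  freq2 k l <= freq2 k.+1 l /\ freq2 k.+1 l - freq2 k l <= freq k.+1 - freq k.
Proof.
move=> lN lk lk'.
have E1 : freq k.+1 = expect (fun h => (inU (adj_swap h) k.+1)%:R).
  by rewrite /freq /prob -[LHS](expect_bij _ adj_swapK).
have E2 : freq2 k.+1 l = expect (fun h => (inU (adj_swap h) k.+1 && inU h l)%:R).
  rewrite /freq2 /prob -[LHS](expect_bij _ adj_swapK); apply: eq_expect => h.
  by rewrite (inU_swap_other h lN lk lk').
rewrite E1 E2 /freq2 /freq /prob; split.
  apply: ler_expect => h; rewrite -!mulnb !natrM ler_wpM2r //.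
  exact: inU_swap_le.
rewrite -!expectB; apply: ler_expect => h; rewrite -!mulnb !natrM -mulrBl.
rewrite -[leRHS]mulr1 ler_wpM2l ?subr_ge0 ?inU_swap_le // lern1; exact: leq_b1.
Qed.

End At.

Lemma freq_mono a b : (a <= b)%N -> (b < N)%N -> freq a <= freq b.
Proof.
move=> ab; rewrite -(subnK ab); elim: (b - a)%N => [|d IH] bN; first by rewrite add0n.
by apply: le_trans (IH _) (freqS _); rewrite ?addSn // ltnW.
Qed.

Lemma freq2C a b : freq2 a b = freq2 b a.
Proof. by apply: eq_prob => h; rewrite andbC. Qed.

Lemma freq2_right K d : (K + 1 + d < N)%N ->
  freq2 K (K + 1) <= freq2 K (K + 1 + d) /\ freq2 K (K + 1 + d) - freq2 K (K + 1) <=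
    freq (K + 1 + d) - freq (K + 1).
Proof.
elim: d => [|d IH] dN; first by rewrite addn0 !subrr.
rewrite addnS in dN *.
have [] := IH (ltnW dN); have [] := freq2S dN (l := K) _ _ _.
- by apply: leq_trans dN; rewrite -addnA -addnS leq_addr.
- by rewrite -addnA; clear; lia.
- by rewrite -addnA; clear; lia.
rewrite ![freq2 _ K]freq2C; lra.
Qed.

Lemma freq2_left K d b : (K + d < b)%N -> (b < N)%N ->
  freq2 K b <= freq2 (K + d) b /\ freq2 (K + d) b - freq2 K b <= freq (K + d) - freq K.
Proof.
elim: d => [|d IH] db bN; first by rewrite addn0 !subrr.
rewrite addnS in db *.
have kN : ((K + d).+1 < N)%N by exact: ltn_trans bN.
have [] := IH (ltnW db) bN; have [] := freq2S kN bN.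
- by move: db; clear; lia.
- by move: db; clear; lia.
lra.
Qed.

Section Window.
Context (K L : nat) (L2 : (2 <= L)%N) (KL : (K + L <= N)%N) (kap : R)
  (kapE : freq (K + L).-1 - freq K <= kap).

Lemma freq_window (i : 'I_L) : freq K <= freq (K + i) <= freq K + kap.
Proof.
have iL := ltn_ord i; have bN : ((K + L).-1 < N)%N by move: KL L2; clear; lia.
rewrite freq_mono ?leq_addr //=; last by apply: leq_trans KL; rewrite ltn_add2l.
rewrite -lerBlDl; apply: le_trans kapE; rewrite lerD2r freq_mono //.
by move: iL; clear; lia.
Qed.

Lemma kap_ge0 : 0 <= kap.
Proof. by have /andP[h1 h2] := freq_window (Ordinal (ltnW L2)); move: (le_trans h1 h2);
  rewrite lerDl. Qed.

(** Move the right index from [K + 1] to [K + j], then the left one from [K] to [K + i]; each move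
    raises the joint frequency by at most [kap]. *)
Lemma freq2_window (i j : 'I_L) : i != j ->
  freq2 K (K + 1) <= freq2 (K + i) (K + j) <= freq2 K (K + 1) + 2 * kap.
Proof.
wlog ij : i j / (i < j)%N => [H|_].
  move=> ij; have : (i < j)%N || (j < i)%N by rewrite -neq_ltn.
  by case/orP => h; [exact: H|rewrite [freq2 (K + i) _]freq2C; apply: H;
    rewrite // eq_sym].
have jL := ltn_ord j.
have jN : (K + j < N)%N by apply: leq_trans KL; rewrite ltn_add2l.
have ij' : (K + i < K + j)%N by rewrite ltn_add2l.
have [h1 h2] := freq2_left ij' jN.
have jE : (K + j = K + 1 + j.-1)%N by move: ij; clear; lia.
have jN' : (K + 1 + j.-1 < N)%N by rewrite -jE.
have [] := freq2_right jN'; rewrite -jE => h3 h4.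
have /andP[h5 h6] := freq_window i; have /andP[h7 h8] := freq_window j.
have /andP[h9 h10] := freq_window (Ordinal L2); rewrite /= in h9 h10.
by apply/andP; split; lra.
Qed.

Definition weighted_count (c : 'I_L -> R) h : R := \sum_i c i * (inU h (K + i))%:R.

Lemma expect_weighted_count c : expect (weighted_count c) = \sum_i c i * freq (K + i).
Proof. by rewrite expect_sum; apply: eq_bigr => i _; rewrite expectZ. Qed.

(** Under exact exchangeability all off-diagonal joint frequencies would equal [freq2 K (K + 1)]; by
    [freq2_window] each is off by at most [2 * kap]. *)
Lemma expect_weighted_count2 c : (forall i, `|c i| <= 1) ->
  `|expect (fun h => weighted_count c h ^+ 2) - \sum_i c i ^+ 2 * freq (K + i)
    - freq2 K (K + 1) * ((\sum_i c i) ^+ 2 - \sum_i c i ^+ 2)| <= 2 * kap * L%:R ^+ 2.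
Proof.
move=> c1.
have E : expect (fun h => weighted_count c h ^+ 2) = \sum_i \sum_j c i * c j * freq2 (K
  + i) (K + j).
  under [RHS]eq_bigr do under eq_bigr do rewrite -expectZ.
  under [RHS]eq_bigr do rewrite -expect_sum; rewrite -expect_sum; apply: eq_expect => h.
  rewrite expr2 /weighted_count mulr_suml; apply: eq_bigr => i _; rewrite mulr_sumr;
    apply: eq_bigr => j _.
  by rewrite -mulnb natrM; ring.
pose q := freq2 K (K + 1).
have E2 : (\sum_i c i) ^+ 2 = \sum_i \sum_j c i * c j.
  by rewrite expr2 mulr_suml; apply: eq_bigr => i _; rewrite mulr_sumr.
have diag i : freq2 (K + i) (K + i) = freq (K + i) by apply: eq_prob => h;
  rewrite andbb.
have -> : expect (fun h => weighted_count c h ^+ 2) = \sum_i c i ^+ 2 * freq (K + i) +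
  \sum_i \sum_(j | j != i) c i * c j * freq2 (K + i) (K + j).
  by rewrite E -big_split; apply: eq_bigr => i _; rewrite (bigD1 i) //= diag expr2.
have -> : (\sum_i c i) ^+ 2 = \sum_i c i ^+ 2 + \sum_i \sum_(j | j != i) c i * c j.
  by rewrite E2 -big_split; apply: eq_bigr => i _; rewrite (bigD1 i) //= expr2.
have K1 (a b : R) : a + b - a = b by ring.
rewrite -/q !K1 mulr_sumr -sumrB.
rewrite (eq_bigr (fun i => \sum_(j | j != i) c i * c j * (freq2 (K + i) (K + j) - q)));
  last first.
  by move=> i _; rewrite mulr_sumr -sumrB; apply: eq_bigr => j _; ring.
apply: le_trans (ler_norm_sum _ _ _) _.
apply: (@le_trans _ _ (\sum_(i : 'I_L) 2 * kap * L%:R)); last first.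
  by rewrite sumr_const card_ord -[leLHS]mulr_natr expr2 mulrA.
apply: ler_sum => i _; apply: le_trans (ler_norm_sum _ _ _) _.
have k0 := kap_ge0.
apply: (@le_trans _ _ (\sum_(j : 'I_L) 2 * kap));
  last by rewrite sumr_const card_ord -[leLHS]mulr_natr.
rewrite [leRHS](bigD1 i) //= -[leLHS]add0r; apply: lerD; first by rewrite mulr_ge0.
apply: ler_sum => j ji; rewrite !normrM -[leRHS]mul1r; apply: ler_pM => //.
- by rewrite mulr_ge0.
- by rewrite -[leRHS]mulr1 ler_pM.
have ij : i != j by rewrite eq_sym.
have /andP[h1 h2] := freq2_window ij.
by rewrite ger0_norm ?subr_ge0 // lerBlDl.
Qed.

End Window.
End AdjacentSwap.

(** * Second moments *)

(** [E1] is the second moment of the difference of the half counts, [E2] that of the full count, [p]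
    and [q] are single and joint frequencies. The bound on [E2] puts [q] at most about [p ^+ 2], the
    bound on [E1] limits [L * (p - q)], and [p * (1 - p) >= alp / 2] makes the two clash for large
    [L]. *)
Lemma final_inequality (R : realFieldType) (L p q kap dev_bound alp S1 E1 E2 D1 : R) :
  2 <= L -> 1 <= dev_bound -> 0 <= kap -> kap * L ^+ 2 <= 1 / 5 -> 0 < alp ->
    alp <= p -> p <= 1 - alp ->
  L * p <= S1 -> S1 <= L * (p + kap) ->
  S1 + q * (0 - L) - 2 * kap * L ^+ 2 <= E1 -> E1 <= 18 * dev_bound + D1 ^+ 2 ->
    `|D1| <= L * kap ->
  S1 + q * (L ^+ 2 - L) - 2 * kap * L ^+ 2 <= E2 -> E2 <= 4 * dev_bound + S1 ^+ 2 ->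
  L * alp <= 40 * dev_bound + 4.
Proof.
move=> L2 V1 k0 kL a0 ap pa S1l S1u E1l E1u D1b E2l E2u.
have L0 : 0 < L by lra.
have L4 : 4 <= L ^+ 2 by rewrite expr2; nra.
have k1 : kap <= 1 / 20 by nra.
have D1s : D1 ^+ 2 <= kap * L ^+ 2.
  rewrite -(real_normK (num_real D1)); apply: le_trans (_ : (L * kap) ^+ 2 <= _).
    by rewrite ler_sqr ?nnegrE // mulr_ge0 // ltW.
  by rewrite exprMn mulrC ler_wpM2r ?exprn_ge0 ?(ltW L0) // expr2; nra.
have A : L * (p - q) <= 18 * dev_bound + 1 by lra.
have S1s : S1 ^+ 2 <= (L * (p + kap)) ^+ 2.
  rewrite ler_sqr ?nnegrE //; first by apply: le_trans S1l; rewrite mulr_ge0 ?ltW //;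
    lra.
  by rewrite mulr_ge0 ?ltW //; lra.
have S1e : (L * (p + kap)) ^+ 2 <= L ^+ 2 * p ^+ 2 + 3 * (kap * L ^+ 2).
  have -> : (L * (p + kap)) ^+ 2 = L ^+ 2 * p ^+ 2 + (2 * p + kap) * (kap * L ^+ 2) by
    ring.
  rewrite lerD2l ler_wpM2r //; last lra.
  by rewrite mulr_ge0 // exprn_ge0 // ltW.
have B : q * (L ^+ 2 - L) <= 4 * dev_bound + 1 + L ^+ 2 * p ^+ 2 - L * p by lra.
have C : (L - 1) * (L * (p - q)) <= (L - 1) * (18 * dev_bound + 1) by rewrite ler_wpM2l
  //; lra.
have pp : alp / 2 <= p * (1 - p).
  have h : 0 <= (p - alp) * (1 - alp - p) by rewrite mulr_ge0 //; lra.
  nra.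
have F : L ^+ 2 * (alp / 2) <= L ^+ 2 * (p * (1 - p)) by rewrite ler_wpM2l // exprn_ge0
  // ltW.
have G : L * (L * (alp / 2)) <= L * (20 * dev_bound + 2).
  have -> : L * (L * (alp / 2)) = L ^+ 2 * (alp / 2) by ring.
  apply: le_trans F _.
  have e1 : (L - 1) * (L * (p - q)) = L ^+ 2 * p - L * p - q * (L ^+ 2 - L) by ring.
  rewrite e1 in C; have e2 : L ^+ 2 * (p * (1 - p)) = L ^+ 2 * p - L ^+ 2 * p ^+ 2 by
    ring.
  rewrite e2; nra.
by rewrite ler_pM2l // in G; lra.
Qed.

Lemma variance_le (R : realFieldType) (W : finType) (W0 : (0 < #|W|)%N) (X : W ->
  R) (c : R) :
  expect (fun h => X h ^+ 2) <= expect (fun h => (X h - c) ^+ 2) + expect X ^+ 2.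
Proof.
have -> : expect (fun h => (X h - c) ^+ 2) = expect (fun h =>
  X h ^+ 2) - 2 * c * expect X + c ^+ 2.
  rewrite -expectZ -expectB -[c ^+ 2 in RHS](expect_cst W0) -expectD;
    apply: eq_expect => h; ring.
have := sqr_ge0 (expect X - c); rewrite !expr2; lra.
Qed.

Section Endgame.
Context (R : realFieldType) {T : finType} (lt : rel T).
Local Notation N := #|T|.
Local Notation LE := (LE lt).
Context (lt_irr : irreflexive lt) (lt_tr : transitive lt) (LE0 : (0 < #|{: LE}|)%N).
Implicit Types (h : LE) (z u : T).
Context (s Pi : nat) (eta : R) (eta0 : 0 < eta) (eta2 : eta <= 1 / 2).
Context (near_s : forall u, (#|nearset lt eta u| <= s)%N) (inc_Pi : forall u,
  (#|incomp lt u| <= Pi)%N).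
Context (Pieta : Pi%:R * eta <= 1 / 2 :> R).
Local Notation median_rank := (median_rank R lt).
Local Notation B2 := (4 * (Pi + s) + 2)%N.
Context (B2eta : B2%:R ^+ 2 * (Pi%:R * eta) <= 1 :> R).

Section UpSet.
Context (U : {set T}) (upU : forall x y, lt x y -> x \in U -> y \in U).

Definition countU h k : R := #|[set z in U | (pos h z < k)%N]|%:R.
Definition count0 k : R := #|[set z in U | (median_rank z < k)%N]|%:R.
Definition crowd (k M : nat) : {set T} := [set z | (`|(median_rank z)%:Z - k%:Z| <=
  M%:Z)%R].
Definition stray h k : nat := #|[set z in crowd k Pi | deviant R s h z]|.

(** An element that rank and median rank put on different sides of [k] has median rank within [s] of
    [k], or it is deviant. In the latter case it still belongs to the crowd of radius [Pi], because
    no deviation exceeds [Pi]. *)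
Lemma countU_close h k : `|countU h k - count0 k| <= (8 * s + 2)%:R + (stray h k)%:R.
Proof.
rewrite /countU /count0 -!sum1_card !natr_sum [in X in X - _]big_mkcond [in X in _ -
  X]big_mkcond -sumrB.
apply: le_trans (ler_norm_sum _ _ _) _; rewrite -natrD.
apply: (@le_trans _ _ (\sum_z (((z \in crowd k s) + ((z \in crowd k Pi) && deviant R s h
  z))%N%:R : R))); last first.
  rewrite -natr_sum ler_nat big_split leq_add //=.
    rewrite -big_mkcond sum1_card; apply: leq_trans (card_crowd lt_irr LE0 eta0 eta2
      near_s inc_Pi Pieta k s) _.
    by clear; lia.
  by rewrite /stray -sum1_card [leqRHS]big_mkcond; apply: leq_sum => z _; rewrite !inE;
    case: (_ && _).
apply: ler_sum => z _; rewrite !inE; case: (z \in U) => /=;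
  last by rewrite subrr normr0.
have := pos_median_rank_Pi R lt_irr LE0 inc_Pi h z; rewrite /deviant; set a := pos h z;
  set b := median_rank z.
case: (ltnP a k) => ha; case: (ltnP b k) => hb;
  rewrite ?subrr ?normr0 ?subr0 ?sub0r ?normrN ?normr1 // => hP;
  rewrite ler1n; move: ha hb hP; case: (ltP s%:Z _) => //=; lia.
Qed.

(** [stray] never exceeds [B2], so its second moment is at most [B2] times its mean. *)
Lemma expect_stray k : expect (fun h => (stray h k)%:R ^+ 2) <= 1 :> R.
Proof.
have cP : (#|crowd k Pi| <= B2)%N := card_crowd lt_irr LE0 eta0 eta2 near_s inc_Pi Pieta
  k Pi.
apply: le_trans B2eta.
apply: (@le_trans _ _ (B2%:R * expect (fun h => (stray h k)%:R))).
  rewrite -expectZ; apply: ler_expect => h; rewrite expr2 ler_wpM2r // ler_nat.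
  apply: leq_trans cP; apply/subset_leq_card/subsetP => z; by rewrite inE => /andP[].
rewrite expr2 -mulrA ler_wpM2l //.
apply: (@le_trans _ _ (\sum_(z in crowd k Pi) prob (fun h => deviant R s h z))).
  rewrite -expect_sum; apply: ler_expect => h;
    rewrite -natr_sum ler_nat /stray -sum1_card big_mkcond [leqRHS]big_mkcond.
  by apply: leq_sum => z _; rewrite inE; case: (z \in _) => //=; case: deviant.
apply: (@le_trans _ _ (\sum_(z in crowd k Pi) Pi%:R * eta)).
  by apply: ler_sum => z _; exact: (prob_deviant lt_irr LE0 eta0 eta2 near_s inc_Pi).
rewrite sumr_const -[leLHS]mulr_natl ler_wpM2r ?ler_nat // mulr_ge0 // ltW //.
Qed.

Definition dev_bound : R := 2 * (8 * s + 2)%:R ^+ 2 + 2.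

Lemma expect_dev k : expect (fun h => (countU h k - count0 k) ^+ 2) <= dev_bound.
Proof.
apply: (@le_trans _ _ (expect (fun h =>
  2 * (8 * s + 2)%:R ^+ 2 + 2 * (stray h k)%:R ^+ 2))).
  apply: ler_expect => h; rewrite -(real_normK (num_real (countU h k - count0 k))).
  have h1 := countU_close h k.
  apply: (@le_trans _ _ (((8 * s + 2)%:R + (stray h k)%:R) ^+ 2)).
    by rewrite ler_sqr ?nnegrE // addr_ge0.
  by have := sqr_ge0 ((8 * s + 2)%:R - (stray h k)%:R : R); rewrite !expr2; lra.
rewrite expectD expect_cst // expectZ /dev_bound lerD2l; have := expect_stray k; lra.
Qed.

Lemma countUS h k : (k < N)%N -> countU h k.+1 = countU h k + (inU U h k)%:R.
Proof.
move=> kN; have [y yk] := pos_surj h kN.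
rewrite (inU_pos U yk) /countU -natrD (cardsD1 y) !inE yk ltnSn andbT addnC;
  congr (_ + _)%:R.
apply: eq_card => z; rewrite !inE; case: eqP => [->|zy]; first by rewrite yk ltnn andbF.
rewrite /= ltnS leq_eqVlt; case: eqP => //= zk; case: zy; apply: (@pos_inj _ _ h);
  by rewrite yk.
Qed.

Lemma sum_inU h K L : (K + L <= N)%N ->
  \sum_(i < L) (inU U h (K + i))%:R = countU h (K + L) - countU h K.
Proof.
elim: L => [|L IH] KL; first by rewrite big_ord0 addn0 subrr.
rewrite addnS in KL *; rewrite big_ord_recr IH /=; last exact: ltnW.
by rewrite countUS // addrAC.
Qed.

Local Notation freq := (freq R lt U).

Section Window.
Context (K l : nat) (l0 : (0 < l)%N) (KL : (K + (l + l) <= N)%N) (kap alp : R)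
  (kapE : freq (K + (l + l)).-1 - freq K <= kap) (kapL : kap * (l + l)%:R ^+ 2 <= 1 / 5)
  (alp0 : 0 < alp) (alpK : alp <= freq K) (Kalp : freq K <= 1 - alp).
Local Notation L := (l + l)%N.

Definition sgn (i : 'I_L) : R := if (i < l)%N then 1 else -1.

Lemma weighted_count_one h : weighted_count (R := R) U K (fun _ : 'I_L =>
  1) h = countU h (K + L) - countU h K.
Proof. by rewrite -sum_inU //; apply: eq_bigr => i _; rewrite mul1r. Qed.

Lemma sum_sgn (F : 'I_L -> R) : \sum_i sgn i * F i = \sum_(i < l) F (lshift l i) -
  \sum_(i < l) F (rshift l i).
Proof.
rewrite big_split_ord /= -sumrN; congr (_ + _); apply: eq_bigr => i _; rewrite /sgn /=.
  by rewrite ltn_ord mul1r.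
by rewrite ltnNge leq_addr mulN1r.
Qed.

Lemma weighted_count_sgn h : weighted_count (R := R) U K sgn h = 2 * countU h (K + l) -
  countU h K - countU h (K + L).
Proof.
rewrite /weighted_count sum_sgn /=.
have e1 := @sum_inU h K l (leq_trans (_ : K + l <= K + L)%N KL).
have {}e1 : \sum_(i < l) (inU U h (K + i))%:R = countU h (K + l) - countU h K.
  by apply: e1; rewrite addnA leq_addr.
have e2 := @sum_inU h (K + l) l.
have {}e2 : \sum_(i < l) (inU U h (K + l + i))%:R = countU h (K + l + l) - countU h (K +
  l).
  by apply: e2; rewrite -addnA.
rewrite e1; under [\sum_(i < l) (inU U h (K + (l + i)))%:R]eq_bigr do rewrite addnA.
rewrite e2 addnA; ring.
Qed.

(* The count of [U] in the window has variance O(s ^ 2), so [freq2] is at most about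
   [freq ^ 2]; then the difference of the two half counts has second moment of order
   [L * p * (1 - p)], which the same variance bounds. *)
Lemma window_bound : L%:R * alp <= 40 * dev_bound + 4.
Proof.
have L2 : (2 <= L)%N by rewrite addnn; move: l0; clear; lia.
have Lr : (2 : R) <= L%:R by rewrite ler_nat.
have V1 : 1 <= dev_bound by rewrite /dev_bound; have := sqr_ge0 ((8 * s + 2)%:R : R);
  lra.
have k0 := kap_ge0 lt_irr upU L2 KL kapE.
have fw i := freq_window lt_irr upU L2 KL kapE i.
pose q := freq2 R lt U K (K + 1).
pose one := fun _ : 'I_L => (1 : R).
have c1 i : `|one i| <= 1 by rewrite normr1.
have cs i : `|sgn i| <= 1 by rewrite /sgn; case: ifP; rewrite ?normrN normr1.
have Q1 := expect_weighted_count2 lt_irr upU L2 KL kapE c1.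
have Qs := expect_weighted_count2 lt_irr upU L2 KL kapE cs.
pose S1 := \sum_(i < L) freq (K + i).
have sum1 : \sum_(i < L) one i ^+ 2 * freq (K + i) = S1.
  by apply: eq_bigr => i _; rewrite expr1n mul1r.
have sums : \sum_(i < L) sgn i ^+ 2 * freq (K + i) = S1.
  by apply: eq_bigr => i _; rewrite /sgn; case: ifP; rewrite ?sqrrN expr1n mul1r.
have n1 : \sum_(i < L) one i = L%:R by rewrite sumr_const card_ord.
have n2 : \sum_(i < L) one i ^+ 2 = L%:R.
  by rewrite -n1; apply: eq_bigr => i _; rewrite expr1n.
have n3 : \sum_(i < L) sgn i = 0.
  rewrite (eq_bigr (fun i => sgn i * 1)) => [|i _]; last by rewrite mulr1.
  by rewrite sum_sgn !sumr_const subrr.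
have n4 : \sum_(i < L) sgn i ^+ 2 = L%:R.
  by rewrite -n1; apply: eq_bigr => i _; rewrite /sgn; case: ifP; rewrite ?sqrrN expr1n.
rewrite sum1 n1 n2 -/q in Q1; rewrite sums n3 n4 expr0n /= -/q in Qs.
have var1 := variance_le LE0 (weighted_count (R := R) U K one) (count0 (K + L) - count0
  K).
have vars := variance_le LE0 (weighted_count (R := R) U K sgn) (2 * count0 (K + l) -
  count0 K - count0 (K + L)).
have d0 := expect_dev K; have d1 := expect_dev (K + l); have d2 := expect_dev (K + L).
have b1 : expect (fun h => (weighted_count U K one h - (count0 (K + L) - count0 K)) ^+
  2) <= 4 * dev_bound.
  apply: (@le_trans _ _ (expect (fun h =>
    2 * (countU h (K + L) - count0 (K + L)) ^+ 2 + 2 * (countU h K - count0 K) ^+ 2))).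
    apply: ler_expect => h; rewrite weighted_count_one; set x := countU h (K + L);
      set y := countU h K.
    have := sqr_ge0 ((x - count0 (K + L)) + (y - count0 K)); rewrite !expr2; lra.
  by rewrite expectD !expectZ; lra.
have bs : expect (fun h => (weighted_count U K sgn h - (2 * count0 (K + l) - count0 K -
  count0 (K + L))) ^+ 2) <= 18 * dev_bound.
  apply: (@le_trans _ _ (expect (fun h => 12 * (countU h (K + l) - count0 (K + l)) ^+ 2
       + 3 * (countU h (K + L) - count0 (K + L)) ^+ 2 + 3 * (countU h K - count0 K) ^+
         2))).
    apply: ler_expect => h; rewrite weighted_count_sgn.
    set x := countU h (K + L) - count0 (K + L); set y := countU h K - count0 K;
      set z := countU h (K + l) - count0 (K + l).
    have -> : 2 * countU h (K + l) - countU h K - countU h (K + L) - (2 * count0 (K + l)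
      - count0 K - count0 (K + L)) = 2 * z - y - x.
      by rewrite /x /y /z; ring.
    have := sqr_ge0 (2 * z + y); have := sqr_ge0 (2 * z + x); have := sqr_ge0 (x - y).
    rewrite !expr2; lra.
  by rewrite !expectD !expectZ; lra.
have D1b : `|expect (weighted_count (R := R) (lt := lt) U K sgn)| <= L%:R * kap.
  rewrite expect_weighted_count.
  have -> : \sum_i sgn i * freq (K + i) = \sum_i sgn i * (freq (K + i) - freq K).
    under [RHS]eq_bigr do rewrite mulrBr.
    by rewrite sumrB -mulr_suml n3 mul0r subr0.
  apply: le_trans (ler_norm_sum _ _ _) _.
  rewrite mulr_natl -[Z in _ *+ Z]card_ord -sumr_const; apply: ler_sum => i _.
  rewrite normrM -[leRHS]mul1r; apply: ler_pM => //.
  by have /andP[f1 f2] := fw i; rewrite ger0_norm ?subr_ge0 // lerBlDl.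
have e1 : expect (weighted_count (R := R) (lt := lt) U K one) = S1.
  by rewrite expect_weighted_count; apply: eq_bigr => i _; rewrite mul1r.
rewrite e1 in var1.
have S1l : L%:R * freq K <= S1.
  by rewrite mulr_natl -[Z in _ *+ Z]card_ord -sumr_const; apply: ler_sum => i _;
    have /andP[] := fw i.
have S1u : S1 <= L%:R * (freq K + kap).
  by rewrite mulr_natl -[Z in _ *+ Z]card_ord -sumr_const; apply: ler_sum => i _;
    have /andP[] := fw i.
move: Q1 Qs; rewrite !ler_norml => /andP[Q1 _] /andP[Qs _].
apply: (final_inequality Lr V1 k0 kapL alp0 alpK Kalp S1l S1u (q := q) _ (le_trans vars
  (lerD bs (lexx _))) D1b _ (le_trans var1 (lerD b1 (lexx _)))).
  by move: Qs; set E := expect _; lra.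
by move: Q1; set E := expect _; lra.
Qed.

End Window.
End UpSet.
End Endgame.

(** * Distant median ranks *)

(** The window length is of order [c * s ^ 3], the frequency margin of order [1 / s] and [dev_bound]
    of order [s ^ 2], so a large constant [c] decides. *)
Lemma window_length (R : realFieldType) (s c : nat) : (0 < s)%N ->
  160 * 160 <= c%:R :> R ->
  40 * (2 * (8 * s + 2)%:R ^+ 2 + 2) + 4 < (c * s ^ 3 + c * s ^ 3)%:R * (1 / (2 * (2 * s
    + 1)%:R)) :> R.
Proof.
move=> s0 hc; have s1 : 1 <= s%:R :> R by rewrite ler1n.
rewrite div1r ltr_pdivlMr; last by rewrite mulr_gt0 // ltr0n addn1.
have E : (c * s ^ 3)%:R = c%:R * s%:R ^+ 3 :> R by rewrite natrM natrX.
have E1 : (8 * s + 2)%:R = 8 * s%:R + 2 :> R by rewrite natrD natrM.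
have E2 : (2 * s + 1)%:R = 2 * s%:R + 1 :> R by rewrite natrD natrM.
rewrite [(c * _ + _)%:R]natrD E E1 E2; set x := s%:R in s1 *; set y := c%:R in hc *.
have x2 : x <= x ^+ 2 by rewrite expr2; nra.
have x3 : x ^+ 2 <= x ^+ 3 by rewrite exprS [x ^+ 3]exprS ler_wpM2l // ?expr2; nra.
have e0 : (8 * x + 2) ^+ 2 <= 100 * x ^+ 2 by rewrite !expr2; nra.
have e1 : 40 * (2 * (8 * x + 2) ^+ 2 + 2) + 4 <= 90 * 90 * x ^+ 2 by lra.
apply: le_lt_trans (_ : 90 * 90 * x ^+ 2 * (2 * (3 * x)) < _).
  apply: ler_pM => //; last lra.
    by rewrite addr_ge0 // mulr_ge0 // addr_ge0 // mulr_ge0 // sqr_ge0.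
  by rewrite mulr_ge0 // addr_ge0 // mulr_ge0 // ltW // (lt_le_trans _ s1).
have x30 : 0 < x ^+ 3 by rewrite exprn_gt0 // (lt_le_trans _ s1).
have -> : 90 * 90 * x ^+ 2 * (2 * (3 * x)) = (90 * 90 * 6) * x ^+ 3 by ring.
rewrite -mulrDl ltr_pM2r //; lra.
Qed.

Lemma telescope_small (R : realFieldType) (F : nat -> R) (K L J : nat) : (0 < L)%N ->
  (0 < J)%N ->
  (forall a b, (K <= a)%N -> (a <= b)%N -> (b < K + J * L)%N -> F a <= F b) ->
  (forall a, 0 <= F a <= 1) ->
  exists2 t, (t < J)%N & F (K + t * L + L).-1%N - F (K + t * L)%N <= 1 / J%:R.
Proof.
move=> L0 J0 mono F01.
have [/existsP[t ht]|] := boolP [exists t : 'I_J,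
  F (K + t * L + L).-1%N - F (K + t * L)%N <= 1 / J%:R].
  by exists t.
rewrite negb_exists => /forallP h.
have S : forall j, (0 < j <= J)%N -> j%:R * (1 / J%:R) < F (K + j * L).-1%N.
  elim=> [//|j IH] /andP[_ jJ].
  have := h (Ordinal jJ); rewrite -ltNge /= => hj.
  have E : (K + j * L + L = K + j.+1 * L)%N by rewrite mulSn -addnA [(L + _)%N]addnC.
  rewrite E in hj; rewrite -natr1 mulrDl mul1r.
  have [j0|j0] := posnP j.
    have /andP[f0 _] := F01 (K + j * L)%N; rewrite j0 mul0r add0r; move: hj; rewrite j0;
      move: f0; rewrite j0; lra.
  have /IH IHj : (0 < j <= J)%N by rewrite j0 ltnW.
  have m : F (K + j * L).-1%N <= F (K + j * L)%N.
    have jL : (0 < j * L)%N by rewrite muln_gt0 j0.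
    apply: mono; [by move: jL; clear; lia|by rewrite leq_pred|].
    by rewrite ltn_add2l ltn_mul2r L0.
  by move: hj m IHj; lra.
have := S J; rewrite J0 leqnn => /(_ isT);
  rewrite mulrA mulr1 divff ?pnatr_eq0 -?lt0n //.
by have /andP[_ f1] := F01 (K + J * L).-1%N; rewrite ltNge f1.
Qed.

Section Endgame.
Context (R : realFieldType) {T : finType} (lt : rel T).
Local Notation N := #|T|.
Local Notation LE := (LE lt).
Context (lt_irr : irreflexive lt) (lt_tr : transitive lt) (LE0 : (0 < #|{: LE}|)%N).
Implicit Types (h : LE) (z u : T).
Context (s Pi : nat) (eta : R) (eta0 : 0 < eta) (eta2 : eta <= 1 / 2) (s0 : (0 < s)%N).
Context (near_s : forall u, (#|nearset lt eta u| <= s)%N) (inc_Pi : forall u,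
  (#|incomp lt u| <= Pi)%N).
Context (Pieta : Pi%:R * eta <= 1 / 2 :> R).
Local Notation median_rank := (median_rank R lt).
Local Notation B2 := (4 * (Pi + s) + 2)%N.
Context (B2eta : B2%:R ^+ 2 * (Pi%:R * eta) <= 1 :> R).
Context (c : nat) (hc : 160 * 160 <= c%:R :> R).
Local Notation l := (c * s ^ 3)%N.
Local Notation L := (l + l)%N.
Local Notation M1 := (3 * s + 5 * L ^ 2 * L)%N.

(* [U] is an up-set that contains [a] and omits [b], so [freq] is bounded away from 0 above
   the median rank of [a] and from 1 below that of [b]. *)
Lemma gap_absurd a b : a != b -> ~~ lt a b -> (median_rank a + M1 < median_rank b)%N ->
  False.
Proof.
move=> ab nab gap.
have c0 : (0 < c)%N by rewrite -(ltr0n R); apply: lt_le_trans hc; rewrite mulr_gt0.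
have l0 : (0 < l)%N by rewrite muln_gt0 expn_gt0 s0 c0.
have L0 : (0 < L)%N by rewrite addn_gt0 l0.
pose U := [set z | ~~ ((z == b) || lt z b)].
have upU x y : lt x y -> x \in U -> y \in U.
  move=> xy; rewrite !inE; apply: contra => /orP[/eqP <-|yb]; first by rewrite xy orbT.
  by rewrite (lt_tr xy yb) orbT.
have aU : a \in U by rewrite inE (negbTE ab).
have bU : b \notin U by rewrite inE eqxx.
pose F := freq R lt U; pose alp : R := 1 / (2 * (2 * s + 1)%:R).
have hbN : (median_rank b <= N)%N by rewrite max_card.
have s2 : (0 : R) < (2 * s + 1)%:R by rewrite ltr0n addn1.
have alp0 : 0 < alp by rewrite divr_gt0 // mulr_gt0.
have alpE (x : R) : 1 / 2 <= (2 * s + 1)%:R * x -> alp <= x.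
  by rewrite /alp => hx; rewrite ler_pdivrMr ?mulr_gt0 //; lra.
(* With probability at least 1/2 the element [a] of [U] occupies one of [2 * s + 1] ranks, all at
   most [k]; monotonicity of [freq] does the rest. *)
have lowF k : (median_rank a + 2 * s <= k)%N -> (k < N)%N -> alp <= F k.
  move=> ak kN; apply: alpE; apply: le_trans (prob_close lt_irr LE0 eta0 eta2 near_s
    inc_Pi Pieta a) _.
  apply: (@le_trans _ _ (\sum_(i < 2 * s + 1) F (median_rank a - s + i)%N)).
    rewrite -expect_sum; apply: ler_expect => h; case d : (deviant R s h a) => /=;
      first by rewrite sumr_ge0.
    have ib : (pos h a - (median_rank a - s) < 2 * s + 1)%N by move: d;
      rewrite /deviant; move: (median_rank a) (pos h a); clear; lia.
    have iE : (median_rank a - s + (pos h a - (median_rank a - s)) = pos h a)%N.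
      by move: d; rewrite /deviant; move: (median_rank a) (pos h a); clear; lia.
    rewrite (bigD1 (Ordinal ib)) //= iE (inU_pos U (erefl (pos h a))) aU lerDl sumr_ge0
      //.
  rewrite mulr_natl -[Z in _ *+ Z]card_ord -sumr_const; apply: ler_sum => i _.
  apply: (freq_mono R lt_irr upU) => //; apply: leq_trans ak; have := ltn_ord i;
    move: (median_rank a); clear; lia.
have highF k : (k <= median_rank b - s)%N -> F k <= 1 - alp.
  move=> kb; suff : alp <= 1 - F k by lra.
  apply: alpE; apply: le_trans (prob_close lt_irr LE0 eta0 eta2 near_s inc_Pi Pieta b)
    _.
  apply: (@le_trans _ _ (\sum_(i < 2 * s + 1) prob (fun h : LE =>
    (median_rank b - s + i < N)%N && ~~ inU U h (median_rank b - s + i)))).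
    rewrite -expect_sum; apply: ler_expect => h; case d : (deviant R s h b) => /=;
      first by rewrite sumr_ge0.
    have ib : (pos h b - (median_rank b - s) < 2 * s + 1)%N by move: d;
      rewrite /deviant; move: (median_rank b) (pos h b); clear; lia.
    have iE : (median_rank b - s + (pos h b - (median_rank b - s)) = pos h b)%N.
      by move: d; rewrite /deviant; move: (median_rank b) (pos h b); clear; lia.
    by rewrite (bigD1 (Ordinal ib)) //= iE (inU_pos U (erefl (pos h b))) bU pos_lt lerDl
      sumr_ge0.
  rewrite mulr_natl -[Z in _ *+ Z]card_ord -sumr_const; apply: ler_sum => i _.
  case: (ltnP (median_rank b - s + i) N) => iN /=; last first.
    by rewrite /prob expect_cst // subr_ge0 prob_le1.
  rewrite probC // lerB // (freq_mono R lt_irr upU) //; apply: leq_trans kb _;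
    exact: leq_addr.
(* A rise of [1 / J] with [J = 5 * L ^ 2] meets the requirement [kap * L ^ 2 <= 1 / 5] of
   [window_bound]. *)
pose K := (median_rank a + 2 * s)%N; pose J := (5 * L ^ 2)%N.
have J0 : (0 < J)%N by rewrite muln_gt0 expn_gt0 L0.
have KJ : (K + J * L <= median_rank b - s)%N.
  by rewrite /K /J; move: gap; move: (5 * L ^ 2 * L)%N (median_rank a) (median_rank b);
    clear; lia.
have KJN : (K + J * L <= N)%N by apply: leq_trans KJ (leq_trans (leq_subr _ _) hbN).
have [t tJ small] : exists2 t, (t < J)%N & F (K + t * L + L).-1%N - F (K + t * L)%N <= 1
  / J%:R.
  apply: telescope_small => // [e d Ke ed dK|e]; last by rewrite prob_ge0 prob_le1.
  by apply: (freq_mono R lt_irr upU) => //; exact: leq_trans dK KJN.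
have tK : (K + t * L + L <= K + J * L)%N.
  by rewrite -addnA leq_add2l addnC -mulSn leq_mul2r tJ orbT.
have tKN : (K + t * L + L <= N)%N by apply: leq_trans tK KJN.
have kapL : 1 / J%:R * L%:R ^+ 2 <= 1 / 5 :> R.
  have Lp : (0 : R) < L%:R by rewrite ltr0n.
  rewrite /J natrM natrX; set y := L%:R in Lp *; rewrite le_eqVlt; apply/orP; left;
    apply/eqP.
  by rewrite !div1r invfM -mulrA mulVf ?mulr1 // expf_neq0 // gt_eqF.
have lo : alp <= F (K + t * L)%N.
  by apply: lowF; [exact: leq_addr|apply: leq_trans tKN; rewrite -addn1 leq_add2l].
have hi : F (K + t * L)%N <= 1 - alp.
  by apply: highF; apply: leq_trans KJ; apply: leq_trans tK; exact: leq_addr.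
have := window_bound lt_irr LE0 eta0 eta2 near_s inc_Pi Pieta B2eta upU l0 tKN small
  kapL alp0 lo hi.
by rewrite leNgt window_length.
Qed.

(** By [card_crowd] fewer than [Pi] elements have median rank within [M1] of that of [x], so some
    element incomparable to [x] is farther away. *)
Lemma endgame x : (40 * L ^ 3 <= Pi)%N -> (Pi <= #|incomp lt x|)%N -> False.
Proof.
move=> LPi xPi.
have c0 : (0 < c)%N by rewrite -(ltr0n R); apply: lt_le_trans hc; rewrite mulr_gt0.
have sL : (s <= L ^ 3)%N.
  apply: (@leq_trans (s ^ 3)); first by rewrite -{1}(expn1 s) leq_pexp2l.
  rewrite leq_exp2r //; apply: leq_trans (leq_addr _ _);
    apply: (@leq_trans (1 * s ^ 3)).
    by rewrite mul1n -{1}(expn1 s) leq_pexp2l.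
  by rewrite leq_mul2r c0 orbT.
have L3 : (5 * L ^ 2 * L = 5 * L ^ 3)%N by rewrite -mulnA -expnSr.
have small : (#|crowd R lt (median_rank x) M1| < #|incomp lt x|)%N.
  apply: leq_trans xPi; apply: leq_trans LPi.
  apply: leq_ltn_trans (card_crowd lt_irr LE0 eta0 eta2 near_s inc_Pi Pieta _ _) _.
  by rewrite L3; move: sL s0; move: (L ^ 3)%N; clear; lia.
have [z zx zc] : exists2 z, z \in incomp lt x & z \notin crowd R lt (median_rank x) M1.
  apply/subsetPn; apply: contraL small => /subset_leq_card; by rewrite -leqNgt.
move: zx; rewrite inE => /and3P[zx xz nzx]; rewrite inE -ltNge in zc.
have [gap|gap] : (median_rank x + M1 < median_rank z)%N \/ (median_rank z + M1 <
  median_rank x)%N.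
  by move: zc; move: (median_rank x) (median_rank z) M1; clear; lia.
  by apply: gap_absurd gap => //; rewrite eq_sym.
by apply: gap_absurd gap.
Qed.

End Endgame.

(** * Padding a poset *)

Section TotalOrder.
Context {T : finType} (lt r : rel T).
Local Notation N := #|T|.
Context (r_irr : irreflexive r) (r_tr : transitive r) (r_tot : forall x y, x != y ->
  r x y || r y x)
  (ltr : forall x y, lt x y -> r x y).

Lemma total_rank_lt z : (#|[set y | r y z]| < N)%N.
Proof.
rewrite -[X in (_ < X)%N]cardsT; apply: proper_card; rewrite properT.
by apply/negP => /eqP/setP/(_ z); rewrite !inE r_irr.
Qed.

Definition total_rank : {ffun T -> 'I_N} := [ffun z => Ordinal (total_rank_lt z)].

Lemma total_rank_mono x y : r x y -> (total_rank x < total_rank y)%N.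
Proof.
move=> xy; rewrite !ffunE; apply: proper_card; apply/properP; split.
  by apply/subsetP => z; rewrite !inE => zx; exact: r_tr xy.
by exists x; rewrite inE // r_irr.
Qed.

Lemma LE_of_total : exists h : LE lt, forall x y, (pos h x < pos h y)%N = r x y.
Proof.
have E x y : (total_rank x < total_rank y)%N = r x y.
  apply/idP/idP; last exact: total_rank_mono.
  apply: contraTT => nxy; have [->|xy] := eqVneq x y; first by rewrite ltnn.
  have := r_tot xy; rewrite (negbTE nxy) /= => /total_rank_mono;
    by rewrite -leqNgt => /ltnW.
have P : op_map lt total_rank && injectiveb total_rank.
  apply/andP; split.
    by apply/forallP => x; apply/forallP => y;
      apply/implyP => /ltr/total_rank_mono/ltnW.
  apply/injectiveP => x y e; apply/eqP; apply: contraT => /r_tot.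
  by rewrite -!E e ltnn.
by exists (exist _ total_rank P).
Qed.

End TotalOrder.

(** Sort by the number of predecessors and break ties by the enumeration. *)
Lemma LE_gt0 (T : finType) (lt : rel T) : irreflexive lt -> transitive lt ->
  (0 < #|{: LE lt}|)%N.
Proof.
move=> irr tr; pose key z := (#|[set y | lt y z]| * #|T| + enum_rank z)%N.
have [||||h _] := @LE_of_total T lt (fun x y => key x < key y)%N;
  last by apply/card_gt0P; exists h.
- by move=> x; rewrite ltnn.
- by move=> y x z; exact: ltn_trans.
- move=> x y; apply: contraNT; rewrite negb_or -!leqNgt -eqn_leq => /eqP; rewrite /key.
  have := ltn_ord (enum_rank x); have := ltn_ord (enum_rank y).
  move: (enum_rank x) (enum_rank y) (@enum_rank_inj T x y) => i j ij jT iT e.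
  apply/eqP/ij/ord_inj; have := congr1 (modn^~ #|T|) e; by rewrite !modnMDl !modn_small.
- move=> x y xy; rewrite /key.
  have lxy : (#|[set z | lt z x]| < #|[set z | lt z y]|)%N.
    apply: proper_card; apply/properP; split; last by exists x; rewrite inE ?xy // irr.
    by apply/subsetP => z; rewrite !inE => zx; exact: tr xy.
  apply: leq_trans (leq_addr _ _); apply: leq_trans (_ : #|[set z | lt z x]|.+1 * #|T|
    <= _)%N.
    by rewrite mulSn addnC ltn_add2r.
  by rewrite leq_mul2r lxy orbT.
Qed.

Section Padding.
Context (d : Order.disp_t) (P : finPOrderType d) (n : nat).

(* Chains of length [n] on both sides, so that every element of [P] is far from the ends;
   they affect neither the linear extensions of [P] nor the incomparabilities. *)
Definition padded : finType := ('I_n + (P + 'I_n))%type.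

Definition padlt (u v : padded) : bool :=
  match u, v with
  | inl i, inl j => (i < j)%N
  | inl _, inr _ => true
  | inr _, inl _ => false
  | inr (inl x), inr (inl y) => (x < y)%O
  | inr (inl _), inr (inr _) => true
  | inr (inr _), inr (inl _) => false
  | inr (inr i), inr (inr j) => (i < j)%N
  end.

Definition inner (x : P) : padded := inr (inl x).
Definition bottom_pad (i : 'I_n) : padded := inl i.
Definition top_pad (i : 'I_n) : padded := inr (inr i).

Lemma padlt_irr : irreflexive padlt.
Proof. by move=> [i|[x|i]] /=; rewrite ?ltnn ?ltxx. Qed.

Lemma padlt_tr : transitive padlt.
Proof.
move=> [j|[y|j]] [i|[x|i]] [k|[z|k]] //=;
  [exact: ltn_trans|exact: lt_trans|exact: ltn_trans].
Qed.

Lemma padlt_total u v : u != v -> ~~ padlt u v -> ~~ padlt v u ->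
  exists x y, [/\ u = inner x, v = inner y & (x >< y)%O].
Proof.
case: u => [i|[x|i]]; case: v => [j|[y|j]] //= uv n1 n2.
- by case/eqP: uv; congr inl; apply: ord_inj; move: n1 n2; clear; lia.
- exists x, y; split => //; apply: contra uv; rewrite /Order.comparable.
  by rewrite !le_eqVlt (negbTE n1) (negbTE n2) !orbF => /orP[/eqP ->|/eqP ->].
- by case/eqP: uv; congr (inr (inr _)); apply: ord_inj; move: n1 n2; clear; lia.
Qed.

Lemma inner_inj : injective inner. Proof. by move=> x y []. Qed.

Lemma incomp_inner x : incomp padlt (inner x) = inner @: [set y : P | (x >< y)%O].
Proof.
apply/setP => z; rewrite inE; apply/and3P/imsetP => [[zx xz nzx]|[y]].
  have [y [x' [-> [<-] yx]]] := padlt_total zx nzx xz; exists y => //.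
  by rewrite inE comparable_sym.
rewrite inE => xy ->; split => /=.
- by rewrite (inj_eq inner_inj); apply: contraNneq xy => ->; exact: comparablexx.
- by apply: contraNN xy; exact: lt_comparable.
- by apply: contraNN xy; exact: gt_comparable.
Qed.

Lemma incomp_pad u : (forall x, u != inner x) -> incomp padlt u = set0.
Proof.
move=> nu; apply/setP => z; rewrite !inE; apply/negP => /and3P[zu uz nzu].
have [x [y [_ uy _]]] := padlt_total zu nzu uz; by move: (nu y); rewrite uy eqxx.
Qed.

Lemma card_incomp_inner x : #|incomp padlt (inner x)| = incomp_count x.
Proof. by rewrite incomp_inner card_imset //; exact: inner_inj. Qed.

Lemma card_incomp u : (#|incomp padlt u| <= max_incomp_count P)%N.
Proof.
case: u => [i|[x|i]]; [by rewrite incomp_pad ?cards0| |by rewrite incomp_pad ?cards0].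
by rewrite card_incomp_inner /max_incomp_count leq_bigmax.
Qed.

(** A padding element is comparable to every other element, so an antichain of size at least 2 lies
    in [P]; [0 < w] covers the smaller ones. *)
Lemma antichain_pad w (A : {set padded}) : (0 < w)%N -> (width P <= w)%N ->
  {in A &, forall x y, ~~ padlt x y} -> (#|A| <= w)%N.
Proof.
move=> w0 wP anti; have [A1|A1] := leqP #|A| 1; first exact: leq_trans A1 w0.
apply: leq_trans wP.
have coreA u : u \in A -> exists x, u = inner x.
  move=> uA; have [v vA vu] : exists2 v, v \in A & u != v.
    have /card_gt0P[v] : (0 < #|A :\ u|)%N by move: A1; rewrite (cardsD1 u) uA.
    by rewrite !inE => /andP[vu vA]; exists v; rewrite // eq_sym.
  by have [x [_ [-> _ _]]] := padlt_total vu (anti _ _ uA vA) (anti _ _ vA uA);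
    exists x.
pose A' := [set x : P | inner x \in A].
have -> : A = inner @: A'.
  apply/setP => u; apply/idP/imsetP => [uA|[x xA ->]]; last by move: xA; rewrite inE.
  by have [x ux] := coreA u uA; exists x => //; rewrite inE -ux.
rewrite card_imset; last exact: inner_inj.
rewrite /width; apply: (leq_bigmax_cond (F := fun A : {set P} => #|A|)).
apply/forall_inP => x xA; apply/forall_inP => y yA; apply/implyP => xy.
rewrite !inE in xA yA; have n1 : ~~ (x < y)%O := anti _ _ xA yA;
  have n2 : ~~ (y < x)%O := anti _ _ yA xA.
by rewrite /Order.comparable !le_eqVlt (negbTE n1) (negbTE n2) !orbF negb_or xy eq_sym.
Qed.

Local Notation LEp := (LE padlt).
Implicit Types (h : LEp).

Lemma LEp_gt0 : (0 < #|{: LEp}|)%N. Proof. by apply: LE_gt0;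
  [exact: padlt_irr|exact: padlt_tr]. Qed.

Definition ext_of h : {set P * P} := [set p | (pos h (inner p.1) < pos h (inner
  p.2))%N].

(** Only pairs inside [P] are left open by the padded order, so the restriction to [P] determines
    all comparisons and hence all ranks. *)
Lemma ext_of_inj : injective ext_of.
Proof.
move=> h h' /setP e.
have E u v : (pos h u < pos h v)%N = (pos h' u < pos h' v)%N.
  have [->|uv] := eqVneq u v; first by rewrite !ltnn.
  case uv1 : (padlt u v); first by rewrite !(pos_mono padlt_irr).
  case vu1 : (padlt v u).
    have h1 := pos_mono padlt_irr h vu1; have h2 := pos_mono padlt_irr h' vu1.
    by rewrite [LHS]ltnNge (ltnW h1) ltnNge (ltnW h2).
  have [x [y [-> -> _]]] := padlt_total uv (negbT uv1) (negbT vu1).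
  by have := e (x, y); rewrite !inE.
apply: val_inj; apply/ffunP => z; apply: ord_inj;
  rewrite -[LHS]/(pos h z) -[RHS]/(pos h' z).
rewrite -(card_before h z) -(card_before h' z); apply: eq_card => y; by rewrite !inE E.
Qed.

Lemma ext_of_linear h : linear_extension (ext_of h).
Proof.
apply/and4P; split.
- by apply/forallP => x; rewrite inE ltnn.
- apply/forallP => x; apply/forallP => y; apply/forallP => z; apply/implyP;
  rewrite !inE => /andP[].
  exact: ltn_trans.
- apply/forallP => x; apply/forallP => y; apply/implyP => xy; rewrite !inE /= -neq_ltn.
  by apply: contra xy => /eqP/pos_inj[->].
- by apply/forallP => x; apply/forallP => y; apply/implyP => xy;
  rewrite inE (pos_mono padlt_irr).
Qed.

Lemma ext_of_surj (L : {set P * P}) : linear_extension L -> exists h, ext_of h = L.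
Proof.
move=> /and4P[/forallP Lirr /forallP Ltr /forallP Ltot /forallP Lext].
pose r (u v : padded) := match u, v with inr (inl x), inr (inl y) =>
  (x, y) \in L | _, _ => padlt u v end.
have [||||h hE] := @LE_of_total padded padlt r.
- by move=> [i|[x|i]]; [exact: ltnn|exact: negbTE (Lirr x)|exact: ltnn].
- move=> [j|[y|j]] [i|[x|i]] [k|[z|k]] //=; [exact: ltn_trans| |exact: ltn_trans].
  move=> xy yz; have /forallP/(_ y)/forallP/(_ z) := Ltr x; by rewrite xy yz.
- move=> u v uv; case uv1 : (padlt u v).
    by apply/orP; left; move: u v uv uv1 => [i|[x|i]] [j|[y|j]] //= _ xy;
      have /forallP/(_ y)/implyP := Lext x; apply.
  case vu1 : (padlt v u).
    by apply/orP; right; move: u v uv uv1 vu1 => [i|[x|i]] [j|[y|j]] //= _ _ xy;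
      have /forallP/(_ x)/implyP := Lext y; apply.
  have [x [y [ux vy _]]] := padlt_total uv (negbT uv1) (negbT vu1).
  rewrite ux vy /r /=; have /forallP/(_ y)/implyP := Ltot x; apply.
  by apply: contraNneq uv => e; rewrite ux vy e.
- by move=> [i|[x|i]] [j|[y|j]] //= xy; have /forallP/(_ y)/implyP := Lext x; apply.
by exists h; apply/setP => -[x y]; rewrite inE hE.
Qed.

Lemma linear_extensionsE : linear_extensions P = ext_of @: [set: LEp].
Proof.
apply/setP => L; rewrite inE; apply/idP/imsetP => [/ext_of_surj[h <-]|[h _ ->]];
  last exact: ext_of_linear.
by exists h.
Qed.

Lemma prob_precE (R : realFieldType) x y : prob_prec R x y = prec R padlt (inner x)
  (inner y).
Proof.
rewrite /prob_prec /prec /prob /expect; congr (_ / _).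
  rewrite -natr_sum; congr (_%:R).
  rewrite (_ : [set L in _ | _] = ext_of @: [set h : LEp | (pos h (inner x) < pos h
    (inner y))%N]).
    rewrite card_imset; last exact: ext_of_inj.
    by rewrite -sum1_card big_mkcond; apply: eq_bigr => h _; rewrite inE;
      case: (_ < _)%N.
  apply/setP => L; rewrite inE linear_extensionsE;
    apply/andP/imsetP => [[/imsetP[h _ ->]]|[h]].
    by rewrite inE => xy; exists h; rewrite // inE.
  by rewrite inE => xy ->; rewrite imset_f // inE.
by rewrite linear_extensionsE card_imset ?cardsT //; exact: ext_of_inj.
Qed.

Lemma card_below_bottom_pad (i : 'I_n) : (i <= #|[set z | padlt z (bottom_pad i)]|)%N.
Proof.
pose F (j : 'I_i) : padded := bottom_pad (widen_ord (ltnW (ltn_ord i)) j).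
have Fi : injective F by move=> j k [/ord_inj].
rewrite -[leqLHS](card_ord i) -(card_imset _ Fi);
  apply/subset_leq_card/subsetP => _ /imsetP[j _ ->].
by rewrite inE /=.
Qed.

Lemma card_bottom_pad : (n <= #|[set bottom_pad i | i : 'I_n]|)%N.
Proof. by rewrite card_imset ?card_ord // => i j []. Qed.

Lemma card_top_pad : (n <= #|[set top_pad i | i : 'I_n]|)%N.
Proof. by rewrite card_imset ?card_ord // => i j []. Qed.

Lemma card_above_top_pad (i : 'I_n) : (n.-1 - i <= #|[set z | padlt (top_pad i) z]|)%N.
Proof.
have bd (j : 'I_(n.-1 - i)) : (n.-1 - j < n)%N by have := ltn_ord j; have := ltn_ord i;
  clear; lia.
pose F (j : 'I_(n.-1 - i)) : padded := top_pad (Ordinal (bd j)).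
have Fi : injective F by move=> j k [e]; apply: ord_inj; have := ltn_ord j;
  have := ltn_ord k; move: e; clear; lia.
rewrite -[leqLHS](card_ord (n.-1 - i)) -(card_imset _ Fi);
  apply/subset_leq_card/subsetP => _ /imsetP[j _ ->].
by rewrite inE /=; have := ltn_ord j; clear; lia.
Qed.

End Padding.

(** * Anchors in the padded poset *)

(** With [b = a.+1] and [u = v %/ b], [v ^ b <= (u.+1 * b) ^ b <= 2 ^ v * b ^ b], and one factor
    [v >= b ^ b] cancels. *)
Lemma pow2_dominates (a : nat) : exists V, forall v, (V <= v)%N -> (v ^ a <= 2 ^ v)%N.
Proof.
pose b := a.+1; exists (b ^ b)%N => v Vv.
have v0 : (0 < v)%N by apply: leq_trans Vv; rewrite expn_gt0.
pose u := (v %/ b)%N.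
have h1 : (v ^ b <= (u.+1 * b) ^ b)%N by rewrite leq_exp2r // ltnW // ltn_ceil.
have h2 : (u.+1 ^ b <= 2 ^ v)%N.
  apply: (@leq_trans ((2 ^ u) ^ b)); first by rewrite leq_exp2r // ltn_expl.
  by rewrite -expnM leq_pexp2l // leq_trunc_div.
rewrite -(leq_pmul2l v0) -expnS; apply: leq_trans h1 _; rewrite expnMn mulnC.
by rewrite leq_mul.
Qed.

Lemma integer_root (e V n : nat) : (0 < e)%N -> (V ^ e <= n)%N ->
  exists v, [/\ (V <= v)%N, (v ^ e <= n)%N & (n < v.+1 ^ e)%N].
Proof.
move=> e0 Vn; pose p v := (v ^ e <= n)%N.
have exp : exists v, p v by exists V.
have bnd v : p v -> (v <= n)%N.
  by move=> pv; apply: leq_trans pv; case: v => // v;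
    rewrite -{1}(expn1 v.+1) leq_pexp2l.
case: (ex_maxnP exp bnd) => v pv vmax; exists v; split => //; first exact: vmax.
by rewrite ltnNge; apply/negP => /vmax; rewrite ltnn.
Qed.

Section Anchor.
Context (R : realFieldType) (d : Order.disp_t) (P : finPOrderType d) (n m D : nat).
Local Notation padlt := (@padlt d P n).
Local Notation T := (padded P n).
Context (OP0 : (0 < #|{: OP padlt m}|)%N) (D0 : (0 < D)%N).
Context (t q B : nat) (t0 : (0 < t)%N) (tq : (2 * t + 1 <= q ^ 2)%N) (Bn : (B + 4 * t +
  12 * q + 2 <= n)%N).
Context (inc : forall c : T, (B <= #|[set z | padlt z c]|)%N ->
  (B <= #|[set z | padlt c z]|)%N ->
  incompressible padlt m c (D * q ^ 2) (D%:R^-1 : R) (6 * q%:R)).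

Lemma top_pad_above (c : T) : (forall i, c != top_pad P i) ->
  (n <= #|[set z | padlt c z]|)%N.
Proof.
move=> nc; apply: leq_trans (card_top_pad P n) _;
  apply/subset_leq_card/subsetP => _ /imsetP[i _ ->].
by rewrite inE; move: nc; case: c => [j|[x|j]] //= /(_ j); rewrite eqxx.
Qed.

Lemma bottom_pad_below (c : T) : (forall i, c != bottom_pad P i) ->
  (n <= #|[set z | padlt z c]|)%N.
Proof.
move=> nc; apply: leq_trans (card_bottom_pad P n) _;
  apply/subset_leq_card/subsetP => _ /imsetP[i _ ->].
by rewrite inE; move: nc; case: c => [j|[x|j]] //= /(_ j); rewrite eqxx.
Qed.

Lemma dist_between_below (x y z : T) : padlt x y -> padlt y z ->
  dist R padlt m y z <= dist R padlt m x z.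
Proof.
move=> xy yz; apply: ler_expect => f; rewrite ler_int.
have h1 := value_mono f xy; have h2 := value_mono f yz; move: h1 h2; clear; lia.
Qed.

Lemma dist_between_above (x y z : T) : padlt z y -> padlt y x ->
  dist R padlt m y z <= dist R padlt m x z.
Proof.
move=> xy yz; apply: ler_expect => f; rewrite ler_int.
have h1 := value_mono f xy; have h2 := value_mono f yz; move: h1 h2; clear; lia.
Qed.

(** Suppose the anchor is in the bottom padding with fewer than [B] elements below it. The padding
    element of index [B] lies between it and [y], so it is no farther from [y], and [inc] applies to
    it; [few_above] then contradicts the number of padding elements above it. The top is
    symmetric. *)
Lemma anchors_mid (y : P) (c : T) : c \in ball R padlt m D (inner n y) t ->
  (B <= #|[set z | padlt z c]|)%N /\ (B <= #|[set z | padlt c z]|)%N.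
Proof.
rewrite inE dist_sym => cy.
have Bn' : (B <= n)%N by apply: leq_trans Bn; rewrite -!addnA leq_addr.
have Bn2 : (B < n)%N by move: Bn; clear; lia.
case: c cy => [i|[x|i]] cy.
- split; last by apply: leq_trans Bn' _; apply: top_pad_above.
  apply: leq_trans (card_below_bottom_pad P i); rewrite leqNgt; apply/negP => iB.
  pose c' : T := bottom_pad P (Ordinal Bn2).
  have inc' : incompressible padlt m c' (D * q ^ 2) (D%:R^-1 : R) (6 * q%:R).
    apply: inc; first exact: (card_below_bottom_pad P (Ordinal Bn2)).
    by apply: leq_trans Bn' _; apply: top_pad_above.
  have cy' : dist R padlt m c' (inner n y) <= (t * D)%:R.
    by apply: le_trans cy; apply: dist_between_below.
  have := few_above OP0 D0 t0 tq inc' cy' (S := [set bottom_pad P j | j in [set j : 'I_n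
    | (B < j)%N]]).
  have -> : #|[set bottom_pad P j | j in [set j : 'I_n | (B < j)%N]]| = (n - B.+1)%N.
    rewrite card_imset; last by move=> a b [].
    have := cardsC [set j : 'I_n | (B < j)%N]; rewrite card_ord.
    have -> : #|~: [set j : 'I_n | (B < j)%N]| = B.+1.
      rewrite -[RHS]card_ord -[RHS](card_imset _ (_ : injective (widen_ord Bn2)));
        last by move=> a b /(congr1 val) /= /ord_inj.
      apply: eq_card => j; rewrite !inE -leqNgt; apply/idP/imsetP => [jB|[a _ ->]].
        by exists (Ordinal (jB : (j < B.+1)%N)) => //; apply: ord_inj.
      by rewrite /= -ltnS.
    by clear; lia.
  move=> /(_ _)/wrap[]; first by move=> z /imsetP[j]; rewrite inE => Bj -> /=;
    rewrite Bj.
  by move: Bn; clear; lia.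
- by split; apply: leq_trans Bn' _; [apply: bottom_pad_below|apply: top_pad_above].
- split; first by apply: leq_trans Bn' _; apply: bottom_pad_below.
  apply: leq_trans (card_above_top_pad P i); rewrite leqNgt; apply/negP => iB.
  have bd : (n.-1 - B < n)%N by move: Bn2; clear; lia.
  pose c' : T := top_pad P (Ordinal bd).
  have inc' : incompressible padlt m c' (D * q ^ 2) (D%:R^-1 : R) (6 * q%:R).
    apply: inc; first by apply: leq_trans Bn' _; apply: bottom_pad_below.
    by apply: leq_trans (card_above_top_pad P (Ordinal bd)); move: Bn2; clear => /=;
      lia.
  have cy' : dist R padlt m c' (inner n y) <= (t * D)%:R.
    apply: le_trans cy; apply: dist_between_above => //=.
    by have := ltn_ord i; move: iB Bn2; clear; lia.
  have := few_below OP0 D0 t0 tq inc' cy' (S := [set top_pad P j | j in [set j : 'I_n |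
    (j < n.-1 - B)%N]]).
  have -> : #|[set top_pad P j | j in [set j : 'I_n | (j < n.-1 - B)%N]]| = (n.-1 -
    B)%N.
    rewrite card_imset; last by move=> a b [].
    rewrite -[RHS]card_ord -[RHS](card_imset _ (_ : injective (widen_ord (ltnW bd))));
      last by move=> a b /(congr1 val) /= /ord_inj.
    apply: eq_card => j; rewrite !inE; apply/idP/imsetP => [jB|[a _ ->]];
      last by rewrite /= ltn_ord.
    by exists (Ordinal jB) => //; apply: ord_inj.
  move=> /(_ _)/wrap[]; first by move=> z /imsetP[j]; rewrite inE => Bj -> /=.
  by move: Bn; clear; lia.
Qed.

End Anchor.

(** * Choice of parameters *)

Lemma balance_ge0 (R : realFieldType) (d : Order.disp_t) (P : finPOrderType d) :
  0 <= balance P R.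
Proof.
rewrite /balance; elim/big_rec: _ => // p x _ x0.
by rewrite le_max x0 orbT.
Qed.

Lemma le_balance (R : realFieldType) (d : Order.disp_t) (P : finPOrderType d) (x y : P)
  :
  x != y -> balance_pair R x y <= balance P R.
Proof.
move=> xy; rewrite /balance.
exact: (le_bigmax_cond 0 (fun p : P * P => balance_pair R p.1 p.2) (j := (x, y))).
Qed.

Section Padded.
Context (R : realFieldType) (d : Order.disp_t) (P : finPOrderType d) (n : nat).
Local Notation padlt := (@padlt d P n).
Context (eps : R) (eps2 : eps <= 1 / 2).

Lemma prec_unbalanced (u v : padded P n) : balance P R <= 1 / 2 - eps -> u != v ->
  prec R padlt u v <= 1 / 2 - eps \/ 1 / 2 + eps <= prec R padlt u v.
Proof.
move=> bal uv; have e2 := eps2; have irr := @padlt_irr d P n; have LE0 := LEp_gt0 P n.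
case uv1 : (padlt u v); first by right; rewrite prec_lt //; lra.
case vu1 : (padlt v u); first by left; rewrite prec_gt //; lra.
have [x [y [ux vy _]]] := padlt_total uv (negbT uv1) (negbT vu1).
have xy : x != y by apply: contraNneq uv => e; rewrite ux vy e.
have := le_trans (le_balance R xy) bal;
  rewrite /balance_pair !(prob_precE n) -ux -vy ge_min.
have S := prec_sum R LE0 uv.
by case/orP => h; [left|right; lra].
Qed.

Lemma nearset_incomp (eta : R) (u : padded P n) : 0 < eta ->
  nearset padlt eta u \subset incomp padlt u.
Proof.
move=> eta0; have irr := @padlt_irr d P n; have LE0 := LEp_gt0 P n.
apply/subsetP => z; rewrite !inE => /andP[zu uz]; apply/and3P; split.
- by apply: contraTneq zu => ->; rewrite prec_refl // -ltNge.
- by apply: contraTN zu => uz'; rewrite prec_gt // -ltNge.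
- by apply: contraTN uz => zu'; rewrite prec_gt // -ltNge.
Qed.

End Padded.

(** [C1 <= v] pays for [v.+1 ^ 128 <= 2 ^ 128 * v ^ 128], and the exponent 388 exceeds [129 * 3] by
    one power of [v] that pays for 600. *)
Lemma growth_bounds (w v n V1 V2 C1 : nat) : (0 < w)%N -> C1 = (1096 * w * 2 ^ 128)%N ->
  (V1 + V2 + C1 + 160 * 160 + 600 <= v)%N -> (v ^ 388 <= 2 ^ v)%N ->
  (v ^ 128 <= n)%N -> (n < v.+1 ^ 128)%N ->
  [/\ (1096 * w * n <= v ^ 129)%N, (0 < v)%N, (600 * n ^ 3 <= 2 ^ v)%N,
    (v ^ 13 <= n)%N &
      (40 * (v * (v ^ 13) ^ 3 + v * (v ^ 13) ^ 3) ^ 3 <= n)%N].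
Proof.
move=> w0 C1E Vv pw vn nv.
have v600 : (600 <= v)%N by apply: leq_trans Vv; exact: leq_addl.
have v0 : (0 < v)%N by apply: leq_trans v600.
have C1v : (C1 <= v)%N.
  by apply: leq_trans Vv; apply: leq_trans (leq_addl (V1 + V2) C1) _;
    exact: leq_trans (leq_addr (160 * 160) _) (leq_addr 600 _).
have pow i j : (i <= j)%N -> (v ^ i <= v ^ j)%N by move=> ij; rewrite leq_pexp2l.
have n129 : (1096 * w * n <= v ^ 129)%N.
  apply: (@leq_trans (1096 * w * (2 ^ 128 * v ^ 128))).
    rewrite leq_mul2l; apply/orP; right; rewrite -expnMn; apply: leq_trans (ltnW nv) _.
    by rewrite leq_exp2r // mul2n -addnn -addn1 leq_add2l.
  by rewrite mulnA -C1E expnS leq_mul2r C1v orbT.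
have nn : (n <= v ^ 129)%N by apply: leq_trans n129; rewrite leq_pmull // muln_gt0.
split => //.
- apply: leq_trans pw; apply: (@leq_trans (600 * (v ^ 129) ^ 3));
  first by rewrite leq_mul2l leq_exp2r ?nn ?orbT.
  by rewrite -expnM -[(129 * 3)%N]/387%N (expnS v 387) leq_mul2r v600 orbT.
- by apply: leq_trans vn; exact: pow.
have -> : (v * (v ^ 13) ^ 3 = v ^ 40)%N by rewrite -expnM -expnS.
rewrite addnn -mul2n expnMn -expnM mulnA; apply: leq_trans vn.
apply: (@leq_trans (600 * v ^ 120)); first by rewrite leq_mul2r orbT.
by apply: leq_trans (pow 121%N 128%N isT); rewrite (expnS v 120) leq_mul2r v600 orbT.
Qed.

Theorem theorem1p6 (R : realType) (w : nat) (hw : (0 < w)%N)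
    (eps : R) (heps : 0 < eps) :
  exists K : nat,
    forall (d : Order.disp_t) (P : finPOrderType d),
      (width P <= w)%N -> (K < max_incomp_count P)%N ->
      1 / 2 - eps < balance P R.
Proof.
have [eps2|eps2] := ltP (1 / 2) eps.
  exists 0%N => d P _ _.
  have b0 := @balance_ge0 R d P.
  by apply: (lt_le_trans _ b0); rewrite subr_lt0.
(* Half of [eps] is given up when probabilities for linear extensions are replaced by those for
   maps. *)
have eps20 : 0 < eps / 2 by rewrite divr_gt0.
have [V1 near] := near_count hw eps20.
have [V2 dom] := pow2_dominates 388.
have [C1 C1E] : exists C, C = (1096 * w * 2 ^ 128)%N by eexists.
pose V := (V1 + V2 + C1 + 160 * 160 + 600)%N.
exists (V ^ 128)%N => d P wP KP; rewrite ltNge; apply/negP => bal.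
set Pi := max_incomp_count P in KP.
have [v [Vv vn nv]] := @integer_root 128 V Pi isT (ltnW KP).
have V2v : (V2 <= v)%N by apply: leq_trans Vv; rewrite /V -!addnA addnCA leq_addr.
have V1v : (V1 <= v)%N by apply: leq_trans Vv; rewrite /V -!addnA leq_addr.
have [n129 v0 n600 sPi LPi] := growth_bounds hw C1E Vv (dom v V2v) vn nv.
have Pi0 : (0 < Pi)%N by apply: leq_ltn_trans KP.
pose X : R := 2^-1 ^+ v; have X0 : 0 < X by rewrite exprn_gt0 // invr_gt0.
(* [near_count] needs a threshold above [2 * 2^-1 ^+ v]. *)
pose eta := 3 * X; have eta0 : 0 < eta by rewrite mulr_gt0.
pose t0 := (1096 * w * Pi)%N; have t00 : (0 < t0)%N by rewrite !muln_gt0 hw Pi0.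
pose q := (2 * t0 + 1)%N; have tq : (2 * t0 + 1 <= q ^ 2)%N by rewrite -/q -{1}(expn1 q)
  leq_pexp2l // /q addn1.
(* [B] is dictated by [incompressible_mid] at scale [q], and the padding length [N] by
   [anchors_mid]. *)
pose B := (2 * q ^ 4)%N; pose N := (B + 4 * t0 + 12 * q + 2)%N.
pose T := padded P N; pose lt := @padlt d P N.
have irr : irreflexive lt by exact: padlt_irr.
have tr : transitive lt by exact: padlt_tr.
have LE0 : (0 < #|{: LE lt}|)%N by exact: LEp_gt0.
have N0 : (0 < N)%N by rewrite /N addn2.
have n0 : (0 < #|T|)%N by apply/card_gt0P; exists (bottom_pad P (Ordinal N0)).
have [M1 hM1] := nat_above 1 eps20.
have [M2 hM2] := nat_above 1 eta0.
pose M := (#|T| + q ^ 2 + M1 + M2)%N.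
have M0 : (0 < M)%N by rewrite /M !addn_gt0 n0.
pose D := (M * collision_const (T := T) + 2)%N.
have D2 : (1 < D)%N by rewrite /D addn2.
have D0 : (0 < D)%N by exact: ltnW.
have DM : (M * collision_const (T := T) <= D)%N by rewrite leq_addr.
pose m := (#|T| * D)%N.
have MR : (0 : R) < M%:R by rewrite ltr0n.
have Meps : M%:R^-1 <= eps / 2 :> R.
  rewrite -div1r ler_pdivrMr // mulrC; apply: le_trans hM1 _;
    rewrite ler_wpM2r ?(ltW eps20) // ler_nat /M.
  by rewrite addnAC leq_addl.
have Meta : M%:R^-1 <= eta.
  rewrite -div1r ler_pdivrMr // mulrC; apply: le_trans hM2 _;
    rewrite ler_wpM2r ?(ltW eta0) // ler_nat /M.
  by rewrite leq_addl.
have bp u u' := before_prec R n0 LE0 D2 M0 DM u u'.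
have OP0 : (0 < #|{: OP lt m}|)%N by exact: (OP_gt0 LE0 n0 D2).
have st : setting lt m D w (eps / 2).
  split => //; first by move=> A; exact: antichain_pad.
  move=> u u' uu'; have := bp u u'; rewrite ler_norml => /andP[b1 b2].
  have [h|h] := prec_unbalanced eps2 bal uu'; [left|right]; lra.
have mid c q' : (0 < q')%N -> (q' <= q)%N -> (B <= #|[set z | lt z c]|)%N ->
  (B <= #|[set z | lt c z]|)%N ->
    incompressible lt m c (D * q' ^ 2) (D%:R^-1 : R) (6 * q'%:R).
  move=> q0 qq nb na; apply: (incompressible_mid R irr n0 LE0 D2 M0 DM q0 nb na).
    by rewrite leq_mul2l leq_exp2r // qq orbT.
  rewrite /M -!addnA leq_add2l; apply: leq_trans (leq_addr _ _); by rewrite leq_exp2r.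
have Pit : (Pi <= t0)%N by rewrite leq_pmull // muln_gt0.
have tq' : (t0 <= q)%N by rewrite /q; move: (t0) => t; clear; lia.
have nears y : (#|[set u : T | (eta <= before R lt m u (inner N y))%R && (eta <= before
  R lt m (inner N y) u)%R]| <= v ^ 13)%N.
  apply: (near v V1v T lt m D st (inner N y) Pi eta vn n129).
  - exact: card_incomp.
  - move=> c q' cb /andP[q0 qPi].
    have qmid c' : (B <= #|[set z | lt z c']|)%N -> (B <= #|[set z | lt c' z]|)%N ->
      incompressible lt m c' (D * q ^ 2) (D%:R^-1 : R) (6 * q%:R).
      by apply: mid; rewrite // /q addn1.
    have [nb na] := anchors_mid OP0 D0 t00 tq (leqnn _) qmid cb.
    by apply: mid => //; apply: leq_trans qPi (leq_trans Pit tq').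
  - by rewrite /eta ltr_pM2r // ltr_nat.
(* Passing from [before] to [prec] costs at most [M%:R^-1 <= eta], hence the doubled threshold. *)
have near_s (u : T) : (#|nearset lt (2 * eta) u| <= v ^ 13)%N.
  have e0 : 0 < 2 * eta by rewrite mulr_gt0.
  case: (boolP [exists y, u == inner N y]) => [/existsP[y /eqP ->]|].
    apply: leq_trans (nears y); apply/subset_leq_card/subsetP => z;
      rewrite !inE => /andP[h1 h2].
    have := bp z (inner N y); have := bp (inner N y) z;
      rewrite !ler_norml => /andP[b1 _] /andP[b2 _].
    by apply/andP; split; lra.
  rewrite negb_exists => /forallP nu.
  by have := subset_leq_card (nearset_incomp u e0); rewrite incomp_pad // cards0;
    move/leq_trans; apply.
have [x hx] : exists x : P, incomp_count x = Pi.
  have P0 : (0 < #|P|)%N.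
    rewrite lt0n; apply: contraTneq Pi0 => P0; rewrite -leqNgt /Pi /max_incomp_count;
      apply/bigmax_leqP => x _.
    by have := card0_eq P0 x.
  by have [x ex] := @bigop.eq_bigmax P (fun x : P => incomp_count x) P0; exists x;
    rewrite /Pi -ex.
have PiX : 600 * Pi%:R ^+ 3 * X <= 1.
  rewrite /X exprVn ler_pdivrMr ?exprn_gt0 // mul1r.
  by have := n600; rewrite -(ler_nat R) natrM !natrX.
have Pi1 : 1 <= Pi%:R :> R by rewrite ler1n.
have Pi2 : Pi%:R <= Pi%:R ^+ 2 :> R by rewrite expr2; nra.
have Pi3 : Pi%:R ^+ 2 <= Pi%:R ^+ 3 :> R by rewrite exprS [_ ^+ 3]exprS ler_wpM2l.
have PX3 : Pi%:R * X <= Pi%:R ^+ 3 * X by rewrite ler_wpM2r ?(ltW X0) //; lra.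
have X1 : X <= Pi%:R * X by rewrite -{1}[X]mul1r ler_wpM2r ?(ltW X0).
have eta2 : 2 * eta <= 1 / 2 by rewrite /eta; lra.
have Pieta : Pi%:R * (2 * eta) <= 1 / 2 :> R.
  have -> : Pi%:R * (2 * eta) = 6 * (Pi%:R * X) by rewrite /eta; ring.
  lra.
(* As [v ^ 13 <= Pi], the base is at most [10 * Pi]; its square times [6 * Pi * X] gives the factor
   600. *)
have B2eta : (4 * (Pi + v ^ 13) + 2)%:R ^+ 2 * (Pi%:R * (2 * eta)) <= 1 :> R.
  apply: le_trans PiX.
  have b10 : (4 * (Pi + v ^ 13) + 2)%:R <= 10 * Pi%:R :> R.
    rewrite -natrM ler_nat; suff ar (a b : nat) : (a <= b)%N -> (0 < b)%N ->
      (4 * (b + a) + 2 <= 10 * b)%N by exact: ar.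
    by clear; lia.
  have -> : 600 * Pi%:R ^+ 3 * X = (10 * Pi%:R) ^+ 2 * (Pi%:R * (2 * eta)) by rewrite
    /eta; ring.
  have e0 : 0 <= Pi%:R * (2 * eta) by rewrite mulr_ge0 // mulr_ge0 // ltW.
  by rewrite ler_wpM2r // ler_sqr ?nnegrE // mulr_ge0.
have v160 : 160 * 160 <= v%:R :> R.
  rewrite -natrM ler_nat; apply: leq_trans Vv; rewrite /V.
  by apply: leq_trans (leq_addr _ _); exact: leq_addl.
have e20 : 0 < 2 * eta by rewrite mulr_gt0.
apply: (endgame irr tr LE0 e20 eta2 _ near_s (@card_incomp d P N) Pieta B2eta v160 (x :=
  inner N x) LPi).
  by rewrite expn_gt0 v0.
by rewrite card_incomp_inner hx.
Qed.
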